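(* Let $\mathcal{T}$ be a set of monomials in variables $x_1,\dots,x_n$. In the RAM model: (a) it can be verified in time polynomial in $|\mathcal{T}|$ and $n$ whether $\mathcal{T}$ has the monomial intersection property; (b) if $\mathcal{T}$ has the monomial intersection property, then the problem $\min\{\sum_{m\in\mathcal{T}}a_m\prod_{i\in m}x_i : x\in\{0,1\}^n\}$ with coefficients $a\in\mathbb{Q}^{\mathcal{T}}$ can be solved in polynomial time.
   Context: A monomial is a nonempty subset $m\subseteq[n]=\{1,\dots,n\}$. A set $\mathcal{T}$ of monomials has the monomial intersection property if neither of the following holds: (A) there exist $m_1,m_2,m_3\in\mathcal{T}$ with $m_1\cap m_2\cap m_3\ne\emptyset$ such that $m_3\cap(m_1\cup m_2)$ is a proper superset of both $m_3\cap m_1$ and $m_3\cap m_2$; (B) there exist pairwise different $m_1,\dots,m_k\in\mathcal{T}$, $k\ge3$, such that for all $i,j\in[k]$, $m_i\cap m_j\ne\emptyset$ if and only if $i$ and $j$ differ by at most $1$ modulo $k$. *)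

(* Defs.v *)
From HB Require Import structures.
From mathcomp Require Import all_boot all_order all_algebra.
Set Implicit Arguments. Unset Strict Implicit. Unset Printing Implicit Defensive.
Import Order.TTheory GRing.Theory Num.Theory.

(* A monomial over variables x_1..x_n is a nonempty subset of 'I_n     *)
(* (index i : 'I_n stands for variable x_{i+1}).                      *)

Definition condA n (T : {set {set 'I_n}}) : Prop :=
  exists m1 m2 m3, [/\ [&& m1 \in T, m2 \in T & m3 \in T],
    m1 :&: m2 :&: m3 != set0,
    (m3 :&: m1) \proper (m3 :&: (m1 :|: m2)) &
    (m3 :&: m2) \proper (m3 :&: (m1 :|: m2))].

Definition cyc_adj (k i j : nat) : bool :=
  [|| i == j, i.+1 %% k == j | j.+1 %% k == i].

(* condition (B): a chordless "cycle" m_1,...,m_k (k >= 3) of pairwise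
   different monomials of T, indexed here 0..k-1 *)
Definition condB n (T : {set {set 'I_n}}) : Prop :=
  exists ms : seq {set 'I_n}, [/\ 3 <= size ms, uniq ms,
    all (fun m => m \in T) ms &
    forall i j, i < size ms -> j < size ms ->
      (nth set0 ms i :&: nth set0 ms j != set0) = cyc_adj (size ms) i j].

Definition monomial_intersection_property n (T : {set {set 'I_n}}) : Prop :=
  ~ condA T /\ ~ condB T.

Definition objective n (T : {set {set 'I_n}}) (a : {set 'I_n} -> rat)
  (x : 'I_n -> bool) : rat :=
  (\sum_(m in T) a m * \prod_(i in m) (if x i then 1 else 0))%R.

(* RAM model: a random access machine with unbounded integer registers *)
(* R_0, R_1, ..., indirect addressing, and the logarithmic cost        *)
(* criterion (each step costs 1 + the bit lengths of all values it      *)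
(* touches).  This model is polynomially equivalent to Turing machines *)
(* (bit complexity).                                                  *)

Inductive instr : Type :=
| IConst of nat & int
| IAdd of nat & nat & nat
| ISub of nat & nat & nat
| IMul of nat & nat & nat
| IDiv of nat & nat & nat      (* R[r] := R[a] div R[b] (0 if R[b]=0) *)
| ILoad of nat & nat
| IStore of nat & nat
| IJpos of nat & nat
| IJmp of nat
| IHalt.

Definition regs := nat -> int.

Definition upd (R : regs) (r : nat) (v : int) : regs :=
  fun i => if i == r then v else R i.

Definition bitlen (z : int) : nat := (trunc_log 2 `|z|%N).+1.

(* one step: new pc, new registers, cost; None when halted
   (IHalt, or pc outside the program) *)
Definition step (P : seq instr) (pc : nat) (R : regs)
  : option (nat * regs * nat) :=
  match nth IHalt P pc with
  | IConst r c => Some (pc.+1, upd R r c, (bitlen c).+1)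
  | IAdd r a b => Some (pc.+1, upd R r (R a + R b)%R,
                        (bitlen (R a) + bitlen (R b) + bitlen (R a + R b)%R).+1)
  | ISub r a b => Some (pc.+1, upd R r (R a - R b)%R,
                        (bitlen (R a) + bitlen (R b) + bitlen (R a - R b)%R).+1)
  | IMul r a b => Some (pc.+1, upd R r (R a * R b)%R,
                        (bitlen (R a) + bitlen (R b) + bitlen (R a * R b)%R).+1)
  | IDiv r a b => Some (pc.+1, upd R r (divz (R a) (R b)),
                        (bitlen (R a) + bitlen (R b) + bitlen (divz (R a) (R b))).+1)
  | ILoad r a => Some (pc.+1, upd R r (R `|R a|%N),
                        (bitlen (R a) + bitlen (R `|R a|%N)).+1)
  | IStore a r => Some (pc.+1, upd R `|R a|%N (R r),
                        (bitlen (R a) + bitlen (R r)).+1)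
  | IJpos r l => Some (if (0 < R r)%R then l else pc.+1, R, (bitlen (R r)).+1)
  | IJmp l => Some (l, R, 1)
  | IHalt => None
  end.

Fixpoint exec (P : seq instr) (fuel : nat) (pc : nat) (R : regs)
  : option (regs * nat) :=
  match fuel with
  | 0 => None
  | f.+1 =>
    match step P pc R with
    | None => Some (R, 0)
    | Some (pc', R', c) =>
      match exec P f pc' R' with
      | None => None
      | Some (Rf, c') => Some (Rf, c + c')
      end
    end
  end.

Definition init_regs (inp : seq int) : regs :=
  fun i => if i == 0 then Posz (size inp) else nth 0%R inp i.-1.

Definition runs_within (P : seq instr) (inp : seq int) (bound : nat)
  (Q : regs -> Prop) : Prop :=
  exists fuel Rf c, exec P fuel 0 (init_regs inp) = Some (Rf, c)
                    /\ c <= bound /\ Q Rf.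

Definition enc_mono n (m : {set 'I_n}) : seq int :=
  Posz #|m| :: [seq Posz (val i).+1 | i <- enum m].

Definition enc_monos n (s : seq {set 'I_n}) : seq int :=
  [:: Posz n; Posz (size s)] ++ flatten [seq enc_mono m | m <- s].

Definition enc_inst n (s : seq {set 'I_n}) (a : {set 'I_n} -> rat) : seq int :=
  enc_monos s ++ flatten [seq [:: numq (a m); denq (a m)] | m <- s].

Definition ratsize (q : rat) : nat := bitlen (numq q) + bitlen (denq q).

(* Main.v *)
(* Condition (B) with k = 3 forbids three distinct pairwise intersecting
   monomials, and (A) produces such a triple.  Hence the property says that the
   intersection graph of T is a forest, which is recognised by repeatedly
   deleting vertices of degree at most one.

   In a forest, as long as variables are left, some variable x_i is such that
   the monomials through it, restricted to the remaining variables, form a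
   chain.  Minimising over x_i then only changes the coefficients of these
   monomials, into differences of terms min(0, prefix sum), and deletes i from
   them.  After n eliminations the objective is a constant, and optimal values
   are recovered in reverse order.  A common denominator makes all
   coefficients integral.

   The programs are written in a language all of whose loops run to one bound N
   that is polynomial in the size of the instance, so that the number of steps
   is polynomial whatever the data.  Each step lengthens the numbers by at most
   b bits, provided that one factor of each product has at most b bits, so that
   the logarithmic cost is polynomial as well. *)
Require Import Defs.
From HB Require Import structures.
From mathcomp Require Import all_boot all_order all_algebra zify.
Set Implicit Arguments. Unset Strict Implicit. Unset Printing Implicit Defensive.
Import Order.TTheory GRing.Theory Num.Theory.

(** * Steps of the machine and growth of numbers *)

(** The crux is that eliminations create no new monomials. Minimising over one variable of a general
    polynomial yields an arbitrary function of its neighbours. Along a chain, however, the products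
    that equal 1 form an initial segment, so the minimum takes one value per segment and is again a
    combination of the same products. Restricting monomials to the remaining variables only removes
    edges from the intersection graph, so the forest property never has to be re-established.

    The other obstacle is the logarithmic cost: polynomially many multiplications could square a
    number again and again. Hence the number of steps is read off the syntax of a program, and the
    shortness of second factors is treated separately. Apart from addresses, only the common
    denominator involves products; the eliminations add, subtract and compare with 0. *)

Definition small b (z : int) : bool := `|z| < 2 ^ b.

(** Constants and products are the only instructions that can lengthen numbers by more than one bit.
    It is the second factor of a product that has to be short. *)
Definition tame b (i : instr) (R : regs) : bool :=
  match i with
  | IConst _ z => small b z
  | IMul _ _ y => small b (R y)
  | _ => true
  end.

(** Counts steps and forgets their costs, which are recovered all at once in [steps_exec]. *)
Inductive steps (P : seq instr) (b : nat) : nat -> nat -> regs -> nat -> regs -> Prop :=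
| steps0 pc R : steps P b 0 pc R pc R
| stepsS T pc R pc1 R1 c pc2 R2 :
    step P pc R = Some (pc1, R1, c) -> tame b (nth IHalt P pc) R ->
    steps P b T pc1 R1 pc2 R2 -> steps P b T.+1 pc R pc2 R2.

Lemma steps_trans P b T1 T2 pc1 R1 pc2 R2 pc3 R3 :
  steps P b T1 pc1 R1 pc2 R2 -> steps P b T2 pc2 R2 pc3 R3 ->
  steps P b (T1 + T2) pc1 R1 pc3 R3.
Proof.
elim=> {T1 pc1 R1 pc2 R2} [//|T1 pc1 R1 pc2 R2 c pc4 R4 st tm _ IH] /IH.
exact: stepsS st tm.
Qed.

Lemma small_leq a b z : a <= b -> small a z -> small b z.
Proof. by move=> le_ab /leq_trans; apply; rewrite leq_exp2l. Qed.

Lemma small_bitlen b z : 0 < b -> small b z -> bitlen z <= b.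
Proof.
rewrite /small /bitlen => b_gt0 zb.
have [->|z_neq0] := eqVneq `|z| 0; first by rewrite trunc_log0.
rewrite -(@ltn_exp2l 2) //; apply: leq_ltn_trans zb.
by apply: trunc_logP => //; rewrite lt0n.
Qed.

(** A sum or difference at most doubles the bound, which uses one of the [b > 0] extra bits; a
    product adds bit lengths, and a quotient is no longer than its dividend. A step touches at most
    three numbers. *)
Lemma step_growth P b0 b pc R pc' R' c :
  0 < b0 -> 0 < b -> (forall i, small b0 (R i)) -> tame b (nth IHalt P pc) R ->
  step P pc R = Some (pc', R', c) ->
  (forall i, small (b0 + b) (R' i)) /\ c <= 3 * (b0 + b) + 1.
Proof.
move=> b0_gt0 b_gt0 Rb0.
have Rb i : small (b0 + b) (R i) by apply: small_leq (Rb0 i); lia.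
have bl z : small (b0 + b) z -> bitlen z <= b0 + b.
  by apply: small_bitlen; lia.
have add_small i j : small (b0 + b) (R i + R j)%R /\ small (b0 + b) (R i - R j)%R.
  have := Rb0 i; have := Rb0 j; rewrite /small expnD => ri rj.
  have : 2 <= 2 ^ b by rewrite -{1}(expn1 2) leq_exp2l.
  by split; nia.
have upd_small r z : small (b0 + b) z -> forall i, small (b0 + b) (upd R r z i).
  by move=> zb i; rewrite /upd; case: eqP.
rewrite /step; case: (nth IHalt P pc) => //=.
- move=> r z zb [_ <- <-]; have zb' : small (b0 + b) z by apply: small_leq zb; lia.
  by split; [apply: upd_small | have := bl _ zb'; lia].
- move=> r x y _ [_ <- <-]; have [? _] := add_small x y; split; first exact: upd_small.
  by have := bl _ (Rb x); have := bl _ (Rb y); have := bl (R x + R y)%R; lia.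
- move=> r x y _ [_ <- <-]; have [_ ?] := add_small x y; split; first exact: upd_small.
  by have := bl _ (Rb x); have := bl _ (Rb y); have := bl (R x - R y)%R; lia.
- move=> r x y yb [_ <- <-].
  have xyb : small (b0 + b) (R x * R y)%R.
    have := Rb0 x; rewrite /small expnD abszM => xb; exact: ltn_mul.
  split; first exact: upd_small.
  by have := bl _ (Rb x); have := bl _ (Rb y); have := bl _ xyb; lia.
- move=> r x y _ [_ <- <-].
  have xyb : small (b0 + b) (divz (R x) (R y)).
    exact: leq_ltn_trans (lez_div _ _) (Rb x).
  split; first exact: upd_small.
  by have := bl _ (Rb x); have := bl _ (Rb y); have := bl _ xyb; lia.
- move=> r x _ [_ <- <-]; split; first exact: upd_small.
  by have := bl _ (Rb x); have := bl _ (Rb `|R x|); lia.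
- move=> x r _ [_ <- <-]; split; first exact: upd_small.
  by have := bl _ (Rb x); have := bl _ (Rb r); lia.
- move=> r l _ [_ <- <-]; split=> //.
  by have := bl _ (Rb r); lia.
- by move=> l _ [_ <- <-]; split=> //; lia.
Qed.

(** After [t] steps numbers have at most [b0 + t * b] bits, so the bound for the last step serves
    for each of the [T] steps. One more unit of fuel is spent on noticing the halt. *)
Lemma steps_exec P b T pc R pc' R' b0 :
  steps P b T pc R pc' R' -> nth IHalt P pc' = IHalt ->
  0 < b0 -> 0 < b -> (forall i, small b0 (R i)) ->
  exists2 c, exec P T.+1 pc R = Some (R', c) & c <= T * (3 * (b0 + T * b) + 1).
Proof.
move=> st halt b0_gt0 b_gt0; elim: st b0 b0_gt0 halt => {T pc R pc' R'}.
  by move=> pc R b0 _ /= halt _; exists 0 => //; rewrite /step halt.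
move=> T pc R pc1 R1 c pc2 R2 st tm _ IH b0 b0_gt0 halt Rb0.
have [R1b cb] := step_growth b0_gt0 b_gt0 Rb0 tm st.
have [|c' ex c'b] := IH (b0 + b) _ halt R1b; first by lia.
exists (c + c'); first by
  rewrite -[exec P T.+2 pc R]/(if step P pc R is Some (pc', R', c)
    then if exec P T.+1 pc' R' is Some (Rf, c') then Some (Rf, c + c') else None
    else Some (R, 0)) st ex.
apply: (@leq_trans (3 * (b0 + b) + 1 + T * (3 * (b0 + b + T * b) + 1))); first lia.
nia.
Qed.

Definition code_at (P : seq instr) pc (cs : seq instr) :=
  forall i, i < size cs -> nth IHalt P (pc + i) = nth IHalt cs i.

Lemma code_at_cat P pc c1 c2 :
  code_at P pc (c1 ++ c2) <-> code_at P pc c1 /\ code_at P (pc + size c1) c2.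
Proof.
split=> [H|[H1 H2] i].
  split=> i i_lt.
    by have := H i; rewrite nth_cat i_lt size_cat => -> //; lia.
  have := H (size c1 + i); rewrite nth_cat size_cat addnA addKn => -> //; last by lia.
  by case: ltnP => //; lia.
rewrite size_cat nth_cat => i_lt; case: ltnP => ci; first exact: H1.
by have := H2 (i - size c1); rewrite -addnA subnKC // => ->//; lia.
Qed.

(** * A language of bounded loops and its compilation *)

Inductive binop := Badd | Bsub | Bmul | Bdiv.

Definition binstr o : nat -> nat -> nat -> instr :=
  match o with Badd => IAdd | Bsub => ISub | Bmul => IMul | Bdiv => IDiv end.

Definition bfun o : int -> int -> int :=
  match o with
  | Badd => fun x y => (x + y)%R | Bsub => fun x y => (x - y)%R
  | Bmul => fun x y => (x * y)%R | Bdiv => divz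
  end.

(** [ELim] is the common bound of all loops, kept in register 0. [ESum] is the only iteration inside
    expressions; counting and bounded quantification are derived from it. *)
Inductive expr :=
| EConst of int
| EVar of nat
| ELim
| EPeek of expr
| EBin of binop & expr & expr
| EIf of expr & expr & expr
| ESum of nat & expr.

Inductive cmd :=
| CSkip
| CPoke of expr & expr
| CSeq of cmd & cmd
| CIf of expr & cmd & cmd
| CFor of nat & cmd.

Definition memory := nat -> int.

(** The machine addresses by absolute value, so negative addresses would alias others; compiled code
    tests the sign and follows the convention chosen here. *)
Definition rd (mem : memory) (z : int) : int := if z is Posz x then mem x else 0%R.
Definition wr (mem : memory) (z v : int) : memory :=
  if z is Posz x then upd mem x v else mem.

Fixpoint ev (N : nat) (env : nat -> int) (mem : memory) (e : expr) : int :=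
  match e with
  | EConst z => z
  | EVar k => env k
  | ELim => N
  | EPeek e => rd mem (ev N env mem e)
  | EBin o e1 e2 => bfun o (ev N env mem e1) (ev N env mem e2)
  | EIf e1 e2 e3 => if (0 < ev N env mem e1)%R then ev N env mem e2 else ev N env mem e3
  | ESum k e => (\sum_(0 <= i < N) ev N (upd env k (Posz i)) mem e)%R
  end.

Fixpoint ex (N : nat) (env : nat -> int) (c : cmd) (mem : memory) : memory :=
  match c with
  | CSkip => mem
  | CPoke e1 e2 => wr mem (ev N env mem e1) (ev N env mem e2)
  | CSeq c1 c2 => ex N env c2 (ex N env c1 mem)
  | CIf e c1 c2 => if (0 < ev N env mem e)%R then ex N env c1 mem else ex N env c2 mem
  | CFor k c => foldl (fun m i => ex N (upd env k (Posz i)) c m) mem (iota 0 N)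
  end.

(* No condition is needed on sums, differences and quotients: they lengthen
   numbers by at most one bit. *)
Fixpoint safe N b env mem (e : expr) : Prop :=
  match e with
  | EConst z => small b z
  | EVar _ | ELim => True
  | EPeek e => safe N b env mem e
  | EBin o e1 e2 => [/\ safe N b env mem e1, safe N b env mem e2 &
      if o is Bmul then small b (ev N env mem e2) : Prop else True]
  | EIf e1 e2 e3 => safe N b env mem e1 /\
      (if (0 < ev N env mem e1)%R then safe N b env mem e2 else safe N b env mem e3)
  | ESum k e => forall i, i < N -> safe N b (upd env k (Posz i)) mem e
  end.

Fixpoint safec N b env mem (c : cmd) : Prop :=
  match c with
  | CSkip => True
  | CPoke e1 e2 => safe N b env mem e1 /\ safe N b env mem e2
  | CSeq c1 c2 => safec N b env mem c1 /\ safec N b env (ex N env c1 mem) c2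
  | CIf e c1 c2 => safe N b env mem e /\
      (if (0 < ev N env mem e)%R then safec N b env mem c1 else safec N b env mem c2)
  | CFor k c => forall i, i < N -> safec N b (upd env k (Posz i))
      (foldl (fun m i => ex N (upd env k (Posz i)) c m) mem (iota 0 i)) c
  end.

(* Registers [1 .. nv] hold the variables, registers [nv+1 .. K-1] are
   temporaries, and memory cell [x] is register [K + x]. *)
Definition nv := 12.

(* Register [d] accumulates what the body leaves in [d.+3]; this is meaningless
   when the body is a command. *)
Definition cloop pc d k (body : seq instr) : seq instr :=
  let b := size body in
  [:: IConst d 0; IConst d.+1 0; IConst d.+3 0; IAdd d.+2 k.+1 d.+3;
      ISub d.+3 0 d.+1; IJpos d.+3 (pc + 7); IJmp (pc + 13 + b);
      IConst d.+3 0; IAdd k.+1 d.+1 d.+3] ++ body ++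
  [:: IAdd d d d.+3; IConst d.+3 1; IAdd d.+1 d.+1 d.+3; IJmp (pc + 4);
      IConst d.+3 0; IAdd k.+1 d.+2 d.+3].

(** The value is left in register [d], and the registers from [d] on serve as evaluation stack.
    Jumps are absolute, whence the argument [pc]; the branch for a failed test comes first because
    [IJpos] leaps forward over it. *)
Fixpoint ce K pc d (e : expr) : seq instr :=
  match e with
  | EConst z => [:: IConst d z]
  | EVar k => [:: IConst d 0; IAdd d k.+1 d]
  | ELim => [:: IConst d 0; IAdd d 0 d]
  | EPeek e =>
    let c := ce K pc d e in let q := pc + size c in
    c ++ [:: IConst d.+1 1; IAdd d.+1 d d.+1; IJpos d.+1 (q + 5);
             IConst d 0; IJmp (q + 8); IConst d.+1 K; IAdd d d d.+1; ILoad d d]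
  | EBin o e1 e2 =>
    let c1 := ce K pc d e1 in let c2 := ce K (pc + size c1) d.+1 e2 in
    c1 ++ c2 ++ [:: binstr o d d d.+1]
  | EIf e1 e2 e3 =>
    let c1 := ce K pc d e1 in
    let c3 := ce K (pc + size c1 + 1) d e3 in
    let q := pc + size c1 + 1 + size c3 + 1 in
    let c2 := ce K q d e2 in
    c1 ++ [:: IJpos d q] ++ c3 ++ [:: IJmp (q + size c2)] ++ c2
  | ESum k e => cloop pc d k (ce K (pc + 9) d.+3 e)
  end.

Fixpoint cc K pc d (c : cmd) : seq instr :=
  match c with
  | CSkip => [::]
  | CPoke e1 e2 =>
    let c1 := ce K pc d e1 in let c2 := ce K (pc + size c1) d.+1 e2 in
    let q := pc + size c1 + size c2 in
    c1 ++ c2 ++ [:: IConst d.+2 1; IAdd d.+2 d d.+2; IJpos d.+2 (q + 4); IJmp (q + 7);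
                    IConst d.+2 K; IAdd d d d.+2; IStore d d.+1]
  | CSeq c1 c2 => let s1 := cc K pc d c1 in s1 ++ cc K (pc + size s1) d c2
  | CIf e1 c2 c3 =>
    let s1 := ce K pc d e1 in
    let s3 := cc K (pc + size s1 + 1) d c3 in
    let q := pc + size s1 + 1 + size s3 + 1 in
    let s2 := cc K q d c2 in
    s1 ++ [:: IJpos d q] ++ s3 ++ [:: IJmp (q + size s2)] ++ s2
  | CFor k c => cloop pc d k (cc K (pc + 9) d.+3 c)
  end.

Fixpoint wf K d (e : expr) : bool :=
  match e with
  | EConst _ | ELim => d < K
  | EVar k => (d < K) && (k < nv)
  | EPeek e => (d.+1 < K) && wf K d e
  | EBin _ e1 e2 => [&& d.+1 < K, wf K d e1 & wf K d.+1 e2]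
  | EIf e1 e2 e3 => [&& wf K d e1, wf K d e2 & wf K d e3]
  | ESum k e => [&& k < nv, d.+3 < K & wf K d.+3 e]
  end.

Fixpoint wfc K d (c : cmd) : bool :=
  match c with
  | CSkip => true
  | CPoke e1 e2 => [&& d.+2 < K, wf K d e1 & wf K d.+1 e2]
  | CSeq c1 c2 => wfc K d c1 && wfc K d c2
  | CIf e c1 c2 => [&& wf K d e, wfc K d c1 & wfc K d c2]
  | CFor k c => [&& k < nv, d.+3 < K & wfc K d.+3 c]
  end.

(** Both branches of a test are charged, so that the bound is a polynomial in [N] that does not see
    the data. A loop has an overhead of 8 steps per round and of 9 for entry and exit. *)
Fixpoint tm N (e : expr) : nat :=
  match e with
  | EConst _ | EVar _ | ELim => 2
  | EPeek e => tm N e + 8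
  | EBin _ e1 e2 => tm N e1 + tm N e2 + 1
  | EIf e1 e2 e3 => tm N e1 + tm N e2 + tm N e3 + 2
  | ESum _ e => 9 + N * (tm N e + 8)
  end.

Fixpoint tmc N (c : cmd) : nat :=
  match c with
  | CSkip => 0
  | CPoke e1 e2 => tm N e1 + tm N e2 + 8
  | CSeq c1 c2 => tmc N c1 + tmc N c2
  | CIf e c1 c2 => tm N e + tmc N c1 + tmc N c2 + 2
  | CFor _ c => 9 + N * (tmc N c + 8)
  end.

Definition basic (i : instr) : bool :=
  match i with IJpos _ _ | IJmp _ | IHalt => false | _ => true end.

Definition apply_instr (i : instr) (R : regs) : regs :=
  match i with
  | IConst r z => upd R r z
  | IAdd r x y => upd R r (R x + R y)%R
  | ISub r x y => upd R r (R x - R y)%R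
  | IMul r x y => upd R r (R x * R y)%R
  | IDiv r x y => upd R r (divz (R x) (R y))
  | ILoad r x => upd R r (R `|R x|)
  | IStore x r => upd R `|R x| (R r)
  | IJpos _ _ | IJmp _ | IHalt => R
  end.

Section Stepping.
Variables (P : seq instr) (b q : nat) (cs : seq instr).
Hypothesis code : code_at P q cs.

Lemma steps_basic j T R pc2 R2 :
  j < size cs -> basic (nth IHalt cs j) -> tame b (nth IHalt cs j) R ->
  steps P b T (q + j.+1) (apply_instr (nth IHalt cs j) R) pc2 R2 ->
  steps P b T.+1 (q + j) R pc2 R2.
Proof.
move=> j_lt bs tm; rewrite addnS; have Pj := code j_lt.
have step_j := stepsS (P := P) (b := b) (pc := q + j) (R := R).
have {step_j} : exists c, step P (q + j) R = Some ((q + j).+1, apply_instr (nth IHalt cs j) R, c).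
  by rewrite /step Pj; move: bs; case: (nth IHalt cs j) => //= *; eexists.
by case=> c st; apply: stepsS st _; rewrite Pj.
Qed.

Lemma steps_jpos j T R r l pc2 R2 :
  j < size cs -> nth IHalt cs j = IJpos r l ->
  steps P b T (if (0 < R r)%R then l else q + j.+1) R pc2 R2 ->
  steps P b T.+1 (q + j) R pc2 R2.
Proof.
move=> j_lt csj; have := code j_lt; rewrite csj addnS => Pj.
by apply: stepsS; [rewrite /step Pj | rewrite Pj].
Qed.

Lemma steps_jmp j T R l pc2 R2 :
  j < size cs -> nth IHalt cs j = IJmp l ->
  steps P b T l R pc2 R2 -> steps P b T.+1 (q + j) R pc2 R2.
Proof.
move=> j_lt csj; have := code j_lt; rewrite csj => Pj.
by apply: stepsS; [rewrite /step Pj | rewrite Pj].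
Qed.

End Stepping.

Ltac upds := rewrite /upd; repeat (case: eqP => ?); try lia; try congruence.

(** One statement for sums and for [CFor]: [M i] is the memory after [i] rounds, constant for sums,
    and the accumulated value is claimed only under [pure], which becomes [True] for sums and
    [False] for commands. *)
Lemma cloop_ok P b (K N pc d k : nat) body (t : nat) (M : nat -> memory) (pure : Prop) (f : nat -> int) (R0 : regs) :
  0 < b -> code_at P pc (cloop pc d k body) -> nv < d -> d.+3 < K -> k < nv ->
  R0 0 = N -> (forall x, R0 (K + x) = M 0 x) ->
  (forall i (R1 : regs), i < N -> (forall x, x < d -> x <> k.+1 -> R1 x = R0 x) ->
     R1 k.+1 = i -> (forall x, R1 (K + x) = M i x) ->
     exists T R2, [/\ steps P b T (pc + 9) R1 (pc + 9 + size body) R2, T <= t,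
       forall x, x < d.+3 -> R2 x = R1 x, forall x, R2 (K + x) = M i.+1 x
       & pure -> R2 d.+3 = f i]) ->
  exists T R', [/\ steps P b T pc R0 (pc + size (cloop pc d k body)) R',
    T <= 9 + N * (t + 8), forall x, x < d -> R' x = R0 x,
    forall x, R' (K + x) = M N x &
    pure -> R' d = (\sum_(0 <= i < N) f i)%R].
Proof.
move=> b_gt0 code nv_d d_K k_nv R0_0 R0_M body_ok.
have s0 : small b 0 by rewrite /small expn_gt0.
have s1 : small b 1 by rewrite /small (@ltn_exp2l 2 0).
have [code1 code23] := (code_at_cat _ _ _ _).1 code.
have [codeb code3] := (code_at_cat _ _ _ _).1 code23.
set s := size body in code1 code3 *.
have -> : pc + size (cloop pc d k body) = pc + 9 + s + 6.
  by rewrite /cloop !size_cat /= /s; lia.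
rewrite /= -/s in code1 code3.
(* [n] rounds are left and [i] are done. Register [d.+2] keeps the outer value of the loop variable
   until the exit restores it. *)
have loop n : forall i (R : regs), n + i = N ->
    (forall x, x < d -> x <> k.+1 -> R x = R0 x) -> R d.+1 = i -> R d.+2 = R0 k.+1 ->
    (forall x, R (K + x) = M i x) -> (pure -> R d = (\sum_(0 <= j < i) f j)%R) ->
  exists T R', [/\ steps P b T (pc + 4) R (pc + 9 + s + 6) R',
    T <= n * (t + 8) + 5, forall x, x < d -> R' x = R0 x,
    forall x, R' (K + x) = M N x &
    pure -> R' d = (\sum_(0 <= i < N) f i)%R].
  elim: n => [|n IH] i R nE R_R0 R_i R_k R_M R_sum.
    have {nE}iN : i = N by lia.
    rewrite {}iN in R_i R_M R_sum; eexists; eexists; split.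
    - apply: (steps_basic code1) => //=.
      apply: (steps_jpos code1) => //=.
      have -> : (0 < upd R d.+3 (R 0 - R d.+1) d.+3)%R = false.
        by rewrite (R_R0 0) // ?R0_0 ?R_i; upds.
      apply: (steps_jmp code1) => //.
      have -> : pc + 13 + s = pc + 9 + s + 4 by lia.
      apply: (steps_basic code3) => //=.
      by apply: (steps_basic code3) => //=; apply: steps0.
    - lia.
    - move=> x x_d; case: (x =P k.+1) => [->|x_k]; last by rewrite -R_R0 //; upds.
      by rewrite -R_k; upds; rewrite addr0.
    - by move=> x; rewrite -R_M; upds.
    - by move=> p; rewrite -R_sum //; upds.
  pose R1 := apply_instr (IAdd k.+1 d.+1 d.+3) (apply_instr (IConst d.+3 0)
               (apply_instr (ISub d.+3 0 d.+1) R)).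
  have R1_R x : x <> k.+1 -> x <> d.+3 -> R1 x = R x by move=> ? ?; rewrite /R1 /=; upds.
  have R1_k : R1 k.+1 = i by rewrite -R_i /R1 /=; upds; rewrite addr0.
  have [|x x_d x_k|| x |T [R2 [st Tt R2_R1 R2_M R2_f]]] := body_ok i R1.
  - lia.
  - by rewrite R1_R ?R_R0 //; lia.
  - exact: R1_k.
  - by rewrite R1_R ?R_M //; lia.
  pose R3 := apply_instr (IAdd d.+1 d.+1 d.+3) (apply_instr (IConst d.+3 1)
               (apply_instr (IAdd d d d.+3) R2)).
  have R3_R2 x : x <> d -> x <> d.+1 -> x <> d.+3 -> R3 x = R2 x.
    by move=> *; rewrite /R3 /=; upds.
  have [||||||T' [R' [st' T't R'_R0 R'_M R'_sum]]] := IH i.+1 R3.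
  - lia.
  - by move=> x x_d x_k; rewrite R3_R2 ?R2_R1 ?R1_R ?R_R0 //; lia.
  - have -> : R3 d.+1 = (R2 d.+1 + 1)%R by rewrite /R3 /=; upds.
    by rewrite R2_R1 ?R1_R ?R_i //; lia.
  - by rewrite R3_R2 ?R2_R1 ?R1_R //; lia.
  - by move=> x; rewrite R3_R2 ?R2_M //; lia.
  - move=> p; have -> : R3 d = (R2 d + R2 d.+3)%R by rewrite /R3 /=; upds.
    by rewrite big_nat_recr //= -R_sum // -R2_f // (R2_R1 d) ?R1_R //; lia.
  exists (4 + (T + (4 + T'))), R'; split=> //; last by nia.
  apply: (steps_basic code1) => //=; apply: (steps_jpos code1) => //=.
  have -> : (0 < upd R d.+3 (R 0 - R d.+1) d.+3)%R.
    by rewrite (R_R0 0) // ?R0_0 ?R_i; upds.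
  apply: (steps_basic code1) => //=.
  apply: (steps_basic code1) => //=.
  apply: steps_trans st _; rewrite -/s -{1}[pc + 9 + s]addn0.
  do 3 (apply: (steps_basic code3) => //=).
  by apply: (steps_jmp code3) => //; exact: st'.
pose R1 := apply_instr (IAdd d.+2 k.+1 d.+3) (apply_instr (IConst d.+3 0)
             (apply_instr (IConst d.+1 0) (apply_instr (IConst d 0) R0))).
have [||||||T [R' [st Tt R'_R0 R'_M R'_sum]]] := loop N 0 R1.
- by rewrite addn0.
- by move=> x x_d x_k; rewrite /R1 /=; upds.
- by rewrite /R1 /=; upds.
- by rewrite /R1 /=; upds; rewrite addr0.
- by move=> x; rewrite -R0_M /R1 /=; upds.
- by move=> _; rewrite big_geq // /R1 /=; upds.
exists (4 + T), R'; split=> //; last by lia.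
rewrite -{1}[pc]addn0.
do 4 (apply: (steps_basic code1) => //=).
Qed.

Lemma steps_refl P b pc pc' R : pc = pc' -> steps P b 0 pc R pc' R.
Proof. by move=> ->; apply: steps0. Qed.

Section Compile.
Variables (P : seq instr) (b K N : nat).
Hypotheses (b_gt0 : 0 < b) (K_small : small b K).

Definition models (env : nat -> int) (mem : memory) (R : regs) : Prop :=
  [/\ R 0 = N, forall k, k < nv -> R k.+1 = env k & forall x, R (K + x) = mem x].

Definition agree d (R R' : regs) : Prop :=
  forall x, (x < d) || (K <= x) -> R' x = R x.

Lemma agree_trans d1 d2 R1 R2 R3 :
  d1 <= d2 -> agree d1 R1 R2 -> agree d2 R2 R3 -> agree d1 R1 R3.
Proof.
move=> d12 R12 R23 x x_d; rewrite R23 ?R12 //.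
by case/orP: x_d => [x_d|->]; rewrite ?orbT // (leq_trans x_d).
Qed.

Lemma models_agree d env mem R R' :
  nv < d -> models env mem R -> agree d R R' -> models env mem R'.
Proof.
move=> nv_d [R0 Rk Rm] RR'; split=> [|k k_nv|x].
- by rewrite RR' //; lia.
- by rewrite RR' ?Rk //; lia.
- by rewrite RR' // leq_addr orbT.
Qed.

Let s0 : small b 0. Proof. by rewrite /small expn_gt0. Qed.
Let s1 : small b 1. Proof. by rewrite /small (@ltn_exp2l 2 0). Qed.

Lemma ce_ok e : forall pc d env mem R,
  code_at P pc (ce K pc d e) -> nv < d -> wf K d e -> models env mem R ->
  safe N b env mem e ->
  exists T R', [/\ steps P b T pc R (pc + size (ce K pc d e)) R', T <= tm N e,
    R' d = ev N env mem e & agree d R R'].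
Proof.
elim: e => [z|k||e IH|o e1 IH1 e2 IH2|e1 IH1 e2 IH2 e3 IH3|k e IH] pc d env mem R /=.
- move=> code nv_d d_K Rm z_s.
  exists 1, (apply_instr (IConst d z) R); split=> //=.
  + by rewrite -{1}[pc]addn0; apply: (steps_basic code) => //=; exact: steps0.
  + by upds.
  + by move=> x x_d; upds.
- move=> code nv_d /andP[d_K k_nv] [R0 Rk Rm] _.
  exists 2, (apply_instr (IAdd d k.+1 d) (apply_instr (IConst d 0) R)); split=> //=.
  + rewrite -{1}[pc]addn0; do 2 (apply: (steps_basic code) => //=); exact: steps0.
  + by upds; rewrite addr0 Rk.
  + by move=> x x_d; upds.
- move=> code nv_d d_K [R0 Rk Rm] _.
  exists 2, (apply_instr (IAdd d 0 d) (apply_instr (IConst d 0) R)); split=> //=.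
  + rewrite -{1}[pc]addn0; do 2 (apply: (steps_basic code) => //=); exact: steps0.
  + by upds; rewrite addr0.
  + by move=> x x_d; upds.
- move=> /code_at_cat[code code'] nv_d /andP[d_K wfe] Rm se.
  have [T [R1 [st Tt R1d RR1]]] := IH _ _ _ _ _ code nv_d wfe Rm se.
  have [R10 R1k R1m] := models_agree nv_d Rm RR1.
  rewrite size_cat addnA; move: st code'; set q := pc + _ => st code' /=.
  suff [T' [R2 [T'8 R2d R2R1 st']]] : exists T' R2, [/\ T' <= 8,
      R2 d = rd mem (ev N env mem e), agree d R1 R2 & steps P b T' q R1 (q + 8) R2].
    exists (T + T'), R2; split=> //; [exact: steps_trans st st' | lia |].
    exact: agree_trans (leqnn _) RR1 R2R1.
  rewrite -{1}[q]addn0 -R1d; case R1dx: (R1 d) => [x|x].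
  eexists; eexists; split; last first.
  + do 2 (apply: (steps_basic code') => //=).
    apply: (steps_jpos code') => //=.
    rewrite ifT; last by upds; rewrite R1dx; lia.
    do 3 (apply: (steps_basic code') => //=); exact: steps0.
  + by move=> y y_d; upds.
  + rewrite /rd -R1m /=; set i := `|_|.
    have -> : i = K + x by rewrite /i; upds; rewrite R1dx; lia.
    by upds.
  + by [].
  eexists; eexists; split; last first.
  + do 2 (apply: (steps_basic code') => //=).
    apply: (steps_jpos code') => //=.
    rewrite ifF; last by upds; rewrite R1dx; lia.
    apply: (steps_basic code') => //=; apply: (steps_jmp code') => //=; exact: steps0.
  + by move=> y y_d; upds.
  + by upds.
  + by [].
- move=> /code_at_cat[code1 /code_at_cat[code2 code3]] nv_d /and3P[d_K wf1 wf2] Rm [se1 se2 so].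
  have [T1 [R1 [st1 Tt1 R1d RR1]]] := IH1 _ _ _ _ _ code1 nv_d wf1 Rm se1.
  have R1m := models_agree nv_d Rm RR1.
  have [T2 [R2 [st2 Tt2 R2d RR2]]] := IH2 _ _ _ _ _ code2 (leqW nv_d) wf2 R1m se2.
  rewrite 2!size_cat 2!addnA; move: st2 code3; set q := pc + _ + _ => st2 code3 /=.
  have R2d' : R2 d = ev N env mem e1 by rewrite RR2 ?R1d //; lia.
  exists (T1 + (T2 + 1)), (upd R2 d (bfun o (ev N env mem e1) (ev N env mem e2))); split.
  + apply: steps_trans st1 _; apply: steps_trans st2 _; rewrite -{1}[q]addn0 -R2d' -R2d.
    apply: (steps_basic code3) => //=; first by case: (o).
      by case: (o) so => //=; rewrite R2d.
    case: (o); exact: steps0.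
  + lia.
  + by rewrite /upd eqxx.
  + apply: (agree_trans (leqnn _) RR1) => x x_d.
    by upds; rewrite RR2 //; lia.
- move=> /code_at_cat[code1]; rewrite -cat1s => /code_at_cat[codej1 /code_at_cat[code3]].
  rewrite -[IJmp _ :: _]cat1s => /code_at_cat[codej2 code2].
  move=> nv_d /and3P[wf1 wf2 wf3] Rm [se1 se23].
  have [T1 [R1 [st1 Tt1 R1d RR1]]] := IH1 _ _ _ _ _ code1 nv_d wf1 Rm se1.
  have R1m := models_agree nv_d Rm RR1.
  move: se23; rewrite -R1d; case R1pos: (0 < R1 d)%R => se23.
    have [T2 [R2 [st2 Tt2 R2d RR2]]] := IH2 _ _ _ _ _ code2 nv_d wf2 R1m se23.
    exists (T1 + (1 + T2)), R2; split=> //; [|lia|exact: agree_trans (leqnn _) RR1 RR2].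
    apply: steps_trans st1 _; rewrite -{1}[pc + _]addn0; apply: (steps_jpos codej1) => //=.
    by rewrite R1pos; move: st2; congr steps; do 2 rewrite ?size_cat /=; lia.
  have [T2 [R2 [st2 Tt2 R2d RR2]]] := IH3 _ _ _ _ _ code3 nv_d wf3 R1m se23.
  exists (T1 + (1 + (T2 + 1))), R2; split=> //; [|lia|exact: agree_trans (leqnn _) RR1 RR2].
  apply: steps_trans st1 _; rewrite -{1}[pc + _]addn0; apply: (steps_jpos codej1) => //=.
  rewrite R1pos; apply: steps_trans st2 _; rewrite -{1}[_ + size _]addn0.
  apply: (steps_jmp codej2) => //=.
  by apply: steps_refl; do 3 rewrite ?size_cat /=; lia.
- move=> code nv_d /and3P[k_nv d_K wfe] Rm se; have [R0 Rk Rmm] := Rm.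
  have [|T [R' [st Tt RR' R'm R'd]]] :=
    @cloop_ok P b K N pc d k _ (tm N e) (fun=> mem) True
      (fun i => ev N (upd env k (Posz i)) mem e) R b_gt0 code nv_d d_K k_nv R0 Rmm.
    move=> i R1 i_N R1R R1k R1m; have codee := (code_at_cat _ _ _ _).1 ((code_at_cat _ _ _ _).1 code).2.
    have Rm' : models (upd env k (Posz i)) mem R1.
      split=> // [|k' k'_nv]; first by rewrite R1R //; lia.
      by rewrite /upd; case: eqP => [->//|k'_k]; rewrite R1R ?Rk //; lia.
    have nv_d3 : nv < d.+3 by lia.
    have [T [R2 [st Tt R2d RR2]]] := IH _ _ _ _ _ codee.1 nv_d3 wfe Rm' (se i i_N).
    exists T, R2; split=> // x; last by rewrite RR2 ?R1m // leq_addr orbT.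
    by move=> x_d; rewrite RR2 ?x_d.
  exists T, R'; split=> //; first by rewrite R'd.
  move=> x /orP[x_d|x_K]; first exact: RR'.
  by rewrite -(subnKC x_K) R'm Rmm.
Qed.

Lemma cc_ok c : forall pc d env mem R,
  code_at P pc (cc K pc d c) -> nv < d -> wfc K d c -> models env mem R ->
  safec N b env mem c ->
  exists T R', [/\ steps P b T pc R (pc + size (cc K pc d c)) R', T <= tmc N c,
    models env (ex N env c mem) R' & forall x, x < d -> R' x = R x].
Proof.
elim: c => [|e1 e2|c1 IH1 c2 IH2|e1 c2 IH2 c3 IH3|k c IH] pc d env mem R /=.
- by move=> _ _ _ Rm _; exists 0, R; split=> //; rewrite addn0; apply: steps0.
- move=> /code_at_cat[code1 /code_at_cat[code2 code3]] nv_d /and3P[d_K wf1 wf2] Rm [se1 se2].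
  have [T1 [R1 [st1 Tt1 R1d RR1]]] := ce_ok code1 nv_d wf1 Rm se1.
  have R1m := models_agree nv_d Rm RR1.
  have [T2 [R2 [st2 Tt2 R2d RR2]]] := ce_ok code2 (leqW nv_d) wf2 R1m se2.
  have R2m := models_agree (leqW nv_d) R1m RR2.
  rewrite 2!size_cat 2!addnA; move: st2 code3; set q := pc + _ + _ => st2 code3 /=.
  have R2d' : R2 d = ev N env mem e1 by rewrite RR2 ?R1d //; lia.
  suff [T' [R3 [T'8 R3m R3R2 st']]] : exists T' R3, [/\ T' <= 8,
      models env (wr mem (ev N env mem e1) (ev N env mem e2)) R3,
      forall x, x < d -> R3 x = R2 x & steps P b T' q R2 (q + 7) R3].
    exists (T1 + (T2 + T')), R3; split=> //.
    + exact: steps_trans st1 (steps_trans st2 st').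
    + lia.
    + by move=> x x_d; rewrite R3R2 // RR2 ?RR1 //; lia.
  have [R20 R2k R2mm] := R2m.
  rewrite -{1}[q]addn0 -R2d -R2d'; case R2dx: (R2 d) => [x|x].
    eexists; exists (apply_instr (IStore d d.+1) (apply_instr (IAdd d d d.+2)
      (apply_instr (IConst d.+2 K) (apply_instr (IAdd d.+2 d d.+2)
      (apply_instr (IConst d.+2 1) R2))))); split; last first.
    + do 2 (apply: (steps_basic code3) => //=).
      apply: (steps_jpos code3) => //=.
      rewrite ifT; last by upds; rewrite R2dx; lia.
      do 3 (apply: (steps_basic code3) => //=); exact: steps0.
    + move=> y y_d /=; set i := `|_|.
      have -> : i = K + x by rewrite /i; upds; rewrite R2dx; lia.
      by upds.
    + have -> : apply_instr (IStore d d.+1) (apply_instr (IAdd d d d.+2)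
      (apply_instr (IConst d.+2 K) (apply_instr (IAdd d.+2 d d.+2)
      (apply_instr (IConst d.+2 1) R2)))) = upd (apply_instr (IAdd d d d.+2)
      (apply_instr (IConst d.+2 K) (apply_instr (IAdd d.+2 d d.+2)
      (apply_instr (IConst d.+2 1) R2)))) (K + x) (R2 d.+1).
        rewrite /apply_instr; congr (upd _ _ _); upds; rewrite R2dx; lia.
      split=> [|k k_nv|y] /=.
      * by rewrite -R20; upds.
      * by rewrite -R2k //; upds.
      * by rewrite /wr; upds; rewrite -R2mm; upds.
    + by [].
  eexists; eexists; split; last first.
  + do 2 (apply: (steps_basic code3) => //=).
    apply: (steps_jpos code3) => //=.
    rewrite ifF; last by upds; rewrite R2dx; lia.
    apply: (steps_jmp code3) => //=; exact: steps0.
  + by move=> y y_d; upds.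
  + split=> [|k k_nv|y] /=.
    * by rewrite -R20; upds.
    * by rewrite -R2k //; upds.
    * by rewrite -R2mm; upds.
  + by [].
- move=> /code_at_cat[code1 code2] nv_d /andP[wf1 wf2] Rm [se1 se2].
  have [T1 [R1 [st1 Tt1 R1m RR1]]] := IH1 _ _ _ _ _ code1 nv_d wf1 Rm se1.
  have [T2 [R2 [st2 Tt2 R2m RR2]]] := IH2 _ _ _ _ _ code2 nv_d wf2 R1m se2.
  exists (T1 + T2), R2; split=> //.
  + by rewrite size_cat addnA; apply: steps_trans st1 st2.
  + lia.
  + by move=> x x_d; rewrite RR2 ?RR1.
- move=> /code_at_cat[code1]; rewrite -cat1s => /code_at_cat[codej1 /code_at_cat[code3]].
  rewrite -[IJmp _ :: _]cat1s => /code_at_cat[codej2 code2].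
  move=> nv_d /and3P[wf1 wf2 wf3] Rm [se1 se23].
  have [T1 [R1 [st1 Tt1 R1d RR1]]] := ce_ok code1 nv_d wf1 Rm se1.
  have R1m := models_agree nv_d Rm RR1.
  have R1R x : x < d -> R1 x = R x by move=> x_d; rewrite RR1 ?x_d.
  move: se23; rewrite -R1d; case R1pos: (0 < R1 d)%R => se23.
    have [T2 [R2 [st2 Tt2 R2m RR2]]] := IH2 _ _ _ _ _ code2 nv_d wf2 R1m se23.
    exists (T1 + (1 + T2)), R2; split=> //; [|lia|by move=> x x_d; rewrite RR2 ?R1R].
    apply: steps_trans st1 _; rewrite -{1}[pc + _]addn0; apply: (steps_jpos codej1) => //=.
    by rewrite R1pos; move: st2; congr steps; do 2 rewrite ?size_cat /=; lia.
  have [T2 [R2 [st2 Tt2 R2m RR2]]] := IH3 _ _ _ _ _ code3 nv_d wf3 R1m se23.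
  exists (T1 + (1 + (T2 + 1))), R2; split=> //; [|lia|by move=> x x_d; rewrite RR2 ?R1R].
  apply: steps_trans st1 _; rewrite -{1}[pc + _]addn0; apply: (steps_jpos codej1) => //=.
  rewrite R1pos; apply: steps_trans st2 _; rewrite -{1}[_ + size _]addn0.
  apply: (steps_jmp codej2) => //=.
  by apply: steps_refl; do 3 rewrite ?size_cat /=; lia.
- move=> code nv_d /and3P[k_nv d_K wfe] Rm se; have [R0 Rk Rmm] := Rm.
  pose M i := foldl (fun m i => ex N (upd env k (Posz i)) c m) mem (iota 0 i).
  have [|T [R' [st Tt RR' R'm R'd]]] :=
    @cloop_ok P b K N pc d k _ (tmc N c) M False (fun=> 0%R) R b_gt0 code nv_d d_K k_nv R0 Rmm.
    move=> i R1 i_N R1R R1k R1m; have codee := (code_at_cat _ _ _ _).1 ((code_at_cat _ _ _ _).1 code).2.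
    have Rm' : models (upd env k (Posz i)) (M i) R1.
      split=> // [|k' k'_nv]; first by rewrite R1R //; lia.
      by rewrite /upd; case: eqP => [->//|k'_k]; rewrite R1R ?Rk //; lia.
    have nv_d3 : nv < d.+3 by lia.
    have [T [R2 [st Tt [_ _ R2m] RR2]]] := IH _ _ _ _ _ codee.1 nv_d3 wfe Rm' (se i i_N).
    exists T, R2; split=> // x.
    by rewrite R2m /M -addn1 iotaD foldl_cat.
  exists T, R'; split=> //; split=> //; first by rewrite RR' //; lia.
  by move=> k' k'_nv; rewrite RR' ?Rk //; lia.
Qed.

End Compile.

(* The arrays are interleaved above the first [2 * N] cells, which contain the
   input.  [Put] guards against negative indices, which would reach other
   arrays or the input. *)
Definition arr N (mem : memory) A x : int := mem (2 * N + 8 * x + A).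

Definition eadd := EBin Badd.
Definition esub := EBin Bsub.
Definition enat (x : nat) := EConst (Posz x).
Definition eaddr A e := eadd (eadd ELim ELim) (eadd (EBin Bmul e (enat 8)) (enat A)).
Definition Get A e := EPeek (eaddr A e).
Definition Put A e v := CIf (eadd e (enat 1)) (CPoke (eaddr A e) v) CSkip.

Lemma ev_addr N env mem A e x :
  ev N env mem e = Posz x -> ev N env mem (eaddr A e) = Posz (2 * N + 8 * x + A).
Proof. by rewrite /= => ->; rewrite /=; lia. Qed.

Lemma ev_get N env mem A e x :
  ev N env mem e = Posz x -> ev N env mem (Get A e) = arr N mem A x.
Proof. by move=> /(ev_addr A); rewrite /Get => H; cbn [ev]; rewrite H. Qed.

Lemma ex_put N env mem A e v x : ev N env mem e = Posz x ->
  ex N env (Put A e v) mem = upd mem (2 * N + 8 * x + A) (ev N env mem v).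
Proof.
move=> ex_e; have addr := ev_addr A ex_e; cbn [ex Put].
by rewrite addr /= ex_e /= ifT //; lia.
Qed.

Lemma arr_put N env mem A e v x B y :
  ev N env mem e = Posz x -> A < 8 -> B < 8 ->
  arr N (ex N env (Put A e v) mem) B y =
  if (B == A) && (y == x) then ev N env mem v else arr N mem B y.
Proof.
move=> /ex_put-> A8 B8; rewrite /arr /upd.
have -> : (2 * N + 8 * y + B == 2 * N + 8 * x + A) = (B == A) && (y == x); lia.
Qed.

(** A syntactic record of the arrays that a program may write; frame properties then follow without
    a look at what it computes. All writes must go through [Put]. *)
Inductive touches (As : seq nat) : cmd -> Prop :=
| touches_skip : touches As CSkip
| touches_put A e v : A \in As -> A < 8 -> touches As (Put A e v)
| touches_seq c1 c2 : touches As c1 -> touches As c2 -> touches As (CSeq c1 c2)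
| touches_if e c1 c2 : touches As c1 -> touches As c2 -> touches As (CIf e c1 c2)
| touches_for k c : touches As c -> touches As (CFor k c).

Lemma touches_frame As c N env mem z : touches As c ->
  (forall A x, A \in As -> A < 8 -> z <> 2 * N + 8 * x + A) ->
  ex N env c mem z = mem z.
Proof.
move=> ta z_out; elim: ta env mem => {c} [//|A e v A_As A8|c1 c2 _ IH1 _ IH2|e c1 c2 _ IH1 _ IH2|k c _ IH] env mem.
- case Ee: (ev N env mem e) => [x|x]; last by rewrite /= Ee ifF //; lia.
  by rewrite (ex_put _ _ Ee) /upd; case: eqP => // zE; case: (z_out A x).
- by rewrite /= IH2 IH1.
- by rewrite /=; case: ifP.
- by rewrite /=; elim: (iota 0 N) mem => //= i s IHs mem; rewrite IHs IH.
Qed.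

Lemma touches_arr As c N env mem A x : touches As c -> A \notin As -> A < 8 ->
  arr N (ex N env c mem) A x = arr N mem A x.
Proof.
move=> ta nA A8; apply: touches_frame ta _ => B y B_As B8.
by have : B != A by [apply: contraNneq nA => <-]; lia.
Qed.

Lemma touches_low As c N env mem z : touches As c -> z < 2 * N ->
  ex N env c mem z = mem z.
Proof. by move=> ta z_N; apply: touches_frame ta _ => B y _ _; lia. Qed.

(** Sufficient for safety whatever the data: each second factor is a short constant or the loop
    bound. Of the programs below, only the scaling of the coefficients falls outside this class. *)
Fixpoint plain z0 e : bool :=
  match e with
  | EConst z => `|z| <= z0
  | EVar _ | ELim => true
  | EPeek e => plain z0 e
  | EBin Bmul e1 (EConst z) => plain z0 e1 && (`|z| <= z0)
  | EBin Bmul e1 ELim => plain z0 e1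
  | EBin Bmul _ _ => false
  | EBin _ e1 e2 => plain z0 e1 && plain z0 e2
  | EIf e1 e2 e3 => [&& plain z0 e1, plain z0 e2 & plain z0 e3]
  | ESum _ e => plain z0 e
  end.

Fixpoint plainc z0 c : bool :=
  match c with
  | CSkip => true
  | CPoke e1 e2 => plain z0 e1 && plain z0 e2
  | CSeq c1 c2 => plainc z0 c1 && plainc z0 c2
  | CIf e c1 c2 => [&& plain z0 e, plainc z0 c1 & plainc z0 c2]
  | CFor _ c => plainc z0 c
  end.

Lemma plain_safe z0 N b env mem e :
  small b (Posz z0) -> small b (Posz N) -> plain z0 e -> safe N b env mem e.
Proof.
move=> z0b Nb; have cb z : `|z| <= z0 -> small b z by move=> /leq_ltn_trans; apply.
elim: e env => [z|k||e IH|o e1 IH1 e2 IH2|e1 IH1 e2 IH2 e3 IH3|k e IH] env //=.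
- exact: cb.
- exact: IH.
- case: o => [/andP[/IH1 ? /IH2 ?]|/andP[/IH1 ? /IH2 ?]||/andP[/IH1 ? /IH2 ?]] //.
  case: e2 IH2 => //= [z _ /andP[/IH1 ? /cb ?]|_ /IH1 ?]; split=> //.
- by move=> /and3P[/IH1 ? /IH2 ? /IH3 ?]; split=> //; case: ifP.
- by move=> pe i _; apply: IH.
Qed.

Lemma plainc_safe z0 N b env mem c :
  small b (Posz z0) -> small b (Posz N) -> plainc z0 c -> safec N b env mem c.
Proof.
move=> z0b Nb.
have ps e' env' mem' : plain z0 e' -> safe N b env' mem' e' by exact: plain_safe.
elim: c env mem => [|e1 e2|c1 IH1 c2 IH2|e c1 IH1 c2 IH2|k c IH] env mem //=.
- by move=> /andP[/ps ? /ps ?].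
- by move=> /andP[/IH1 ? /IH2 ?].
- by move=> /and3P[/ps ? /IH1 ? /IH2 ?]; split=> //; case: ifP.
- by move=> pc i _; apply: IH.
Qed.

(** * Straight-line code *)

Definition always_tame b (i : instr) : bool :=
  match i with IConst _ z => small b z | IMul _ _ _ => false | _ => basic i end.

Definition run_line (l : seq instr) (R : regs) : regs := foldl (fun R i => apply_instr i R) R l.

Lemma run_line_cat l1 l2 R : run_line (l1 ++ l2) R = run_line l2 (run_line l1 R).
Proof. exact: foldl_cat. Qed.

Lemma run_line_cons i l R : run_line (i :: l) R = run_line l (apply_instr i R).
Proof. by []. Qed.

Lemma run_line0 R : run_line [::] R = R. Proof. by []. Qed.

Lemma steps_line P b l pc R :
  code_at P pc l -> all (always_tame b) l ->
  steps P b (size l) pc R (pc + size l) (run_line l R).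
Proof.
elim: l pc R => [|i l IH] pc R code; first by move=> _; apply: steps_refl; rewrite addn0.
rewrite -cat1s in code; have [code1 code2] := (code_at_cat _ _ _ _).1 code.
move=> /= /andP[i_t l_t]; rewrite -{1}[pc]addn0.
have ib : basic i by move: i_t; clear; case: i.
apply: (steps_basic code1) => //=; first by move: i_t; clear; case: i.
by have := IH _ (apply_instr i R) code2 l_t; rewrite /= addn1 addSnnS.
Qed.

(** * Saving the input and delivering the output *)

(* No register is free at the start.  [R_0] becomes [2 ^ K * (size inp + n)], an
   address beyond the input from which registers [1 .. K-1] are saved; its final
   value is the bound of all loops.  The summand [n] is needed because [n] may
   exceed the length of the input. *)
Definition boot K : seq instr :=
  IAdd 0 0 1 :: nseq K (IAdd 0 0 0) ++ [:: IStore 0 1; IConst 1 1] ++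
  flatten [seq [:: IAdd 0 0 1; IStore 0 r] | r <- iota 2 (K - 2)].

(** [K] doublings give [2 ^ K * L], and each of the registers 2 to [K - 1] adds one. *)
Definition lim K L := 2 ^ K * L + K - 2.

(** Input [i] arrives in register [i.+1]. If that is below [K], it has been moved to register
    [2 ^ K * L + i], that is, [N + i + 2 - K]; memory starts at register [K]. *)
Definition in_pos K N i := if i.+1 < K then N + i + 2 - 2 * K else i.+1 - K.

Definition holds_input K N (mem : memory) (inp : seq int) : Prop :=
  forall i, i < size inp -> mem (in_pos K N i) = nth 0%R inp i.

Lemma boot_ok K n inp : 2 <= K -> 0 < size inp -> nth 0%R inp 0 = Posz n ->
  let N := lim K (size inp + n) in let R := run_line (boot K) (init_regs inp) in
  [/\ R 0 = N, holds_input K N (fun x => R (K + x)) inp &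
      forall x, N < x -> R x = 0%R].
Proof.
move=> K2 inp_gt0 inp_n N R; set L := size inp + n in N *.
have inp_L : size inp <= L by rewrite leq_addr.
have L_gt0 : 0 < L by apply: leq_trans inp_L.
(* Doubling needs no register besides [R_0], and [K] doublings of a positive number lead past the
   first [K] registers and the input alike. *)
have L_N0 : K + L <= 2 ^ K * L by have := ltn_expl K (isT : 1 < 2); nia.
pose Ri := apply_instr (IAdd 0 0 1) (init_regs inp).
have RiE x : Ri x = if x == 0 then Posz L else init_regs inp x.
  by rewrite /Ri /= /upd; case: eqP => // _; rewrite /init_regs /= inp_n.
have dbl k : forall x, run_line (nseq k (IAdd 0 0 0)) Ri x =
    if x == 0 then Posz (2 ^ k * L) else init_regs inp x.
  elim: k => [|k IH] x; first by rewrite /= RiE mul1n.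
  rewrite -addn1 nseqD run_line_cat run_line_cons run_line0 /=.
  by rewrite /upd; case: eqP => [_|x0]; rewrite !IH ?(introF eqP x0) //= addn1 expnS; lia.
pose R1 := run_line [:: IStore 0 1; IConst 1 1] (run_line (nseq K (IAdd 0 0 0)) Ri).
have sav k : k <= K - 2 -> forall x,
    run_line (flatten [seq [:: IAdd 0 0 1; IStore 0 r] | r <- iota 2 k]) R1 x =
    if x == 0 then Posz (2 ^ K * L + k) else if x == 1 then 1%R else
    if 2 ^ K * L <= x <= 2 ^ K * L + k then init_regs inp (x - 2 ^ K * L).+1
    else init_regs inp x.
  elim: k => [|k IH] kK x.
    rewrite /= ?run_line0 /R1 !run_line_cons ?run_line0 /= /upd !dbl /= addn0.
    case: eqP => [->|x1]; first by [].
    case: (x =P 0) => [->|x0]; first by rewrite ifF //; lia.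
    case: eqP => xN; case: ifP => xN' //; try lia.
    by congr init_regs; lia.
  rewrite -{1}(addn1 k) iotaD map_cat flatten_cat run_line_cat /=.
  have {}IH := IH (ltnW kK); rewrite /upd !IH /=.
  by do ![case: ifP => ?]; try lia; congr init_regs; lia.
have RE x : R x = if x == 0 then Posz N else if x == 1 then 1%R else
    if 2 ^ K * L <= x <= 2 ^ K * L + (K - 2) then init_regs inp (x - 2 ^ K * L).+1
    else init_regs inp x.
  rewrite /R /boot run_line_cons !run_line_cat sav //.
  by rewrite /N /lim addnBA.
split=> [|i i_L|x x_N].
- by rewrite RE.
- have iL := leq_trans i_L inp_L; rewrite RE /in_pos /N /lim -/L; case: (ltnP i.+1 K) => iK.
    rewrite ifF; last by lia.
    rewrite ifF; last by lia.
    rewrite ifT; last by lia.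
    by rewrite /init_regs /=; congr nth; lia.
  rewrite ifF; last by lia.
  rewrite ifF; last by lia.
  rewrite ifF; last by lia.
  by rewrite /init_regs ifF; [congr nth|]; lia.
- rewrite /N /lim in x_N; rewrite RE ifF; last by lia.
  rewrite ifF; last by lia.
  rewrite ifF; last by lia.
  rewrite /init_regs ifF; last by lia.
  by rewrite nth_default // -/L; lia.
Qed.

Definition iter_for N env k c n mem : memory :=
  foldl (fun m i => ex N (upd env k (Posz i)) c m) mem (iota 0 n).

Lemma iter_for0 N env k c mem : iter_for N env k c 0 mem = mem.
Proof. by []. Qed.

Lemma iter_forS N env k c n mem :
  iter_for N env k c n.+1 mem = ex N (upd env k (Posz n)) c (iter_for N env k c n mem).
Proof. by rewrite /iter_for -addn1 iotaD foldl_cat. Qed.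

Lemma ex_for N env k c mem : ex N env (CFor k c) mem = iter_for N env k c N mem.
Proof. by []. Qed.

Lemma ex_seq N env c1 c2 mem : ex N env (CSeq c1 c2) mem = ex N env c2 (ex N env c1 mem).
Proof. by []. Qed.

Lemma ex_if N env e c1 c2 mem : ex N env (CIf e c1 c2) mem =
  if (0 < ev N env mem e)%R then ex N env c1 mem else ex N env c2 mem.
Proof. by []. Qed.

Lemma ex_poke N env e1 e2 mem :
  ex N env (CPoke e1 e2) mem = wr mem (ev N env mem e1) (ev N env mem e2).
Proof. by []. Qed.

(* Register [i.+1] is memory cell [i.+1 - K] as soon as [K <= i.+1]. *)
Definition out_loop K : cmd :=
  CFor 0 (CIf (esub (eadd (EVar 0) (enat 2)) (enat K))
    (CPoke (esub (eadd (EVar 0) (enat 1)) (enat K)) (Get 0 (EVar 0))) CSkip).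

(** The targets lie below [2 * N], where there is no array, so that reading and writing do not
    interfere. *)
Lemma out_loop_ok K N env mem : let mem' := ex N env (out_loop K) mem in
  (forall x, arr N mem' 0 x = arr N mem 0 x) /\
  (forall i, i < N -> K <= i.+1 -> mem' (i.+1 - K) = arr N mem 0 i).
Proof.
rewrite /out_loop ex_for; set body := CIf _ _ _; set m := fun n => iter_for N env 0 body n mem.
suff H n : n <= N -> (forall x, 2 * N <= x -> m n x = mem x) /\
    (forall i, i < n -> K <= i.+1 -> m n (i.+1 - K) = arr N mem 0 i).
  by have [H1 H2] := H N (leqnn N); split=> // x; apply: H1; lia.
elim: n => [|n IH] nN; first by [].
have [IH1 IH2] := IH (ltnW nN).
have Sn : ev N (upd env 0 (Posz n)) (m n) (EVar 0) = Posz n by [].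
rewrite /m !iter_forS -/(m n) /body ex_if.
have -> : ev N (upd env 0 (Posz n)) (m n) (esub (eadd (EVar 0) (enat 2)) (enat K)) =
  (Posz n + 2 - Posz K)%R by [].
case: ifP => n_K; last first.
  by split=> // i i_n iK; case: (i =P n) => [ii|ii]; [lia | apply: IH2; lia].
have -> : ex N (upd env 0 (Posz n)) (CPoke (esub (eadd (EVar 0) (enat 1)) (enat K)) (Get 0 (EVar 0)))
  (m n) = upd (m n) (n.+1 - K) (arr N (m n) 0 n).
  rewrite ex_poke (ev_get 0 Sn).
  by have -> : ev N (upd env 0 (Posz n)) (m n) (esub (eadd (EVar 0) (enat 1)) (enat K)) =
    Posz (n.+1 - K) by rewrite /= /upd /=; lia.
split=> [x xN|i i_n iK]; rewrite /upd.
  by rewrite ifF ?IH1 //; lia.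
have -> : (i.+1 - K == n.+1 - K) = (i == n) by lia.
case: eqP => [->|i_ne]; last by apply: IH2; lia.
by rewrite /arr IH1 //; lia.
Qed.

(* Registers [1 .. K-1] are filled last, from [K-1] down to [1], so that [R_0]
   and [R_1] can serve as pointer and decrement. *)
Definition tail K : seq instr :=
  [:: IAdd 0 0 0; IConst 1 (Posz (K + 8 * (K - 2))); IAdd 0 0 1; IConst 1 8] ++
  flatten [seq [:: ILoad r 0; ISub 0 0 1] | r <- rev (iota 2 (K - 2))] ++ [:: ILoad 1 0].

(** Entry [r - 1] of array 0 is in register [K + 2 * N + 8 * (r - 1)]: memory starts at [K], the
    arrays at [2 * N], and 8 is their stride. The pointer starts at the entry for [r = K - 1] and
    goes down by 8. *)
Lemma tail_ok K N R : 2 <= K -> R 0 = Posz N ->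
  let R' := run_line (tail K) R in
  (forall r, 0 < r < K -> R' r = R (K + 2 * N + 8 * (r - 1))) /\
  (forall r, K <= r -> R' r = R r).
Proof.
move=> K2 R0 R'.
pose R1 := run_line [:: IAdd 0 0 0; IConst 1 (Posz (K + 8 * (K - 2))); IAdd 0 0 1; IConst 1 8] R.
have ld n : n <= K - 2 -> forall x,
    run_line (flatten [seq [:: ILoad r 0; ISub 0 0 1] | r <- rev (iota (K - n) n)]) R1 x =
    if x == 0 then Posz (K + 2 * N + 8 * (K - 2 - n)) else if x == 1 then 8%R else
    if K - n <= x < K then R (K + 2 * N + 8 * (x - 1)) else R x.
  elim: n => [|n IH] nK x.
    rewrite subn0 /= /R1 /run_line /= /upd /= R0.
    by do ![case: eqP => ? //]; try case: ifP => ?; lia.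
  have -> : iota (K - n.+1) n.+1 = (K - n.+1) :: iota (K - n) n by rewrite /= subnSK //; lia.
  rewrite rev_cons -cats1 map_cat flatten_cat run_line_cat.
  have {}IH := IH (ltnW nK); set R2 := run_line _ R1 in IH *.
  rewrite /= /upd !IH /=.
  have -> : (0 == K - n.+1) = false by lia.
  have -> : (1 == K - n.+1) = false by lia.
  case: (x =P 0) => x0; first lia.
  have KN : K <= K + 2 * N + 8 * (K - 2 - n) by lia.
  case: eqP => xE; last by do ![case: ifP => ?] => //; lia.
  rewrite ifF; last by lia.
  rewrite ifF; last by lia.
  rewrite ifF; last by lia.
  rewrite ifF; last by lia.
  rewrite ifT; last by lia.
  by congr R; lia.
have {}ld := ld (K - 2) (leqnn _); rewrite subKn // in ld.
have R'E x : R' x = if x == 1 then R (K + 2 * N) else run_line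
   (flatten [seq [:: ILoad r 0; ISub 0 0 1] | r <- rev (iota 2 (K - 2))]) R1 x.
  rewrite /R' /tail !run_line_cat run_line_cons run_line0 /= {1}/upd.
  case: eqP => // _; rewrite !ld /= subnn muln0 addn0.
  by do ![case: ifP => ?] => //; lia.
split=> r r_K; rewrite R'E.
  case: eqP => [->|r1]; first by congr R; lia.
  by rewrite ld; do ![case: ifP => ?] => //; lia.
by rewrite ld; do ![case: ifP => ?] => //; lia.
Qed.

Definition compile K (c : cmd) : seq instr :=
  let b := boot K in let m := cc K (size b) nv.+1 (CSeq c (out_loop K)) in b ++ m ++ tail K.

Definition run_time K (c : cmd) N :=
  size (boot K) + tmc N (CSeq c (out_loop K)) + size (tail K).

Definition run_cost K c N b :=
  run_time K c N * (3 * (b + run_time K c N * b) + 1).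

(** Programs may assume zero arrays, since the registers above [N] still have their initial value 0.
    The bound 24 gives [out_loop] its temporaries. *)
Lemma compile_ok K c n inp b (Q : (nat -> int) -> Prop) :
  let N := lim K (size inp + n) in
  24 < K -> wfc K nv.+1 c -> 0 < size inp -> nth 0%R inp 0 = Posz n -> 0 < b ->
  small b (Posz N) -> small b (Posz (K + 8 * (K - 2))) ->
  (forall i, small b (nth 0%R inp i)) ->
  (forall env mem, holds_input K N mem inp -> (forall A x, A < 8 -> arr N mem A x = 0%R) ->
     safec N b env mem c /\ Q (arr N (ex N env c mem) 0)) ->
  runs_within (compile K c) inp (run_cost K c N b)
    (fun Rf => exists2 X, Q X & forall i, i < N -> Rf i.+1 = X i).
Proof.
move=> N K_nv wf_c L_gt0 inp_n b_gt0 N_small K_small inp_small c_ok.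
have K2 : 2 <= K by lia.
have s0 : small b 0 by rewrite /small expn_gt0.
have [R0 hin R_out] := boot_ok K2 L_gt0 inp_n; set R1 := run_line _ _ in R0 hin R_out.
have smallK z : `|z| <= K + 8 * (K - 2) -> small b z.
  by move=> zK; apply: leq_ltn_trans zK K_small.
set P := compile K c.
have code : code_at P 0 P by [].
have [code1 code23] := (code_at_cat _ _ _ _).1 code.
have [code2 code3] := (code_at_cat _ _ _ _).1 code23.
rewrite add0n in code2 code3.
have boot_tame : all (always_tame b) (boot K).
  rewrite /boot /= !all_cat all_nseq /= orbT smallK /=; last by lia.
  by elim: (iota _ _).
have st1 := steps_line (init_regs inp) code1 boot_tame; rewrite add0n in st1.
set env := fun k => R1 k.+1; set mem := fun x => R1 (K + x).
have [|safe_c Qc] := c_ok env mem hin.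
  move=> A x A8; rewrite /arr /mem R_out //.
  by have n_lt k : k < K + (2 * k + 8 * x + A) by [lia]; apply: n_lt.
have Rm : models K N env mem R1 by split.
have wf_c' : wfc K nv.+1 (CSeq c (out_loop K)) by rewrite /= wf_c /nv /=; lia.
have safe_c' : safec N b env mem (CSeq c (out_loop K)).
  split=> //; apply: (@plainc_safe (K + 8 * (K - 2))) => //=; lia.
have K_small' : small b (Posz K) by apply: smallK; lia.
have [T [R2 [st2 Tt [R20 _ R2m] _]]] := cc_ok b_gt0 K_small' code2 (ltnSn _) wf_c' Rm safe_c'.
have tail_tame : all (always_tame b) (tail K).
  rewrite /tail !all_cat /= K_small smallK /=; last by lia.
  by rewrite andbT; elim: (rev _).
have st3 := steps_line R2 code3 tail_tame.
have [R3lo R3hi] := tail_ok K2 R20.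
have [arr0 low] := out_loop_ok K N env (ex N env c mem).
have st := steps_trans st1 (steps_trans st2 st3); set R3 := run_line (tail K) R2 in st R3lo R3hi.
have [|||i|cost exP cost_le] := steps_exec st (b0 := b).
- by apply: nth_default; rewrite /P /compile !size_cat addnA.
- exact: b_gt0.
- exact: b_gt0.
- rewrite /init_regs; case: eqP => _; last exact: inp_small.
  by apply: leq_ltn_trans N_small; rewrite /N /lim /=; have := ltn_expl K (isT : 1 < 2); nia.
exists (size (boot K) + (T + size (tail K))).+1, R3, cost; split=> //; split.
  apply: leq_trans cost_le _; rewrite /run_cost.
  have le : size (boot K) + (T + size (tail K)) <= run_time K c N by rewrite /run_time; lia.
  by apply: leq_mul => //; rewrite leq_add2r leq_mul2l leq_add2l leq_mul2r le orbT.
exists (arr N (ex N env c mem) 0) => // i iN; case: (ltnP i.+1 K) => iK.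
  by rewrite R3lo // -addnA R2m -arr0 /arr; cbn [ex]; congr (ex _ _ _ _ _); lia.
by rewrite R3hi // -(subnKC iK) R2m -low.
Qed.

(** * Polynomial bounds *)

Definition pbounded (f : nat -> nat) : Prop := exists c, forall x, f x <= c * x.+1 ^ c.

Lemma pbounded_le f g : (forall x, f x <= g x) -> pbounded g -> pbounded f.
Proof. by move=> fg [c gc]; exists c => x; apply: leq_trans (fg x) (gc x). Qed.

Lemma pbounded_const k : pbounded (fun=> k).
Proof. by exists k => x; rewrite -{1}[k]muln1 leq_mul2l expn_gt0 orbT. Qed.

Lemma pbounded_id : pbounded id.
Proof. by exists 1 => x; rewrite mul1n expn1. Qed.

Lemma pbounded_add f g : pbounded f -> pbounded g -> pbounded (fun x => f x + g x).
Proof.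
move=> [c fc] [d gd]; exists (c + d) => x.
rewrite mulnDl leq_add // ?(leq_trans (fc x)) ?(leq_trans (gd x)) // leq_mul2l.
  by rewrite leq_pexp2l ?orbT ?leq_addr.
by rewrite leq_pexp2l ?orbT ?leq_addl.
Qed.

Lemma pbounded_mul f g : pbounded f -> pbounded g -> pbounded (fun x => f x * g x).
Proof.
move=> [c fc] [d gd]; exists (c * d + c + d) => x.
apply: leq_trans (leq_mul (fc x) (gd x)) _.
rewrite mulnACA -expnD; apply: leq_mul; first lia.
by rewrite leq_pexp2l //; lia.
Qed.

Lemma pbounded_exp f k : pbounded f -> pbounded (fun x => f x ^ k).
Proof.
move=> fb; elim: k => [|k IH]; first exact: pbounded_const.
by apply: pbounded_le (pbounded_mul fb IH) => x; rewrite expnS.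
Qed.

Lemma pbounded_comp f g : pbounded f -> pbounded g -> pbounded (fun x => f (g x)).
Proof.
move=> [c fc] gb; apply: pbounded_le (pbounded_mul (pbounded_const c) (pbounded_exp c
  (pbounded_add (pbounded_const 1) gb))) => x.
exact: fc.
Qed.

Lemma pbounded_tm e : pbounded (tm^~ e).
Proof.
by elim: e => /= *; repeat first [exact: pbounded_const | exact: pbounded_id |
  assumption | apply: pbounded_add | apply: pbounded_mul].
Qed.

Lemma pbounded_tmc c : pbounded (tmc^~ c).
Proof.
by elim: c => /= *; repeat first [exact: pbounded_const | exact: pbounded_id |
  assumption | exact: pbounded_tm | apply: pbounded_add | apply: pbounded_mul].
Qed.

(** For fixed [K] the loop bound [lim K L] is linear in [L], and the number of steps is polynomial
    in the loop bound. *)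
Lemma run_cost_poly K c :
  exists q, forall L b, run_cost K c (lim K L) b <= q * (L + b).+1 ^ q.
Proof.
have rt : pbounded (fun x => size (boot K) + tmc (lim K x) (CSeq c (out_loop K)) + size (tail K)).
  apply: pbounded_add; last exact: pbounded_const.
  apply: pbounded_add; first exact: pbounded_const.
  apply: (@pbounded_comp (tmc^~ _)); first exact: pbounded_tmc.
  apply: (@pbounded_le _ (fun x => 2 ^ K * x + K)); first by move=> x; rewrite /lim leq_subr.
  apply: pbounded_add; last exact: pbounded_const.
  by apply: pbounded_mul; [exact: pbounded_const | exact: pbounded_id].
case: rt => q rtq.
have : pbounded (fun x => (q * x.+1 ^ q) * (3 * (x + (q * x.+1 ^ q) * x) + 1)).
  have qb : pbounded (fun x => q * x.+1 ^ q) by exists q.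
  by repeat first [exact: pbounded_const | exact: pbounded_id | exact: qb
    | apply: pbounded_add | apply: pbounded_mul].
case=> q' q'b; exists q' => L b; apply: leq_trans (q'b (L + b)).
have le : run_time K c (lim K L) <= q * (L + b).+1 ^ q.
  apply: leq_trans (rtq L) _; rewrite leq_mul2l; apply/orP; right.
  by case: (q) => // q1; rewrite leq_exp2r; lia.
rewrite /run_cost; apply: leq_mul => //; rewrite leq_add2r leq_mul2l /=.
by apply: leq_add; [lia | apply: leq_mul => //; lia].
Qed.

(** * Intersection graphs *)

Lemma cycle_nthP (T : eqType) (x0 : T) (e : rel T) (c : seq T) :
  reflect (forall i, i < size c -> e (nth x0 c i) (nth x0 c (i.+1 %% size c))) (cycle e c).
Proof.
case: c => [|x p]; first by apply: (iffP idP).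
have nthE i : i < size (rcons p x) ->
    nth x0 (rcons p x) i = nth x0 (x :: p) (i.+1 %% size (x :: p)).
  rewrite size_rcons ltnS leq_eqVlt => /orP[/eqP->|i_lt].
    by rewrite nth_rcons ltnn eqxx modnn.
  by rewrite nth_rcons i_lt modn_small.
have nthE' i : i < size (rcons p x) -> nth x0 (x :: rcons p x) i = nth x0 (x :: p) i.
  by rewrite -rcons_cons size_rcons nth_rcons => ->.
apply: (iffP (pathP x0)) => H i i_lt; have i_lt' := i_lt.
  by have := H i; rewrite size_rcons nthE ?nthE' ?size_rcons // => ->.
by rewrite nthE' // nthE //; apply: H; rewrite size_rcons in i_lt.
Qed.

(** A path is extended at its head [x] as long as possible. One of the two neighbours of [x] is not
    the vertex next to it on the path; if this neighbour lies on the path already, it closes a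
    cycle. *)
Lemma min_degree_cycle (T : finType) (e : rel T) (U : {set T}) :
  symmetric e -> irreflexive e -> U != set0 ->
  (forall u, u \in U -> exists v w,
     [/\ v \in U, w \in U, v != w, e u v & e u w]) ->
  exists c, [/\ 3 <= size c, uniq c, cycle e c & {subset c <= U}].
Proof.
move=> e_sym e_irr /set0Pn[u0 u0U] deg.
have step n x p : #|T| <= size p + n -> uniq (x :: p) -> path e x p ->
    {subset x :: p <= U} ->
    exists c, [/\ 3 <= size c, uniq c, cycle e c & {subset c <= U}].
  elim: n x p => [|n IH] x p.
    rewrite addn0 => Tp /card_uniqP xp_card _ _.
    by have := leq_trans (max_card [in x :: p]) Tp; rewrite xp_card /= ltnn.
  move=> Tp xp_uniq xp_path xpU.
  have [v [w [vU wU v_w xv xw]]] := deg x (xpU x (mem_head _ _)).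
  have ext y : y \in U -> e x y -> y \notin x :: p ->
      exists c, [/\ 3 <= size c, uniq c, cycle e c & {subset c <= U}].
    move=> yU xy y_xp; apply: (IH y (x :: p)); rewrite /= ?y_xp //.
    - by rewrite addSnnS.
    - by rewrite e_sym xy.
    - by move=> z; rewrite inE => /orP[/eqP->//|/xpU].
  (* [head x p] is the vertex next to [x] on the path; excluding it gives the cycle at least three
     vertices. Its default [x] does no harm, as [x] is not its own neighbour. *)
  have close y : y \in U -> e x y -> y != head x p ->
      exists c, [/\ 3 <= size c, uniq c, cycle e c & {subset c <= U}].
    move=> yU xy y_hd; case: (boolP (y \in x :: p)) => [|/(ext y yU xy) //].
    rewrite inE => /orP[/eqP yx|y_p]; first by rewrite yx e_irr in xy.
    case/splitPr: y_p xp_uniq xp_path xpU y_hd => p1 p2 xp_uniq xp_path xpU y_hd {Tp ext}.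
    have p1_gt0 : 0 < size p1 by case: p1 y_hd {xp_uniq xp_path xpU} => //=; rewrite eqxx.
    exists (x :: rcons p1 y); split.
    - by rewrite /= size_rcons.
    - by move: xp_uniq; rewrite -cat_rcons -cat_cons cat_uniq => /andP[].
    - move: xp_path; rewrite -cat_rcons cat_path => /andP[xp1 _].
      by rewrite (cycle_path x) /= last_rcons e_sym xy.
    - by move=> z zc; apply: xpU; rewrite -cat_rcons -cat_cons mem_cat zc.
  case: (eqVneq v (head x p)) => [vh|]; last exact: close.
  by apply: (close w) => //; rewrite -vh eq_sym.
by apply: (step #|T| u0 [::]) => // z; rewrite inE => /eqP->.
Qed.

(** A chord between positions [i < j] closes the segment from [i] to [j] into a shorter cycle, so
    that descent on the length ends in a cycle without chords. *)
Lemma chordless_cycle (T : eqType) (x0 : T) (e : rel T) (c : seq T) :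
  symmetric e -> 3 <= size c -> uniq c -> cycle e c ->
  exists c', [/\ 3 <= size c', uniq c', {subset c' <= c} &
    forall i j, i < size c' -> j < size c' -> i != j ->
      e (nth x0 c' i) (nth x0 c' j) = cyc_adj (size c') i j].
Proof.
move=> e_sym; have [n] := ubnP (size c); elim: n c => // n IH c cn c3 cu cc.
have cP := cycle_nthP x0 e c cc.
have adj i j : i < size c -> j < size c -> i != j -> cyc_adj (size c) i j ->
    e (nth x0 c i) (nth x0 c j).
  move=> ic jc ij; rewrite /cyc_adj (negPf ij) /= => /orP[/eqP<-|/eqP<-]; first exact: cP.
  by rewrite e_sym; apply: cP.
case: (boolP [forall i : 'I_(size c), forall j : 'I_(size c),
    (i < j) && e (nth x0 c i) (nth x0 c j) ==> cyc_adj (size c) i j]) => [|].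
  move=> /forallP H; exists c; split=> // i j ic jc ij.
  apply/idP/idP; last exact: adj.
  have half i' j' : i' < size c -> j' < size c -> i' < j' -> e (nth x0 c i') (nth x0 c j') ->
      cyc_adj (size c) i' j'.
    move=> ic' jc' ij' eij; have /forallP/(_ (Ordinal jc'))/implyP := H (Ordinal ic').
    by apply; rewrite ij'.
  case: (ltngtP i j) => [||ijE]; last by rewrite ijE eqxx in ij.
    by move=> ? ?; apply: half.
  move=> ji eij; have : cyc_adj (size c) j i by apply: half => //; rewrite e_sym.
  by rewrite /cyc_adj eq_sym [X in _ || X]orbC.
rewrite negb_forall => /existsP[[i ic]]; rewrite negb_forall => /existsP[[j jc]] /=.
rewrite negb_imply => /andP[/andP[ij eij] nadj].
(* Not being consecutive leaves a vertex between the two, so the segment has at least three. *)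
have ij2 : i.+2 <= j.
  move: nadj; rewrite /cyc_adj !negb_or => /and3P[_ nij _].
  rewrite ltn_neqAle ij andbT; apply: contra nij => /eqP ijE.
  by rewrite modn_small ?ijE.
(* The segment is not the whole cycle, whose two ends are adjacent modulo its length. *)
have notall : ~~ ((i == 0) && (j.+1 == size c)).
  apply: contra nadj => /andP[/eqP-> /eqP jE].
  by rewrite /cyc_adj jE modnn eqxx !orbT.
set c' := drop i (take j.+1 c).
have c'size : size c' = j.+1 - i.
  by rewrite /c' size_drop size_takel.
have c'nth k : k < size c' -> nth x0 c' k = nth x0 c (i + k).
  by move=> kc; rewrite /c' nth_drop nth_take //; rewrite c'size in kc; lia.
have [||||c'' [c''3 c''u c''c' c''P]] := IH c'.
- by rewrite c'size; move: cn notall; lia.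
- by rewrite c'size; lia.
- by rewrite drop_uniq // take_uniq.
- apply/(cycle_nthP x0) => k kc; rewrite c'nth //.
  have [kl|kl] := ltnP k.+1 (size c').
    rewrite modn_small // c'nth // addnS.
    have := cP (i + k); rewrite modn_small; last by rewrite c'size in kl; lia.
    by apply; rewrite c'size in kl; lia.
  have kE : k.+1 = size c' by lia.
  rewrite kE modnn c'nth; last by rewrite c'size; lia.
  rewrite addn0 e_sym; suff -> : i + k = j by [].
  by rewrite c'size in kE; lia.
exists c''; split=> // z /c''c' zc'.
exact: mem_take (mem_drop zc').
Qed.

Definition meets n (m1 m2 : {set 'I_n}) : bool := (m1 != m2) && (m1 :&: m2 != set0).

Lemma meets_sym n : symmetric (@meets n).
Proof. by move=> m1 m2; rewrite /meets eq_sym setIC. Qed.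

Definition acyclic n (T : {set {set 'I_n}}) : Prop :=
  forall c, 3 <= size c -> uniq c -> {subset c <= T} -> ~~ cycle (@meets n) c.

(* Already (B) with [k = 3] forbids three distinct pairwise intersecting
   monomials, so that (A) is subsumed by (B). *)
Lemma mip_acyclic n (T : {set {set 'I_n}}) :
  set0 \notin T -> monomial_intersection_property T <-> acyclic T.
Proof.
move=> T0; split.
  move=> [_ nB] c c3 cu cT; apply/negP => cc; apply: nB.
  have [c' [c'3 c'u c'c c'P]] := chordless_cycle set0 (@meets_sym n) c3 cu cc.
  exists c'; split=> //; first by apply/allP => m /c'c/cT.
  move=> i j ic jc; case: (eqVneq i j) => [->|ij].
    (* For [i = j], condition (B) asks for a nonempty monomial. *)
    by rewrite setIid /cyc_adj eqxx /=; apply: contraNneq T0 => <-; apply/cT/c'c/mem_nth.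
  by rewrite -c'P // /meets nth_uniq // ij.
move=> acyc; have nB : ~ condB T.
  move=> [c [c3 cu /allP cT cP]]; have /negP := acyc c c3 cu cT; apply.
  apply/(cycle_nthP set0) => i ic; have i'c : i.+1 %% size c < size c by rewrite ltn_pmod //; lia.
  rewrite /meets nth_uniq // cP // /cyc_adj eqxx orbT andbT.
  case: (ltnP i.+1 (size c)) => ic'; first by rewrite modn_small //; lia.
  have iE : i.+1 = size c by apply/eqP; rewrite eqn_leq ic ic'.
  by rewrite iE modnn -lt0n; clear -iE c3; lia.
split=> // -[m1 [m2 [m3 [/and3P[m1T m2T m3T] m123 p1 p2]]]].
(* If two of the three coincide, an inclusion in (A) fails to be proper: [m3 :&: m1] or [m3 :&: m2]
   would be all of [m3], or the union would add nothing. *)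
have m13 : m1 != m3.
  by apply: contraTneq p1 => ->; rewrite setIid properE subsetIl andbF.
have m23 : m2 != m3.
  by apply: contraTneq p2 => ->; rewrite setIid properE subsetIl andbF.
have m12 : m1 != m2 by apply: contraTneq p1 => ->; rewrite setUid properxx.
have : ~~ cycle (@meets n) [:: m1; m2; m3].
  apply: acyc => //; first by rewrite /= !inE negb_or m12 m13 m23.
  by move=> m; rewrite !inE => /or3P[] /eqP->.
apply/negP; rewrite negbK.
have [i] := set0Pn _ m123; rewrite !inE => /andP[/andP[i1 i2] i3].
have I (a b : {set 'I_n}) : i \in a -> i \in b -> a :&: b != set0.
  by move=> ia ib; apply/set0Pn; exists i; rewrite inE ia.
by rewrite /= /meets m12 m23 (eq_sym m3) m13 !I.
Qed.

(** * Reading the instance *)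

Notation bz b := (Posz (nat_of_bool b)).

Definition Bnot a := EIf a (enat 0) (enat 1).
Definition Band a b := EIf a b (enat 0).
Definition Blt a b := EIf (esub b a) (enat 1) (enat 0).
Definition Beq a b := EIf (esub a b) (enat 0) (EIf (esub b a) (enat 0) (enat 1)).
Definition Bex k e := EIf (ESum k e) (enat 1) (enat 0).

Section BooleanExpressions.
Variables (N : nat) (env : nat -> int) (mem : memory).

Lemma ev_if e1 e2 e3 p : ev N env mem e1 = bz p ->
  ev N env mem (EIf e1 e2 e3) = if p then ev N env mem e2 else ev N env mem e3.
Proof. by cbn [ev] => ->; case: p. Qed.

Lemma ev_bnot a p : ev N env mem a = bz p -> ev N env mem (Bnot a) = bz (~~ p).
Proof. by move=> /ev_if ->; case: p. Qed.

(** Conjunction is lazy: the value of [b] matters only where [a] holds, so that a range test can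
    guard an access. *)
Lemma ev_band a b p q : ev N env mem a = bz p -> (p -> ev N env mem b = bz q) ->
  ev N env mem (Band a b) = bz (p && q).
Proof. by move=> /ev_if -> H; case: p H => // ->. Qed.

Lemma ev_blt a b x y : ev N env mem a = Posz x -> ev N env mem b = Posz y ->
  ev N env mem (Blt a b) = bz (x < y).
Proof. by rewrite /Blt /= => -> ->; rewrite subr_gt0 ltz_nat; case: ifP. Qed.

Lemma ev_beq a b x y : ev N env mem a = Posz x -> ev N env mem b = Posz y ->
  ev N env mem (Beq a b) = bz (x == y).
Proof.
by rewrite /Beq /= => -> ->; rewrite !subr_gt0 !ltz_nat; case: ltngtP.
Qed.

Lemma ev_sum k e f : (forall i, i < N -> ev N (upd env k (Posz i)) mem e = f i) ->
  ev N env mem (ESum k e) = (\sum_(0 <= i < N) f i)%R.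
Proof.
by move=> H; cbn [ev]; rewrite !big_mkord; apply: eq_bigr => i _; apply: H.
Qed.

Lemma sum_bz (p : pred nat) : (\sum_(0 <= i < N) bz (p i))%R = Posz (count p (iota 0 N)).
Proof.
elim: N => [|m IH]; first by rewrite big_geq.
have -> : iota 0 m.+1 = iota 0 m ++ [:: m] by rewrite -addn1 iotaD.
by rewrite big_nat_recr // IH count_cat /= addn0.
Qed.

Lemma ev_count k e (p : pred nat) :
  (forall i, i < N -> ev N (upd env k (Posz i)) mem e = bz (p i)) ->
  ev N env mem (ESum k e) = Posz (count p (iota 0 N)).
Proof. by move=> /ev_sum->; apply: sum_bz. Qed.

Lemma ev_bex k e (p : pred nat) :
  (forall i, i < N -> ev N (upd env k (Posz i)) mem e = bz (p i)) ->
  ev N env mem (Bex k e) = bz (has p (iota 0 N)).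
Proof.
move=> /ev_count H; rewrite /Bex -[LHS]/(if (0 < ev N env mem (ESum k e))%R then 1%R else 0%R) H.
by rewrite ltz_nat has_count; case: ifP.
Qed.

Lemma ev_add a b x y : ev N env mem a = Posz x -> ev N env mem b = Posz y ->
  ev N env mem (eadd a b) = Posz (x + y).
Proof. by rewrite /= => -> ->. Qed.

Lemma ex_ifb e c1 c2 p : ev N env mem e = bz p ->
  ex N env (CIf e c1 c2) mem = if p then ex N env c1 mem else ex N env c2 mem.
Proof. by rewrite ex_if => ->; case: p. Qed.

Lemma ev_enat x : ev N env mem (enat x) = Posz x.
Proof. by []. Qed.

End BooleanExpressions.

(** The two branches follow the two cases of [in_pos]. *)
Definition In K e :=
  EIf (esub (enat (K - 1)) e)
    (EPeek (esub (eadd (eadd ELim e) (enat 2)) (enat (2 * K))))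
    (EPeek (esub (eadd e (enat 1)) (enat K))).

Lemma ev_in K N env mem inp e x : 0 < K -> 2 * K <= N + 2 ->
  holds_input K N mem inp -> ev N env mem e = Posz x -> x < size inp ->
  ev N env mem (In K e) = nth 0%R inp x.
Proof.
move=> K0 KN hin ex x_lt; rewrite -(hin x x_lt) /in_pos /=; rewrite ex.
case: (ltnP x.+1 K) => xK; [rewrite ifT; last by lia | rewrite ifF; last by lia].
  by have -> : (Posz N + Posz x + 2 - Posz (2 * K))%R = Posz (N + x + 2 - 2 * K) by lia.
by have -> : (Posz x + 1 - Posz K)%R = Posz (x.+1 - K) by lia.
Qed.

Lemma touches_input As c K N env mem inp : 0 < K -> 0 < N -> size inp <= N ->
  touches As c -> holds_input K N mem inp -> holds_input K N (ex N env c mem) inp.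
Proof.
move=> K0 N0 inpN tc hin i i_lt; rewrite (touches_low env mem tc) ?hin // /in_pos.
by case: ifP => iK; lia.
Qed.

(** Indices are natural numbers, as in the programs; beyond [s] the default [set0] makes the
    relation false. *)
Definition occurs n (s : seq {set 'I_n}) (j i : nat) : bool :=
  i \in [seq val x | x <- enum (nth set0 s j)].

Lemma occursE n (s : seq {set 'I_n}) j (i : 'I_n) : occurs s j i = (i \in nth set0 s j).
Proof. by rewrite /occurs (mem_map val_inj) mem_enum. Qed.

Lemma occurs_lt n (s : seq {set 'I_n}) j i : occurs s j i -> (j < size s) && (i < n).
Proof.
case/mapP=> x; rewrite mem_enum => xj ->; rewrite ltn_ord andbT ltnNge.
by apply: contraL xj => sj; rewrite nth_default // inE.
Qed.

(** The position of the cardinality of monomial [j] in the encoding, after a header of two entries;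
    at [size s] it is the position of the first coefficient, if there are any. *)
Definition offset n (s : seq {set 'I_n}) j := 2 + sumn [seq #|m|.+1 | m : {set 'I_n} <- take j s].

Lemma offsetS n (s : seq {set 'I_n}) j : j < size s ->
  offset s j.+1 = offset s j + 1 + #|nth set0 s j|.
Proof.
move=> js; rewrite /offset (take_nth set0) // map_rcons sumn_rcons; lia.
Qed.

Lemma size_leq_offset n (s : seq {set 'I_n}) : size s <= offset s (size s).
Proof. by rewrite /offset take_size; elim: s => //= m t; lia. Qed.

(** The remainder lets the same reading routines serve for inputs with and without coefficients. *)
Definition encodes n (s : seq {set 'I_n}) (inp : seq int) : Prop :=
  exists rest, inp = enc_monos s ++ rest.

Lemma size_enc_mono n (m : {set 'I_n}) : size (enc_mono m) = #|m|.+1.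
Proof. by rewrite /= size_map -cardE. Qed.

Lemma enc_monos_cat n (s : seq {set 'I_n}) j : j < size s ->
  exists l1 l2, [/\ size l1 = offset s j, enc_monos s = l1 ++ enc_mono (nth set0 s j) ++ l2
    & size (enc_monos s) = offset s (size s)].
Proof.
move=> js; exists ([:: Posz n; Posz (size s)] ++ flatten [seq enc_mono m | m <- take j s]),
  (flatten [seq enc_mono m | m <- drop j.+1 s]).
have sz (t : seq {set 'I_n}) : size (flatten [seq enc_mono m | m <- t]) = sumn [seq #|m|.+1 | m : {set 'I_n} <- t].
  by rewrite size_flatten /shape -map_comp; congr sumn; apply: eq_map => m /=; rewrite size_map -cardE.
split; first by rewrite size_cat sz.
  by rewrite /enc_monos -{2}(cat_take_drop j s) (drop_nth set0) // map_cat flatten_cat -!catA.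
by rewrite size_cat sz /offset take_size.
Qed.

Lemma size_enc_monos n (s : seq {set 'I_n}) : size (enc_monos s) = offset s (size s).
Proof.
case: (posnP (size s)) => [/size0nil->//|s0]; by have [l1 [l2 []]] := enc_monos_cat s0.
Qed.

Section Encoding.
Variables (n : nat) (s : seq {set 'I_n}) (inp : seq int).
Hypothesis inp_enc : encodes s inp.

Lemma enc_size : offset s (size s) <= size inp.
Proof. by case: inp_enc => rest ->; rewrite size_cat size_enc_monos leq_addr. Qed.

Lemma enc_n : nth 0%R inp 0 = n.
Proof. by case: inp_enc => rest ->. Qed.

Lemma enc_m : nth 0%R inp 1 = size s.
Proof. by case: inp_enc => rest ->. Qed.

Lemma enc_in j k : j < size s -> k <= #|nth set0 s j| ->
  (offset s j + k < size inp) /\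
  nth 0%R inp (offset s j + k) = nth 0%R (enc_mono (nth set0 s j)) k.
Proof.
move=> js kj; case: inp_enc => rest ->; have [l1 [l2 [sz1 E _]]] := enc_monos_cat js.
have := size_enc_mono (nth set0 s j); rewrite {}E; move: (enc_mono _) => M szM.
rewrite -!catA -sz1 !size_cat szM; split; first by lia.
by rewrite nth_cat ltnNge leq_addr /= addKn nth_cat szM ltnS kj.
Qed.

Lemma enc_card j : j < size s ->
  (offset s j < size inp) /\ nth 0%R inp (offset s j) = #|nth set0 s j|.
Proof. by move=> js; have := enc_in js (leq0n _); rewrite addn0. Qed.

Lemma enc_elt j t : j < size s -> t < #|nth set0 s j| ->
  (offset s j + 1 + t < size inp) /\ nth 0%R inp (offset s j + 1 + t) =
    (nth 0 [seq val x | x <- enum (nth set0 s j)] t).+1.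
Proof.
move=> js tj; have -> : offset s j + 1 + t = offset s j + t.+1 by lia.
have [lt ->] := enc_in js tj; split=> //; have -> : enc_mono (nth set0 s j) =
    Posz #|nth set0 s j| :: [seq Posz x.+1 | x <- [seq val i | i <- enum (nth set0 s j)]].
  by rewrite -map_comp.
by rewrite /= (nth_map 0) // size_map -cardE.
Qed.

End Encoding.

(* Array 0 is reserved for the output, array 1 contains the offsets. *)
Definition offsets K : cmd :=
  CSeq (Put 1 (enat 0) (enat 2))
    (CFor 0 (Put 1 (eadd (EVar 0) (enat 1))
       (eadd (eadd (Get 1 (EVar 0)) (enat 1)) (In K (Get 1 (EVar 0)))))).

(** Variable 10 is bound nowhere else, so that [ej] and [ei] may use any variable of the context.
    The encoding numbers the variables of the polynomial from 1, hence the shift of [ei]. *)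
Definition Occurs K ej ei :=
  Band (Blt ej (In K (enat 1)))
    (Bex 10 (Band (Blt (EVar 10) (In K (Get 1 ej)))
                  (Beq (In K (eadd (eadd (Get 1 ej) (enat 1)) (EVar 10))) (eadd ei (enat 1))))).

Section Occurrences.
Variables (K N n : nat) (s : seq {set 'I_n}) (inp : seq int).
Hypotheses (K_gt0 : 0 < K) (K_N : 2 * K <= N + 2) (inp_N : size inp <= N) (inp_enc : encodes s inp).

Definition ready (mem : memory) : Prop :=
  holds_input K N mem inp /\ forall j, j <= size s -> arr N mem 1 j = offset s j.

Let inp_gt1 : 1 < size inp.
Proof. by apply: leq_trans (enc_size inp_enc); rewrite leq_addr. Qed.

Lemma ready_frame As c env mem : touches As c -> 1 \notin As -> ready mem ->
  ready (ex N env c mem).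
Proof.
move=> tc nA [hin off]; split; first by apply: touches_input tc hin => //; lia.
by move=> j js; rewrite (touches_arr _ _ _ _ tc) ?off.
Qed.

Lemma ready_upd A x v mem : 1 < A -> A < 8 -> ready mem -> ready (upd mem (2 * N + 8 * x + A) v).
Proof.
move=> A1 A8 [hin off]; split.
  move=> i i_lt; rewrite -hin // /upd /in_pos ifF //; case: ifP => iK; lia.
by move=> j js; rewrite -off // /arr /upd ifF //; lia.
Qed.

Lemma ex_offsets env mem : holds_input K N mem inp -> ready (ex N env (offsets K) mem).
Proof.
move=> hin; rewrite /offsets ex_seq ex_for; set mem0 := ex N env _ mem.
have hin0 : holds_input K N mem0 inp.
  by apply: (@touches_input [:: 1]) => //; [lia | constructor].
have arr0 : arr N mem0 1 0 = 2%R by rewrite /mem0 (@arr_put _ _ _ _ _ _ 0).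
set body := Put _ _ _.
have tb : touches [:: 1] body by constructor.
suff H m : holds_input K N (iter_for N env 0 body m mem0) inp /\
    forall j, j <= m -> j <= size s -> arr N (iter_for N env 0 body m mem0) 1 j = offset s j.
  have [H1 H2] := H N; split=> // j js; apply: H2 => //.
  apply: leq_trans js _; apply: leq_trans inp_N; apply: leq_trans (enc_size inp_enc).
  exact: size_leq_offset.
elim: m => [|m [IH1 IH2]].
  by rewrite iter_for0; split=> // j; rewrite leqn0 => /eqP-> _; rewrite arr0 /offset take0.
rewrite !iter_forS; split; first by apply: touches_input tb IH1 => //; lia.
move=> j jm js; rewrite (@arr_put _ _ _ _ _ _ m.+1) //; last by rewrite /= /upd /=; lia.
rewrite eqxx andTb; case: eqP => [jE|jm']; last by apply: IH2 => //; lia.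
rewrite {j}jE in jm js *; have [lt c] := enc_card inp_enc js.
have G : ev N (upd env 0 (Posz m)) (iter_for N env 0 body m mem0) (Get 1 (EVar 0)) = offset s m.
  by rewrite (@ev_get _ _ _ _ _ m) // IH2 // ltnW.
have := ev_in K_gt0 K_N IH1 G lt; rewrite c => I.
by rewrite (ev_add (ev_add G (ev_enat _ _ _ _)) I) offsetS.
Qed.

Lemma ev_occurs env mem ej ei j i : ready mem ->
  (forall t, ev N (upd env 10 (Posz t)) mem ej = Posz j) -> ev N env mem ej = Posz j ->
  (forall t, ev N (upd env 10 (Posz t)) mem ei = Posz i) ->
  ev N env mem (Occurs K ej ei) = bz (occurs s j i).
Proof.
move=> [hin off] ejt ej0 eit.
have m_le j' : j' < size s -> #|nth set0 s j'| <= N.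
  move=> js; have [lt _] := enc_in inp_enc js (leqnn _); lia.
have -> : occurs s j i = (j < size s) && has (fun t => (t < #|nth set0 s j|) &&
    ((nth 0 [seq val x | x <- enum (nth set0 s j)] t).+1 == i + 1)) (iota 0 N).
  apply/idP/andP => [oji|[js /hasP[t]]].
    have /andP[js _] := occurs_lt oji; split=> //; apply/hasP.
    have it : index i [seq val x | x <- enum (nth set0 s j)] < #|nth set0 s j|.
      by move: oji; rewrite /occurs -index_mem size_map -cardE.
    exists (index i [seq val x | x <- enum (nth set0 s j)]).
      by rewrite mem_iota /= add0n (leq_trans it) // m_le.
    by rewrite it nth_index // addn1 eqxx.
  rewrite mem_iota => /= tN /andP[tm /eqP]; rewrite addn1 => -[<-].
  by rewrite /occurs mem_nth // size_map -cardE.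
have inm : ev N env mem (In K (enat 1)) = Posz (size s).
  by rewrite (@ev_in _ _ _ _ inp _ 1) ?(enc_m inp_enc).
apply: ev_band; first exact: ev_blt.
move=> js; apply: ev_bex => t tN.
have [ltc c] := enc_card inp_enc js.
have G : ev N (upd env 10 (Posz t)) mem (Get 1 ej) = offset s j.
  by rewrite (ev_get 1 (ejt t)) off // ltnW.
apply: ev_band.
  by apply: ev_blt; [|rewrite (ev_in K_gt0 K_N hin G ltc)].
move=> tm; have [lte e] := enc_elt inp_enc js tm.
apply: ev_beq; last exact: ev_add (eit t) _.
by rewrite (ev_in K_gt0 K_N hin (ev_add (ev_add G (ev_enat _ _ _ _)) _) lte).
Qed.

End Occurrences.

(** * Deciding the property *)

Section Elimination.
Variables (N : nat) (adj : rel nat).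

Definition live_degree (d : pred nat) j := count (fun k => ~~ d k && adj j k) (iota 0 N).

Definition kill (d : pred nat) j : pred nat :=
  if live_degree d j < 2 then (fun k => (k == j) || d k) else d.

Definition sweep d n := foldl kill d (iota 0 n).

Lemma sweepS d n : sweep d n.+1 = kill (sweep d n) n.
Proof. by rewrite /sweep -addn1 iotaD foldl_cat. Qed.

Lemma kill_mono (d : pred nat) j k : d k -> kill d j k.
Proof. by rewrite /kill; case: ifP => // _ ->; rewrite orbT. Qed.

Lemma sweep_mono (d : pred nat) m n k : m <= n -> sweep d m k -> sweep d n k.
Proof.
by move=> /subnK<-; elim: (n - m) => // i IH /IH; rewrite addSn sweepS; apply: kill_mono.
Qed.

(** The first member of [C] to be deleted would still have two live neighbours, both in [C]. *)
Lemma two_neighbours_survive (C : pred nat) r :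
  (forall j, C j -> exists k1 k2, [/\ k1 < N, k2 < N, k1 != k2, C k1 /\ C k2
     & adj j k1 && adj j k2]) ->
  forall j, C j -> ~~ iter r (fun d => sweep d N) pred0 j.
Proof.
move=> CC; suff killC (d : pred nat) j : (forall j, C j -> ~~ d j) -> forall k, C k -> ~~ kill d j k.
  elim: r => [|r IH] //=; elim: {2}N => [|n IHn] //= j Cj.
  by rewrite sweepS; apply: killC.
move=> Cd k Ck; rewrite /kill; case: ifP => [deg|_]; last exact: Cd.
rewrite negb_or Cd // andbT; apply: contraTneq deg => kj; rewrite -leqNgt -{}kj.
have [k1 [k2 [k1N k2N k12 [Ck1 Ck2] /andP[a1 a2]]]] := CC _ Ck.
have : {subset [:: k1; k2] <= [seq i <- iota 0 N | ~~ d i && adj k i]}.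
  move=> i; rewrite !inE mem_filter mem_iota /= => /orP[]/eqP->.
    by rewrite Cd // a1.
  by rewrite Cd // a2.
by move/uniq_leq_size; rewrite /= inE k12 size_filter => ->.
Qed.

(** Each sweep deletes something as long as anything is alive, so that [N] sweeps suffice for [N]
    vertices. *)
Lemma leaves_die :
  (forall d : pred nat, (exists2 j, j < N & ~~ d j) ->
     exists j, [/\ j < N, ~~ d j & live_degree d j < 2]) ->
  forall j, j < N -> iter N (fun d => sweep d N) pred0 j.
Proof.
move=> leaf.
pose dead (d : pred nat) := count d (iota 0 N).
have progress (d : pred nat) : dead d < N -> dead d < dead (sweep d N).
  move=> dN; have [|j [jN dj deg]] := leaf d.
    suff /hasP[j] : has (predC d) (iota 0 N) by rewrite mem_iota; exists j.
    by rewrite has_count; have := count_predC d (iota 0 N); rewrite size_iota; move: dN; rewrite /dead; lia.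
  have sj : sweep d N j.
    apply: (@sweep_mono d j.+1) => //; rewrite sweepS /kill.
    (* Deletions earlier in the sweep can only have lowered the degree of [j]. *)
    suff -> : live_degree (sweep d j) j < 2 by rewrite eqxx.
    apply: leq_ltn_trans deg; apply: sub_count => k /andP[dk ->]; rewrite andbT.
    by apply: contra dk => dk; rewrite (@sweep_mono d 0).
  rewrite /dead -!size_filter; apply: (@uniq_leq_size _ (j :: filter d (iota 0 N))).
    by rewrite /= mem_filter (negPf dj) filter_uniq ?iota_uniq.
  move=> k; rewrite inE !mem_filter mem_iota /= add0n => /orP[/eqP->|/andP[dk ->]].
    by rewrite sj.
  by rewrite andbT (@sweep_mono d 0).
have many r : minn r N <= dead (iter r (fun d => sweep d N) pred0).
  elim: r => [|r IH]; first by rewrite min0n.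
  rewrite iterS; case: (ltnP (dead (iter r (fun d => sweep d N) pred0)) N) => [/progress|]; first lia.
  have : dead (iter r (fun d => sweep d N) pred0) <= dead (sweep (iter r (fun d => sweep d N) pred0) N).
    by apply: sub_count => k; apply: (@sweep_mono _ 0).
  lia.
move=> j jN; have := many N; rewrite minnn /dead -{1}(size_iota 0 N) => all_dead.
have /allP : all (iter N (fun d => sweep d N) pred0) (iota 0 N).
  by rewrite all_count eqn_leq count_size all_dead.
by apply; rewrite mem_iota.
Qed.

End Elimination.

(* Array 2 marks the deleted monomials. *)
Definition Meets K ej ek :=
  Band (Bnot (Beq ej ek)) (Bex 9 (Band (Occurs K ej (EVar 9)) (Occurs K ek (EVar 9)))).

Definition kill_cmd K : cmd :=
  CIf (Blt (ESum 2 (Band (Bnot (Get 2 (EVar 2))) (Meets K (EVar 1) (EVar 2)))) (enat 2))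
    (Put 2 (EVar 1) (enat 1)) CSkip.

Definition mip_cmd K : cmd :=
  CSeq (offsets K) (CSeq (CFor 0 (CFor 1 (kill_cmd K)))
    (Put 0 (enat 0) (Bnot (Bex 1 (Bnot (Get 2 (EVar 1))))))).

(** Indices beyond [s] are isolated and get deleted like leaves, so that the test can range over all
    numbers below [N]. *)
Definition meets_nat n (s : seq {set 'I_n}) N : rel nat := fun j k =>
  (j != k) && has (fun i => occurs s j i && occurs s k i) (iota 0 N).

Section MipCmd.
Variables (K N n : nat) (s : seq {set 'I_n}) (inp : seq int).
Hypotheses (K_gt0 : 0 < K) (K_N : 2 * K <= N + 2) (inp_N : size inp <= N) (inp_enc : encodes s inp).

Let adj := meets_nat s N.

Definition dead_state (d : pred nat) (mem : memory) : Prop :=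
  ready K N s inp mem /\ forall j, arr N mem 2 j = bz (d j).

Lemma ex_kill env mem d j : dead_state d mem ->
  dead_state (kill N adj d j) (ex N (upd env 1 (Posz j)) (kill_cmd K) mem).
Proof.
move=> [rdy dE]; set env1 := upd env 1 _.
have deg : ev N env1 mem (ESum 2 (Band (Bnot (Get 2 (EVar 2))) (Meets K (EVar 1) (EVar 2)))) =
    live_degree N adj d j.
  apply: ev_count => k kN; apply: ev_band.
    by apply: ev_bnot; rewrite (@ev_get _ _ _ _ _ k) ?dE.
  move=> _; apply: ev_band; first by apply: ev_bnot; apply: ev_beq.
  move=> _; apply: ev_bex => i iN.
  apply: ev_band; first by apply: (ev_occurs K_gt0 K_N inp_N inp_enc).
  by move=> _; apply: (ev_occurs K_gt0 K_N inp_N inp_enc).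
rewrite /kill_cmd ex_if (ev_blt deg (ev_enat _ _ _ _)) /kill.
case: (live_degree N adj d j < 2); last by [].
set d' := fun k => _.
change (dead_state d' (ex N env1 (Put 2 (EVar 1) (enat 1)) mem)).
split; first by rewrite (@ex_put _ _ _ _ _ _ j) //; apply: ready_upd.
by move=> k; rewrite (@arr_put _ _ _ _ _ _ j) // eqxx andTb /d'; case: eqP => // _; apply: dE.
Qed.

Lemma ex_mip env mem : holds_input K N mem inp ->
  (forall A x, A < 8 -> arr N mem A x = 0%R) ->
  arr N (ex N env (mip_cmd K) mem) 0 0 =
    bz (all (iter N (fun d => sweep N adj d N) pred0) (iota 0 N)).
Proof.
move=> hin zero; rewrite /mip_cmd !ex_seq ex_for.
set mem1 := ex N env (offsets K) mem.
have st1 : dead_state pred0 mem1.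
  split; first exact: (ex_offsets _ _ _ inp_enc).
  by move=> j; rewrite (@touches_arr [:: 1]) ?zero //; repeat constructor.
have st2 r : dead_state (iter r (fun d => sweep N adj d N) pred0)
    (iter_for N env 0 (CFor 1 (kill_cmd K)) r mem1).
  elim: r => [|r IH] //; rewrite iter_forS ex_for iterS.
  move: (iter_for N env 0 _ r mem1) (iter r _ _) IH => mem2 d IH.
  suff H j : dead_state (sweep N adj d j) (iter_for N (upd env 0 (Posz r)) 1 (kill_cmd K) j mem2) by [].
  by elim: j => [|j IHj] //; rewrite iter_forS sweepS; apply: ex_kill.
rewrite (@arr_put _ _ _ _ _ _ 0) //
  (_ : all _ _ = ~~ has (predC (iter N (fun d => sweep N adj d N) pred0)) (iota 0 N)).
  apply: ev_bnot; apply: ev_bex => j jN; apply: ev_bnot.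
  by rewrite (@ev_get _ _ _ _ _ j) // (st2 N).2.
by rewrite -all_predC; apply: eq_all => j /=; rewrite negbK.
Qed.

Hypothesis n_N : n <= N.

Hypothesis s_uniq : uniq s.

Lemma meets_natE j k : j < size s -> k < size s ->
  adj j k = meets (nth set0 s j) (nth set0 s k).
Proof.
move=> js ks; rewrite /adj /meets_nat /meets nth_uniq //; congr (_ && _).
apply/hasP/set0Pn => [[i _ /andP[oj ok]]|[i]].
  have /andP[_ i_n] := occurs_lt oj; exists (Ordinal i_n).
  by rewrite inE -!occursE oj.
rewrite inE => /andP[ij ik]; exists (val i); last by rewrite !occursE ij.
by rewrite mem_iota /= (leq_trans (ltn_ord i)).
Qed.

Lemma meets_nat_lt j k : adj j k -> (j < size s) && (k < size s).
Proof.
by case/andP=> _ /hasP[i _ /andP[/occurs_lt/andP[-> _] /occurs_lt/andP[-> _]]].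
Qed.

(** The successor and the predecessor on a cycle protect each of its vertices. Conversely, if no
    live vertex has degree at most one, the live monomials contain a cycle by [min_degree_cycle]. *)
Lemma all_dead_acyclic :
  reflect (acyclic [set m in s]) (all (iter N (fun d => sweep N adj d N) pred0) (iota 0 N)).
Proof.
have sN : size s <= N := leq_trans (size_leq_offset s) (leq_trans (enc_size inp_enc) inp_N).
apply: (iffP allP) => [dead c c3 cu cs|acyc].
  apply/negP => cc.
  pose C j := nth set0 s j \in c.
  have idx m : m \in c -> index m s < size s /\ nth set0 s (index m s) = m.
    by move=> /cs; rewrite inE => ms; rewrite index_mem nth_index.
  have : forall j, C j && (j < size s) -> ~~ iter N (fun d => sweep N adj d N) pred0 j.
    apply: (two_neighbours_survive (C := fun j => C j && (j < size s))) => j /andP[Cj js].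
    have nx : next c (nth set0 s j) \in c by rewrite mem_next.
    have pv : prev c (nth set0 s j) \in c by rewrite mem_prev.
    have [nx_s nxE] := idx _ nx; have [pv_s pvE] := idx _ pv.
    exists (index (next c (nth set0 s j)) s), (index (prev c (nth set0 s j)) s); split.
    - exact: leq_trans sN.
    - exact: leq_trans sN.
    (* Equality of successor and predecessor would mean length at most two; rotating the vertex to
       the front turns this into a case analysis on the list. *)
    - apply/eqP => E; have : next c (nth set0 s j) = prev c (nth set0 s j) by rewrite -nxE E pvE.
      move/(congr1 (next c)); rewrite next_prev //; case/rot_to: Cj (c3) (cu) => i p rotE.
      rewrite -(size_rot i) -(rot_uniq i) -!(next_rot i cu) rotE.
      case: p {rotE} => [|a [|b p]] //= _; rewrite eqxx !inE !negb_or => /andP[/and3P[xa xb _] _].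
      by rewrite [a == _]eq_sym (negPf xa) eqxx => /eqP; rewrite eq_sym (negPf xb).
    - by rewrite /C nxE pvE nx pv nx_s pv_s.
    - rewrite !meets_natE // nxE pvE; apply/andP; split; first exact: next_cycle.
      by rewrite meets_sym; apply: prev_cycle.
  case: c c3 {cu cc} cs @C idx => // m c _ cs C idx H.
  have [ms mE] := idx m (mem_head _ _).
  have := H (index m s); rewrite /C mE mem_head ms => /(_ isT) /negP; apply.
  by apply: dead; rewrite mem_iota /= (leq_trans ms).
move=> j; rewrite mem_iota /= => jN; apply: leaves_die jN => d [j0 j0N j0d].
have [|] := boolP (has (fun j => (live_degree N adj d j < 2) && ~~ d j) (iota 0 N)).
  by case/hasP=> k; rewrite mem_iota /= => kN /andP[degk dk]; exists k.
move=> /hasPn nol.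
have deg k : k < N -> ~~ d k -> 1 < live_degree N adj d k.
  by move=> kN dk; have := nol k; rewrite mem_iota dk andbT -leqNgt; apply.
pose U := [set m in s | ~~ d (index m s)].
have [|||c [c3 cu cc cU]] := min_degree_cycle (U := U) (@meets_sym n).
- by move=> m; rewrite /meets eqxx.
- have : has (fun k => ~~ d k && adj j0 k) (iota 0 N).
    by rewrite has_count; apply: ltn_trans (deg j0 j0N j0d).
  move=> /hasP[k _ /andP[_ /meets_nat_lt/andP[j0s _]]].
  by apply/set0Pn; exists (nth set0 s j0); rewrite !inE index_uniq // j0d mem_nth.
- move=> u; rewrite !inE => /andP[us du].
  have us' : index u s < size s by rewrite index_mem.
  have := deg _ (leq_trans us' sN) du; rewrite /live_degree -size_filter.
  set l := filter _ _; have : uniq l by rewrite filter_uniq ?iota_uniq.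
  have : {in l, forall k, [/\ nth set0 s k \in U, k < size s & meets u (nth set0 s k)]}.
    move=> k; rewrite mem_filter => /andP[/andP[dk ak] _].
    have /andP[_ ks] := meets_nat_lt ak; split=> //.
      by rewrite !inE mem_nth // index_uniq.
    by move: ak; rewrite meets_natE // nth_index.
  case: l => [|k1 [|k2 l]] // lP /= /andP[]; rewrite !inE negb_or => /andP[k12 _] _ _.
  have [U1 s1 a1] := lP k1 (mem_head _ _).
  have [|U2 s2 a2] := lP k2; first by rewrite !inE eqxx orbT.
  by exists (nth set0 s k1), (nth set0 s k2); rewrite nth_uniq.
have : ~~ cycle (@meets n) c by apply: acyc => // m /cU; rewrite !inE => /andP[].
by rewrite cc.
Qed.

End MipCmd.

(** * Size estimates and the decision procedure *)

(** Covers the variables and the deepest nesting of temporaries in both programs. *)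
Definition ntemps := 64.

Lemma lim_geq L : 2 * ntemps <= lim ntemps L.+1 + 2.
Proof.
rewrite /lim /ntemps; have : 7 <= 64 by []. move=> /(leq_pexp2l (isT : 0 < 2)).
rewrite -[2 ^ 7]/128 mulnS; move: (2 ^ 64) => p; lia.
Qed.

Lemma leq_lim L : L <= lim ntemps L.
Proof.
rewrite /lim /ntemps; have : 0 < 2 ^ 64 by rewrite expn_gt0.
by move: (2 ^ 64) => p; nia.
Qed.

Lemma lim_small M b : ntemps + 4 + M <= b -> small b (Posz (lim ntemps M)).
Proof.
move=> Mb; apply: (@small_leq (ntemps + 4 + M)) => //; rewrite /small /lim absz_nat.
apply: (@leq_ltn_trans (2 ^ ntemps * M + ntemps)); first exact: leq_subr.
have := ltn_expl M (isT : 1 < 2); have := ltn_expl ntemps (isT : 1 < 2).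
rewrite !expnD -[2 ^ 4]/16; move: (2 ^ M) (2 ^ ntemps) ntemps => p q t; nia.
Qed.

Lemma const_small b : ntemps + 4 <= b -> small b (Posz (ntemps + 8 * (ntemps - 2))).
Proof.
by move=> Mb; apply: (@small_leq (ntemps + 4)).
Qed.

Lemma nat_small x b : x <= b -> small b (Posz x).
Proof. by move=> xb; apply: small_leq xb _; rewrite /small absz_nat ltn_expl. Qed.

Lemma offset_size n (s : seq {set 'I_n}) : offset s (size s) <= 2 + size s * n.+1.
Proof.
rewrite /offset take_size leq_add2l; elim: s => //= m t IH; rewrite mulSn leq_add //.
by rewrite ltnS (leq_trans (max_card _)) // card_ord.
Qed.

Lemma enc_monos_small n (s : seq {set 'I_n}) i b :
  n + size s <= b -> small b (nth 0%R (enc_monos s) i).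
Proof.
move=> nb; have : all (small b) (enc_monos s).
  rewrite /enc_monos /= (@nat_small n) ?(@nat_small (size s)) /=; try lia.
  apply/allP => z /flattenP[_ /mapP[m _ ->]].
  rewrite inE => /orP[/eqP->|/mapP[k _ ->]]; apply: nat_small.
    by apply: leq_trans nb; apply: leq_trans (leq_addr _ _); rewrite -[X in _ <= X]card_ord max_card.
  by apply: leq_trans nb; apply: leq_trans (leq_addr _ _); exact: ltn_ord.
move=> /allP H; case: (ltnP i (size (enc_monos s))) => [/(mem_nth 0%R)/H //|ni].
by rewrite nth_default // nat_small.
Qed.

(** [M] stands for the length of the encoding plus [n]. The monomials take at most
    [2 + size s * n.+1] entries, whence the quadratic bound. *)
Lemma cost_poly c : exists q, forall x M b : nat,
  M <= 2 + 4 * (x.+1 * x.+1) -> b <= M + x + (ntemps + 4) ->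
  run_cost ntemps c (lim ntemps M) b <= q * x.+1 ^ q.
Proof.
have [q qP] := run_cost_poly ntemps c.
have [q' q'P] : pbounded (fun x => q * (2 * (2 + 4 * (x.+1 * x.+1)) + x + (ntemps + 4)).+1 ^ q).
  apply: (@pbounded_comp (fun x => q * x.+1 ^ q) (fun x => 2 * (2 + 4 * (x.+1 * x.+1)) + x + (ntemps + 4))).
    by exists q.
  have Sb : pbounded (fun x => x.+1).
    by apply: pbounded_le (pbounded_add pbounded_id (pbounded_const 1)) => x; rewrite addn1.
  by repeat first [exact: Sb | exact: pbounded_id | exact: pbounded_const | apply: pbounded_mul
    | apply: pbounded_add].
exists q' => x M b MP bP; apply: leq_trans (qP M b) _; apply: leq_trans (q'P x).
rewrite leq_mul2l; apply/orP; right; case: (q) => // q1; rewrite leq_exp2r // ltnS; lia.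
Qed.

Lemma mip_decidable_poly : exists (P : seq instr) (c : nat),
  forall (n : nat) (s : seq {set 'I_n}),
    uniq s -> all (fun m => m != set0) s ->
    runs_within P (enc_monos s) (c * (size s + n).+1 ^ c)
      (fun Rf => (Rf 1%N = 0%R \/ Rf 1%N = 1%R) /\
                 (Rf 1%N = 1%R <-> monomial_intersection_property [set m in s])).
Proof.
have [q qP] := cost_poly (mip_cmd ntemps).
exists (compile ntemps (mip_cmd ntemps)), q => n s s_uniq s_ne0.
set inp := enc_monos s; pose M := size inp + n; pose b := M + (size s + n) + (ntemps + 4).
have szE : size inp = offset s (size s) by exact: size_enc_monos.
have inp_gt0 : 1 < size inp by [].
have enc : encodes s inp by exists [::]; rewrite cats0.
have T0 : set0 \notin [set m in s].
  by rewrite inE; apply/negP => /(allP s_ne0); rewrite eqxx.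
have K_N : 2 * ntemps <= lim ntemps M + 2.
  have -> : M = M.-1.+1 by rewrite prednK // /M; lia.
  exact: lim_geq.
have M_N := leq_lim M.
have inp_N : size inp <= lim ntemps M by apply: leq_trans M_N; rewrite leq_addr.
have n_N : n <= lim ntemps M by apply: leq_trans M_N; rewrite leq_addl.
have b_M : ntemps + 4 + M <= b by rewrite /b; lia.
have [|||||||||fuel [Rf [c [exP [c_le [X QX RX]]]]]] := @compile_ok ntemps (mip_cmd ntemps) n inp b
  (fun X => X 0 = bz (all (iter (lim ntemps M)
      (fun d => sweep (lim ntemps M) (meets_nat s (lim ntemps M)) d (lim ntemps M)) pred0)
    (iota 0 (lim ntemps M)))).
- by [].
- by [].
- exact: ltnW.
- by [].
- by rewrite /b; lia.
- exact: lim_small.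
- by apply: const_small; rewrite /b; lia.
- by move=> i; apply: enc_monos_small; rewrite /b; lia.
- move=> env mem hin zero; split; last exact: (ex_mip _ K_N inp_N enc).
  apply: (@plainc_safe (ntemps + 8 * (ntemps - 2))) => //; last exact: lim_small.
  by apply: const_small; rewrite /b; lia.
have R1 : Rf 1 = X 0.
  by apply: RX; apply: leq_trans inp_N; apply: ltnW.
exists fuel, Rf, c; split=> //; split.
  apply: leq_trans c_le _; apply: qP => //.
  by rewrite /M szE; have := offset_size s; nia.
rewrite R1 QX (mip_acyclic T0).
have := all_dead_acyclic inp_N enc n_N s_uniq.
case=> [acyc|nacyc]; split; [by right | by split | by left | by split].
Qed.

(** * Eliminating variables *)

Definition neg_part (z : int) : int := if (0 < z)%R then 0%R else z.

(** In the order given by [r], [S j] and [S j - c j] are consecutive prefix sums, and [D] is an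
    initial segment of [J], so that the sum telescopes. The induction peels off the largest element
    of [D]. *)
Lemma neg_part_telescope N (J D : pred 'I_N) (r : 'I_N -> nat) (c : 'I_N -> int) :
  {in J &, injective r} -> {subset D <= J} ->
  (forall j k, j \in D -> k \in J -> r k <= r j -> k \in D) ->
  let S (j : 'I_N) := (\sum_(k in J | (r k <= r j)%N) c k)%R in
  (\sum_(j in D) (neg_part (S j) - neg_part (S j - c j)) = neg_part (\sum_(j in D) c j))%R.
Proof.
move=> r_inj DJ down S; have [n] := ubnP #|D|; elim: n D DJ down => // n IH D DJ down Dn.
case: (pickP (mem D)) => [j0 j0D|D0]; last by rewrite !big_pred0.
case: (arg_maxnP (P := mem D) r j0D) => j jD j_max.
have SjE : S j = (\sum_(k in D) c k)%R.
  apply: eq_bigl => k; apply/andP/idP => [[kJ kj]|kD]; first exact: down kj.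
  by split; [apply: DJ | apply: j_max].
pose D' := [pred k in D | k != j].
have sumD (f : 'I_N -> int) : (\sum_(k in D) f k = f j + \sum_(k in D') f k)%R.
  by rewrite (bigD1 j).
rewrite sumD IH ?SjE.
- by rewrite (sumD c) (addrC (c j)) addrK subrK.
- by move=> k; rewrite !inE => /andP[/DJ].
- move=> k l; rewrite !inE => /andP[kD kj] lJ lk; rewrite (down k l) //=.
  apply: contra kj => /eqP lj; rewrite lj in lk; apply/eqP/r_inj; rewrite ?DJ //.
  by apply/eqP; rewrite eqn_leq lk andbT; apply: j_max.
- apply: leq_trans (ltnSE Dn); apply: proper_card; apply/properP; split.
    by apply/subsetP => k; rewrite !inE => /andP[].
  by exists j => //; rewrite !inE eqxx andbF.
Qed.

Section VariableElimination.
Variables (N : nat) (occ : nat -> nat -> bool) (vs : seq nat) (c0 : nat -> int).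

Definition remaining t a := a \notin take t vs.

Definition rest_size t j := count (fun b => remaining t b && occ j b) (iota 0 N).

(** Within a chain, cardinality decides inclusion, so counting suffices for sorting. The summand [j]
    separates monomials with equally many remaining variables. *)
Definition rank t j := rest_size t j * N + j.

Definition prefix_sum t (c : nat -> int) v j : int :=
  (\sum_(0 <= k < N) if occ k v && (rank t k <= rank t j)%N then c k else 0)%R.

(* If the monomials through [v] form a chain of products [A_1 >= A_2 >= ...]
   with prefix sums [S_j] of coefficients, then [min(0, sum_j c_j A_j)] is
   [sum_j (min(0, S_j) - min(0, S_j - c_j)) A_j]. *)
Definition eliminate t (c : nat -> int) v j : int :=
  if occ j v then (neg_part (prefix_sum t c v j) - neg_part (prefix_sum t c v j - c j))%R
  else c j.

Fixpoint coeffs t : nat -> int :=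
  if t is t'.+1 then eliminate t' (coeffs t') (nth 0 vs t') else c0.

Definition sat t (x : pred nat) j := all (fun b => remaining t b && occ j b ==> x b) (iota 0 N).

(** For a nested elimination order, this turns out to be the minimum of the objective over the
    variables [take t vs], the others being fixed by [x]. *)
Definition partial_min t (x : pred nat) : int :=
  (\sum_(0 <= j < N) if sat t x j then coeffs t j else 0)%R.

(** The cofactor of the variable [nth 0 vs t] in [partial_min t]: setting that variable to 1 pays
    off exactly if this is negative. *)
Definition gain t (x : pred nat) : int :=
  (\sum_(0 <= j < N) if occ j (nth 0 vs t) && sat t.+1 x j then coeffs t j else 0)%R.

Definition comparable t j k : Prop :=
  (forall b, b < N -> remaining t b -> occ j b -> occ k b) \/
  (forall b, b < N -> remaining t b -> occ k b -> occ j b).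

Definition nest_point t v : Prop :=
  forall j k, j < N -> k < N -> occ j v -> occ k v -> comparable t j k.

Hypothesis vs_uniq : uniq vs.
Hypothesis vs_N : all (fun v => v < N) vs.

Lemma remainingS t a : t < size vs -> remaining t.+1 a = remaining t a && (a != nth 0 vs t).
Proof. by move=> tn; rewrite /remaining (take_nth 0) // mem_rcons inE negb_or andbC. Qed.

Lemma remaining_nth t : t < size vs -> remaining t (nth 0 vs t).
Proof.
move=> tn; rewrite /remaining; apply/negP => /(nthP 0)[i].
rewrite size_takel; last exact: ltnW.
move=> it; rewrite nth_take // => /eqP; rewrite nth_uniq //; last exact: ltn_trans tn.
by move/eqP=> E; rewrite E ltnn in it.
Qed.

Lemma sat_split t x j : t < size vs ->
  sat t x j = (occ j (nth 0 vs t) ==> x (nth 0 vs t)) && sat t.+1 x j.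
Proof.
move=> tn; set v := nth 0 vs t.
have vN : v < N by apply: (allP vs_N); apply: mem_nth.
apply/allP/andP => [H|[H1 /allP H2] b bN].
  split; first by have := H v; rewrite mem_iota vN remaining_nth // => ->.
  apply/allP => b /H; rewrite remainingS // => /implyP H'.
  by apply/implyP => /andP[/andP[rb _] ob]; apply: H'; rewrite rb.
apply/implyP => /andP[rb ob]; case: (eqVneq b v) => [bv|bv].
  by move: H1; rewrite -bv ob.
by have /implyP := H2 b bN; apply; rewrite remainingS // rb bv.
Qed.

Definition untouched t (x : pred nat) : int :=
  (\sum_(0 <= j < N) if ~~ occ j (nth 0 vs t) && sat t.+1 x j then coeffs t j else 0)%R.

Lemma partial_min_split t x : t < size vs ->
  partial_min t x = ((if x (nth 0 vs t) then gain t x else 0) + untouched t x)%R.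
Proof.
move=> tn; have -> : (if x (nth 0 vs t) then gain t x else 0)%R =
    (\sum_(0 <= j < N) if x (nth 0 vs t) && (occ j (nth 0 vs t) && sat t.+1 x j) then coeffs t j else 0)%R.
  by case: (x _) => //; rewrite big1.
rewrite -big_split; apply: eq_bigr => j _; rewrite sat_split //.
by case: (x _); case: (occ _ _); case: (sat _ _ _); rewrite /= ?addr0 ?add0r.
Qed.

Lemma count_subset_eq (T : eqType) (p q : pred T) (l : seq T) : uniq l ->
  {in l, forall b, p b -> q b} -> count q l <= count p l -> {in l, forall b, q b -> p b}.
Proof.
move=> l_uniq pq; rewrite -!size_filter => le b bl qb.
have [|_ E] := uniq_min_size (filter_uniq p l_uniq) _ le.
  by move=> c; rewrite !mem_filter => /andP[pc cl]; rewrite pq.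
by have := E b; rewrite !mem_filter bl qb !andbT.
Qed.

Lemma rank_inj t : {in gtn N &, injective (rank t)}.
Proof.
move=> j k /= jN kN /(congr1 (modn^~ N)); rewrite /rank !modnMDl !modn_small //.
Qed.

Lemma rank_rest t j k : j < N -> k < N -> rank t k <= rank t j -> rest_size t k <= rest_size t j.
Proof.
move=> jN kN /(leq_div2r N); rewrite /rank !divnMDl ?divn_small ?addn0 //; lia.
Qed.

(** Among the monomials through [v], those that [x] satisfies outside [v] form an initial segment
    for [rank], because a monomial of smaller rank has its remaining variables inside those of the
    larger one. Over this segment the new coefficients telescope. *)
Lemma partial_min_next t x : t < size vs -> nest_point t (nth 0 vs t) ->
  partial_min t.+1 x = (neg_part (gain t x) + untouched t x)%R.
Proof.
move=> tn nest; set v := nth 0 vs t.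
pose J := [pred j : 'I_N | occ j v]; pose D := [pred j : 'I_N | occ j v && sat t.+1 x j].
have sE (j : nat) : prefix_sum t (coeffs t) v j = (\sum_(k in J | (rank t k <= rank t j)%N) coeffs t k)%R.
  by rewrite /prefix_sum big_mkord [RHS]big_mkcond.
have gE : gain t x = (\sum_(j in D) coeffs t j)%R.
  by rewrite /gain big_mkord [RHS]big_mkcond.
rewrite gE -(@neg_part_telescope N J D (fun j => rank t j)).
- rewrite /partial_min /untouched !big_mkord [X in (X + _)%R]big_mkcond -big_split.
  apply: eq_bigr => j _ /=; rewrite /eliminate -/v !inE -!sE.
  by case: (occ j v); case: (sat _ _ _); rewrite /= ?addr0 ?add0r.
- by move=> j k _ _ /rank_inj jk; apply/val_inj/jk; apply: ltn_ord.
- by move=> j; rewrite !inE => /andP[].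
move=> j k; rewrite !inE => /andP[oj sj] ok kj; rewrite ok.
have kj' := rank_rest (ltn_ord j) (ltn_ord k) kj.
(* Comparable and not larger implies contained: even if the inclusion goes the other way, the
   cardinalities force equality. *)
have sub : {in iota 0 N, forall b, remaining t b && occ k b -> remaining t b && occ j b}.
  have [H|H] := nest j k (ltn_ord j) (ltn_ord k) oj ok; last first.
    by move=> b; rewrite mem_iota => bN /andP[rb ob]; rewrite rb H.
  apply: (count_subset_eq (iota_uniq 0 N)) kj' => b; rewrite mem_iota => bN /andP[rb ob].
  by rewrite rb H.
apply/allP => b bN; apply/implyP => /andP[rb ob].
have /implyP := allP sj b bN; apply; rewrite rb.
have rb' : remaining t b by move: rb; rewrite remainingS // => /andP[].
by have := sub b bN; rewrite rb' ob => /(_ isT).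
Qed.

Hypothesis nests : forall t, t < size vs -> nest_point t (nth 0 vs t).

Lemma neg_part_le z : (neg_part z <= z)%R /\ (neg_part z <= 0)%R.
Proof. by rewrite /neg_part; case: ifP; lia. Qed.

Lemma partial_min_le x t : t <= size vs -> (partial_min t x <= partial_min 0 x)%R.
Proof.
elim: t => // t IH tn; apply: le_trans (IH (ltnW tn)).
rewrite partial_min_next ?partial_min_split ?lerD2r //; last exact: nests.
by have [? ?] := neg_part_le (gain t x); case: ifP.
Qed.

Lemma partial_min_eq x t : t <= size vs ->
  (forall t', t' < t -> x (nth 0 vs t') = (gain t' x < 0)%R) ->
  partial_min t x = partial_min 0 x.
Proof.
elim: t => // t IH tn dec; rewrite -IH ?(ltnW tn) //; last by move=> t' t't; apply: dec; apply: leqW.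
rewrite partial_min_next ?[RHS]partial_min_split //; last exact: nests.
by congr (_ + _)%R; rewrite dec // /neg_part; case: ltrgt0P => [|| ->].
Qed.

Hypothesis occ_vs : forall j b, occ j b -> b \in vs.

Lemma partial_min_last x : partial_min (size vs) x = (\sum_(0 <= j < N) coeffs (size vs) j)%R.
Proof.
apply: eq_bigr => j _; rewrite ifT //; apply/allP => b _.
by apply/implyP => /andP[]; rewrite /remaining take_size => /negP nb /occ_vs.
Qed.

(** After all eliminations the value no longer depends on the point. It is a lower bound for each
    [y], and [x] attains it because each of its decisions realises the negative part of a gain. *)
Lemma back_substitution_optimal x :
  (forall t, t < size vs -> x (nth 0 vs t) = (gain t x < 0)%R) ->
  forall y, (partial_min 0 x <= partial_min 0 y)%R.
Proof.
move=> dec y; rewrite -(@partial_min_eq x (size vs)) // partial_min_last -(partial_min_last y).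
exact: partial_min_le.
Qed.

End VariableElimination.

(** On the remaining variables [V], the intersection graph is a subgraph of a forest, so some
    monomial [u] that meets [V] has at most one neighbour, provided that any monomial meets [V].
    Either some variable of [u] in [V] lies in no other monomial, or all of them lie in the only
    neighbour [p]; then the monomials through any of them are [u] and [p], and [u :&: V] is inside
    [p]. *)
Lemma nest_point_exists N n (s : seq {set 'I_n}) (vs : seq nat) :
  acyclic [set m in s] -> size vs < n ->
  exists i, [/\ i < n, i \notin vs & nest_point N (occurs s) vs (size vs) i].
Proof.
move=> acyc vs_n; pose V := [set i : 'I_n | val i \notin vs].
have remE a : remaining vs (size vs) a = (a \notin vs) by rewrite /remaining take_size.
have [i1 i1V] : exists i, i \in V.
  apply/existsP; apply: contraLR vs_n; rewrite negb_exists -leqNgt => /forallP V0.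
  rewrite -(size_iota 0 n); apply: (@uniq_leq_size _ (iota 0 n)); first exact: iota_uniq.
  move=> i; rewrite mem_iota => iN; have := V0 (Ordinal (iN : i < n)).
  by rewrite inE negbK.
pose e (m1 m2 : {set 'I_n}) := (m1 != m2) && (m1 :&: m2 :&: V != set0).
have e_sym : symmetric e by move=> m1 m2; rewrite /e eq_sym (setIC m1).
have eI i (m1 m2 : {set 'I_n}) : i \in m1 -> i \in m2 -> i \in V -> m1 != m2 -> e m1 m2.
  by move=> i1' i2' iV m12; rewrite /e m12; apply/set0Pn; exists i; rewrite !inE i1' i2'; move: iV; rewrite inE.
pose U := [set m in s | m :&: V != set0].
have UI i (m : {set 'I_n}) : i \in m -> i \in V -> m \in s -> m \in U.
  by move=> im iV ms; rewrite inE ms; apply/set0Pn; exists i; rewrite inE im.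
(* Taking [p = u] covers the case of a single monomial through [i], and [u = p = set0] that of
   none. *)
have enough i (u p : {set 'I_n}) : i \in V -> u :&: V \subset p ->
    (forall m, m \in s -> i \in m -> m = u \/ m = p) ->
    exists i, [/\ i < n, i \notin vs & nest_point N (occurs s) vs (size vs) i].
  move=> iV up im; exists (val i); split; [exact: ltn_ord | by move: iV; rewrite inE |].
  have nthE j : occurs s j (val i) -> nth set0 s j = u \/ nth set0 s j = p.
    move=> oji; have /andP[js _] := occurs_lt oji.
    by apply: im; [apply: mem_nth | rewrite -occursE].
  have sub j k : nth set0 s j = u -> nth set0 s k = u \/ nth set0 s k = p ->
      forall b, b < N -> remaining vs (size vs) b -> occurs s j b -> occurs s k b.
    move=> ju kE b _; rewrite remE => bV ojb; have /andP[_ bn] := occurs_lt ojb.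
    move: ojb bV; rewrite -[b]/(val (Ordinal bn)) !occursE ju => bu bV.
    case: kE => -> //; apply: (subsetP up); rewrite !inE bu; exact: bV.
  move=> j k _ _ /nthE jE /nthE kE; case: (jE) => [ju|jp]; first by left; apply: sub.
  case: (kE) => [ku|kp]; first by right; apply: sub.
  by left=> b _ _; rewrite /occurs jp kp.
pose branching u := [exists v in U, exists w in U, [&& v != w, e u v & e u w]].
have [/existsP[u /andP[uU /negP leaf]]|] := boolP [exists u in U, ~~ branching u]; last first.
  move=> nleaf; have [U0|U0] := eqVneq U set0.
    apply: (enough i1 set0 set0) => //; first by rewrite set0I sub0set.
    by move=> m ms i1m; have := UI _ _ i1m i1V ms; rewrite U0 inE.
  have [||c [c3 cu cc cU]] := min_degree_cycle (U := U) e_sym _ U0.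
  - by move=> m; rewrite /e eqxx.
  - move=> u uU; move: nleaf; rewrite negb_exists => /forallP/(_ u); rewrite uU negbK.
    move=> /existsP[v /andP[vU /existsP[w /and4P[wU vw uv uw]]]].
    by exists v, w.
  have /negP[] : ~~ cycle (@meets n) c.
    by apply: acyc => // m /cU; rewrite !inE => /andP[].
  apply: sub_cycle cc => m1 m2 /andP[m12 m12V]; rewrite /meets m12.
  by apply: contraNneq m12V => ->; rewrite set0I.
have nbr v w : v \in U -> w \in U -> e u v -> e u w -> v = w.
  move=> vU wU uv uw; apply/eqP/negPn/negP => vw; apply: leaf.
  by apply/existsP; exists v; rewrite vU; apply/existsP; exists w; rewrite wU vw uv.
have us : u \in s by move: uU; rewrite inE => /andP[].
have [i0 i0u i0V] : exists2 i, i \in u & i \in V.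
  by move: uU; rewrite inE => /andP[_ /set0Pn[i]]; rewrite inE => /andP[]; exists i.
have [/existsP[i /and3P[iu iV /allP own]]|] :=
    boolP [exists i, [&& i \in u, i \in V & all (fun m : {set 'I_n} => (i \in m) ==> (m == u)) s]].
  apply: (enough i u u) => //; first exact: subsetIl.
  by move=> m ms im; left; apply/eqP; have := own m ms; rewrite im.
rewrite negb_exists => /forallP shared.
have other i : i \in u -> i \in V -> exists2 m, m \in U /\ i \in m & e u m.
  move=> iu iV; have := shared i; rewrite iu iV => /allPn[m ms].
  rewrite negb_imply => /andP[im mu]; exists m; first by split=> //; apply: UI im iV ms.
  by apply: eI iV _ => //; rewrite eq_sym.
have [p [pU i0p] up] := other i0 i0u i0V.
apply: (enough i0 u p) => //.
  apply/subsetP => i; rewrite inE => /andP[iu iV].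
  by have [m [mU im] um] := other i iu iV; rewrite (nbr p m).
move=> m ms i0m; case: (eqVneq m u) => [->|mu]; first by left.
by right; apply: nbr => //; [apply: UI i0m i0V ms | apply: eI i0V _; rewrite // eq_sym].
Qed.

(** * Solving the optimization problem *)

(* Array 2 contains the elimination order, array 3 the common denominator and
   array 4 the coefficients after [t] eliminations, from index [t * N] on. *)
Definition Remaining et ea :=
  Bnot (Bex 8 (Band (Blt (EVar 8) et) (Beq (Get 2 (EVar 8)) ea))).

Definition NotSubset K et ej ek b :=
  Bex b (Band (Band (Remaining et (EVar b)) (Occurs K ej (EVar b))) (Bnot (Occurs K ek (EVar b)))).

Definition NestPoint K et ei :=
  Bnot (Bex 3 (Band (Occurs K (EVar 3) ei) (Bex 4 (Band (Occurs K (EVar 4) ei)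
    (Band (NotSubset K et (EVar 3) (EVar 4) 5) (NotSubset K et (EVar 4) (EVar 3) 5)))))).

(** There is no early exit: later candidates overwrite earlier ones. This is harmless because
    [Remaining] consults only the entries below the current position. *)
Definition order_cmd K : cmd :=
  CFor 0 (CIf (Blt (EVar 0) (In K (enat 0)))
    (CFor 1 (CIf (Band (Blt (EVar 1) (In K (enat 0)))
                   (Band (Remaining (EVar 0) (EVar 1)) (NestPoint K (EVar 0) (EVar 1))))
      (Put 2 (EVar 0) (EVar 1)) CSkip)) CSkip).

Section OrderCmd.
Variables (K N n : nat) (s : seq {set 'I_n}) (inp : seq int).
Hypotheses (K_gt0 : 0 < K) (K_N : 2 * K <= N + 2) (inp_N : size inp <= N) (inp_enc : encodes s inp).
Hypothesis n_N : n <= N.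

Let occ := occurs s.

Definition holds_order (vs : seq nat) t (mem : memory) : Prop :=
  forall t', t' < t -> arr N mem 2 t' = Posz (nth 0 vs t').

Lemma ev_remaining env mem vs t a et ea : holds_order vs t mem -> t <= size vs -> t <= N ->
  (forall i, ev N (upd env 8 (Posz i)) mem et = Posz t) ->
  (forall i, ev N (upd env 8 (Posz i)) mem ea = Posz a) ->
  ev N env mem (Remaining et ea) = bz (remaining vs t a).
Proof.
move=> ord tvs tN ett eaa.
have -> : remaining vs t a = ~~ has (fun i => (i < t) && (nth 0 vs i == a)) (iota 0 N).
  congr (~~ _); apply/(nthP 0)/hasP => [[i]|[i _ /andP[it /eqP ia]]].
    rewrite size_takel // => it; rewrite nth_take // => ia.
    by exists i; rewrite ?mem_iota ?it ?ia ?eqxx //= (leq_trans it).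
  by exists i; rewrite ?size_takel ?nth_take.
apply: ev_bnot; apply: ev_bex => i iN; apply: ev_band; first exact: ev_blt.
by move=> it; apply: ev_beq; rewrite // (@ev_get _ _ _ _ _ i) // ord.
Qed.

Lemma ev_n env mem : ready K N s inp mem -> ev N env mem (In K (enat 0)) = Posz n.
Proof.
move=> [hin _]; rewrite (@ev_in _ _ _ _ inp _ 0) ?(enc_n inp_enc) //.
by apply: leq_trans (enc_size inp_enc); rewrite leq_addr.
Qed.

Definition nest_pointb vs t v : bool :=
  ~~ has (fun j => occ j v && has (fun k => occ k v &&
      (has (fun b => (remaining vs t b && occ j b) && ~~ occ k b) (iota 0 N) &&
       has (fun b => (remaining vs t b && occ k b) && ~~ occ j b) (iota 0 N))) (iota 0 N)) (iota 0 N).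

Lemma nest_pointP vs t v : reflect (nest_point N occ vs t v) (nest_pointb vs t v).
Proof.
have subP j k : reflect (forall b, b < N -> remaining vs t b -> occ j b -> occ k b)
    (~~ has (fun b => (remaining vs t b && occ j b) && ~~ occ k b) (iota 0 N)).
  apply: (iffP hasPn) => [H b bN rb ob|H b].
    by have := H b; rewrite mem_iota bN rb ob negbK => ->.
  by rewrite mem_iota => /(H b); case: (remaining _ _ _) => // /(_ isT); case: (occ j b) => // ->.
apply: (iffP hasPn) => [H j k jN kN ojv okv|H j].
  have := H j; rewrite mem_iota jN ojv => /(_ isT)/hasPn/(_ k).
  by rewrite mem_iota kN okv andTb negb_and => /(_ isT)/orP[/subP|/subP]; [left|right].
rewrite mem_iota => jN; rewrite negb_and; case ojv: (occ j v) => //=.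
apply/hasPn => k; rewrite mem_iota => kN; case okv: (occ k v) => //=.
by rewrite negb_and; apply/orP; case: (H j k jN kN ojv okv) => /subP ?; [left|right].
Qed.

Lemma ev_nest_point env mem vs t v : ready K N s inp mem -> holds_order vs t mem ->
  t <= size vs -> t <= N -> env 0 = Posz t -> env 1 = Posz v ->
  ev N env mem (NestPoint K (EVar 0) (EVar 1)) = bz (nest_pointb vs t v).
Proof.
move=> rdy ord tvs tN e0 e1; have oc := ev_occurs K_gt0 K_N inp_N inp_enc.
have rm := @ev_remaining _ _ _ _ _ _ _ ord tvs tN.
apply: ev_bnot; apply: ev_bex => j jN; apply: ev_band; first exact: oc.
move=> _; apply: ev_bex => k kN; apply: ev_band; first exact: oc.
move=> _; apply: ev_band => [|_]; apply: ev_bex => b bN.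
  apply: ev_band => [|_]; last by apply: ev_bnot; apply: oc.
  by apply: ev_band => [|_]; [apply: rm | apply: oc].
apply: ev_band => [|_]; last by apply: ev_bnot; apply: oc.
by apply: ev_band => [|_]; [apply: rm | apply: oc].
Qed.

Hypothesis nest_exists : forall vs, size vs < n ->
  exists i, [/\ i < n, i \notin vs & nest_point N occ vs (size vs) i].

Definition good_order vs : Prop :=
  [/\ uniq vs, all (fun v => v < n) vs & forall t, t < size vs -> nest_point N occ vs t (nth 0 vs t)].

Lemma good_order_rcons vs v : good_order vs -> v < n -> v \notin vs ->
  nest_point N occ vs (size vs) v -> good_order (rcons vs v).
Proof.
move=> [uvs nvs nest] vn v_vs nv; split.
- by rewrite rcons_uniq v_vs.
- by rewrite all_rcons vn.
have remE t a : t <= size vs -> remaining (rcons vs v) t a = remaining vs t a.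
  by move=> tvs; rewrite /remaining -cats1 takel_cat.
have npE t w : t <= size vs -> nest_point N occ vs t w -> nest_point N occ (rcons vs v) t w.
  move=> tvs np j k jN kN ojw okw; case: (np j k jN kN ojw okw) => H; [left|right] => b bN.
    by rewrite remE //; apply: H.
  by rewrite remE //; apply: H.
move=> t; rewrite size_rcons ltnS leq_eqVlt => /orP[/eqP->|tvs].
  by rewrite nth_rcons ltnn eqxx; apply: npE.
by rewrite nth_rcons tvs; apply: npE; [exact: ltnW | exact: nest].
Qed.

Lemma touches_order : touches [:: 2] (order_cmd K).
Proof. by repeat constructor. Qed.

Lemma ex_order env mem : ready K N s inp mem ->
  let mem' := ex N env (order_cmd K) mem in
  exists vs, [/\ size vs = n, good_order vs & holds_order vs n mem'].
Proof.
move=> rdy mem'; rewrite /mem' /order_cmd ex_for; set body := CIf _ _ _.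
suff H m : m <= N -> let mem1 := iter_for N env 0 body m mem in ready K N s inp mem1 /\
    exists vs, [/\ size vs = minn m n, good_order vs & holds_order vs (minn m n) mem1].
  by have [_] := H N (leqnn _); rewrite (minn_idPr n_N).
elim: m => [_|m IH mN] /=.
  by rewrite iter_for0; split=> //; exists [::]; rewrite min0n; split=> //; split.
have [rdy1 [vs [szvs gvs ord]]] := IH (ltnW mN); rewrite iter_forS.
set mem1 := iter_for N env 0 body m mem in rdy1 ord *.
rewrite {2}/body; set env1 := upd env 0 _.
have cE : ev N env1 mem1 (Blt (EVar 0) (In K (enat 0))) = bz (m < n).
  by apply: ev_blt => //; apply: ev_n.
rewrite (ex_ifb _ _ cE).
case: ltnP => mn; last first.
  by split=> //; exists vs; rewrite (minn_idPr (leqW mn)); rewrite (minn_idPr mn) in szvs ord.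
rewrite (minn_idPl mn); rewrite (minn_idPl (ltnW mn)) in szvs ord.
set sel := CIf _ _ _; rewrite ex_for.
pose good i := [&& i < n, i \notin vs & nest_pointb vs m i].
have goodE i : good i = (i < n) && (remaining vs m i && nest_pointb vs m i).
  by rewrite /good /remaining -szvs take_size.
have inner p : let mem2 := iter_for N env1 1 sel p mem1 in
    [/\ ready K N s inp mem2, holds_order vs m mem2 &
     (exists2 i, good i & arr N mem2 2 m = Posz i) \/ forall i, i < p -> ~~ good i].
  elim: p => [|p [rdy2 ord2 found]] /=; first by rewrite iter_for0; split=> //; right.
  rewrite iter_forS; set mem2 := iter_for N env1 1 sel p mem1 in rdy2 ord2 found *.
  set env2 := upd env1 1 _; rewrite {2}/sel.
  have gE : ev N env2 mem2 (Band (Blt (EVar 1) (In K (enat 0)))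
      (Band (Remaining (EVar 0) (EVar 1)) (NestPoint K (EVar 0) (EVar 1)))) = bz (good p).
    rewrite goodE; apply: ev_band => [|_]; first by apply: ev_blt => //; apply: ev_n.
    apply: ev_band => [|_].
      by apply: (ev_remaining (vs := vs) (t := m)) => //; [rewrite szvs | apply: ltnW].
    by apply: ev_nest_point => //; [rewrite szvs | apply: ltnW].
  rewrite (ex_ifb _ _ gE); case gp: (good p); last first.
    split=> //; case: found => [?|nf]; [by left | right=> i].
    by rewrite ltnS leq_eqVlt => /orP[/eqP->|/nf //]; rewrite gp.
  split.
  - by rewrite (@ex_put _ _ _ _ _ _ m) //; apply: ready_upd.
  - move=> t' t'm; rewrite (@arr_put _ _ _ _ _ _ m) // eqxx andTb ifF ?ord2 //.
    by rewrite ltn_eqF.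
  - by left; exists p => //; rewrite (@arr_put _ _ _ _ _ _ m) // !eqxx.
have [rdy2 ord2 found] := inner N; split=> //.
have [i0 [i0n i0vs /nest_pointP i0nest]] : exists i, [/\ i < n, i \notin vs & nest_point N occ vs m i].
  by rewrite -szvs; apply: nest_exists; rewrite szvs.
have [i /and3P[i_n i_vs /nest_pointP nest_i] arr_i] : exists2 i, good i & arr N (iter_for N env1 1 sel N mem1) 2 m = Posz i.
  case: found => // /(_ i0 (leq_trans i0n n_N)); by rewrite /good i0n i0vs i0nest.
exists (rcons vs i); split.
- by rewrite size_rcons szvs.
- by apply: good_order_rcons; rewrite // szvs.
- move=> t'; rewrite ltnS leq_eqVlt nth_rcons szvs => /orP[/eqP->|t'm].
    by rewrite ltnn eqxx.
  by rewrite t'm ord2.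
Qed.

End OrderCmd.

(** * Scaling to integral coefficients *)

Lemma safec_if N b env mem z0 e c1 c2 p : small b (Posz z0) -> small b (Posz N) -> plain z0 e ->
  ev N env mem e = bz p -> (p -> safec N b env mem c1) -> safec N b env mem c2 ->
  safec N b env mem (CIf e c1 c2).
Proof.
move=> z0b Nb pe eE s1 s2; split; first exact: plain_safe pe.
by rewrite eE; case: p eE s1 => // _; apply.
Qed.

Lemma safec_put N b env mem z0 A e v : small b (Posz z0) -> small b (Posz N) ->
  8 <= z0 -> A <= z0 -> plain z0 e -> safe N b env mem v -> safec N b env mem (Put A e v).
Proof.
move=> z0b Nb z8 Az pe sv; split; last case: ifP => //.
  by apply: (@plain_safe z0) => //; rewrite /= pe /=; lia.
by split=> //; apply: (@plain_safe z0) => //; rewrite /= pe /= z8 Az.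
Qed.

(** Entry [size s] of array 1 is the position where the coefficients begin, with two entries for
    each. *)
Definition num_pos K := eadd (Get 1 (In K (enat 1))) (eadd (EVar 0) (EVar 0)).
Definition den_pos K := eadd (num_pos K) (enat 1).

(** The growing product is the first factor and the input entry the second, as safety demands. *)
Definition denominator_body K : cmd :=
  CIf (Blt (EVar 0) (In K (enat 1)))
    (Put 3 (enat 0) (EBin Bmul (Get 3 (enat 0)) (In K (den_pos K)))) CSkip.

Definition numerator_body K : cmd :=
  CIf (Blt (EVar 0) (In K (enat 1)))
    (Put 4 (EVar 0) (EBin Bmul (EBin Bdiv (Get 3 (enat 0)) (In K (den_pos K)))
       (In K (num_pos K)))) CSkip.

Definition scale_cmd K : cmd :=
  CSeq (Put 3 (enat 0) (enat 1))
    (CSeq (CFor 0 (denominator_body K)) (CFor 0 (numerator_body K))).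

Lemma size_enc_inst n (s : seq {set 'I_n}) (a : {set 'I_n} -> rat) :
  size (enc_inst s a) = offset s (size s) + 2 * size s.
Proof.
rewrite /enc_inst size_cat size_enc_monos; congr (_ + _).
by elim: s => //= m t IH; lia.
Qed.

Lemma nth_enc_inst n (s : seq {set 'I_n}) (a : {set 'I_n} -> rat) j : j < size s ->
  nth 0%R (enc_inst s a) (offset s (size s) + (j + j)) = numq (a (nth set0 s j)) /\
  nth 0%R (enc_inst s a) (offset s (size s) + (j + j) + 1) = denq (a (nth set0 s j)).
Proof.
move=> js; rewrite /enc_inst -addnA !nth_cat !size_enc_monos !ltnNge !leq_addr /= !addKn.
elim: s j js => //= m t IH [|j] //= js.
by have := IH j js; rewrite !addnS.
Qed.

Section ScaleCmd.
Variables (K N n : nat) (s : seq {set 'I_n}) (inp : seq int) (a : {set 'I_n} -> rat).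
Hypotheses (K_gt0 : 0 < K) (K_N : 2 * K <= N + 2) (inp_N : size inp <= N).
Hypothesis inp_a : inp = enc_inst s a.

Let inp_enc : encodes s inp.
Proof. by rewrite inp_a; eexists. Qed.

Definition denominators k : int := (\prod_(0 <= j < k) denq (a (nth set0 s j)))%R.

Definition scaled j : int :=
  if j < size s then
    (divz (denominators (size s)) (denq (a (nth set0 s j))) * numq (a (nth set0 s j)))%R
  else 0%R.

Let enc_coef j : j < size s ->
  nth 0%R inp (offset s (size s) + (j + j)) = numq (a (nth set0 s j)) /\
  nth 0%R inp (offset s (size s) + (j + j) + 1) = denq (a (nth set0 s j)).
Proof. by rewrite inp_a; apply: nth_enc_inst. Qed.

Lemma ev_m env mem : ready K N s inp mem -> ev N env mem (In K (enat 1)) = Posz (size s).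
Proof.
move=> [hin _]; rewrite (@ev_in _ _ _ _ inp _ 1) ?(enc_m inp_enc) //.
by apply: leq_trans (enc_size inp_enc); rewrite leq_addr.
Qed.

Lemma ev_num_pos env mem j : ready K N s inp mem -> env 0 = Posz j ->
  ev N env mem (num_pos K) = Posz (offset s (size s) + (j + j)).
Proof.
move=> rdy e0; apply: ev_add; last exact: ev_add.
by rewrite (ev_get 1 (ev_m env rdy)) rdy.2.
Qed.

Lemma ev_num env mem j : ready K N s inp mem -> env 0 = Posz j -> j < size s ->
  ev N env mem (In K (num_pos K)) = numq (a (nth set0 s j)).
Proof.
move=> rdy e0 js; rewrite (ev_in K_gt0 K_N rdy.1 (ev_num_pos rdy e0)) ?(enc_coef js).1 //.
by rewrite inp_a size_enc_inst; lia.
Qed.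

Lemma ev_den env mem j : ready K N s inp mem -> env 0 = Posz j -> j < size s ->
  ev N env mem (In K (den_pos K)) = denq (a (nth set0 s j)).
Proof.
move=> rdy e0 js; have posE := ev_add (ev_num_pos rdy e0) (ev_enat N env mem 1).
rewrite (ev_in K_gt0 K_N rdy.1 posE) ?(enc_coef js).2 //.
by rewrite inp_a size_enc_inst; lia.
Qed.

Let sN : size s <= N.
Proof. exact: leq_trans (size_leq_offset s) (leq_trans (enc_size inp_enc) inp_N). Qed.

Let mem1 env mem := ex N env (Put 3 (enat 0) (enat 1)) mem.
Let mem2 env mem := ex N env (CFor 0 (denominator_body K)) (mem1 env mem).

Lemma denominator_loop env mem k : ready K N s inp mem ->
  let mem' := iter_for N env 0 (denominator_body K) k (mem1 env mem) in
  ready K N s inp mem' /\ arr N mem' 3 0 = denominators (minn k (size s)).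
Proof.
move=> rdy; elim: k => [|k [rdy' IH]] /=.
  rewrite iter_for0 min0n /mem1; split; first by apply: (ready_frame K_gt0 K_N inp_N inp_enc (As := [:: 3])) => //; constructor.
  by rewrite (@arr_put _ _ _ _ _ _ 0) // /denominators big_geq.
rewrite iter_forS; set mem' := iter_for _ _ _ _ k _ in rdy' IH *.
have cE : ev N (upd env 0 (Posz k)) mem' (Blt (EVar 0) (In K (enat 1))) = bz (k < size s).
  by apply: ev_blt => //; apply: ev_m.
rewrite (ex_ifb _ _ cE); case: ltnP => ks; last by rewrite (minn_idPr (leqW ks)); rewrite (minn_idPr ks) in IH.
rewrite (minn_idPl ks); rewrite (minn_idPl (ltnW ks)) in IH; split.
  by rewrite (@ex_put _ _ _ _ _ _ 0) //; apply: ready_upd.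
rewrite (@arr_put _ _ _ _ _ _ 0) // !eqxx -[LHS]/(ev N (upd env 0 (Posz k)) mem' (Get 3 (enat 0)) *
  ev N (upd env 0 (Posz k)) mem' (In K (den_pos K)))%R.
by rewrite (@ev_get _ _ _ _ _ 0) // IH (@ev_den _ _ k) // /denominators big_nat_recr.
Qed.

Lemma ready_mem2 env mem : ready K N s inp mem -> ready K N s inp (mem2 env mem) /\
  arr N (mem2 env mem) 3 0 = denominators (size s).
Proof.
by move=> rdy; have := denominator_loop env N rdy; rewrite (minn_idPr sN).
Qed.

Lemma numerator_loop env mem k : ready K N s inp mem -> k <= N ->
  let mem' := iter_for N env 0 (numerator_body K) k (mem2 env mem) in
  [/\ ready K N s inp mem', arr N mem' 3 0 = denominators (size s) &
   forall j, j < N -> arr N mem' 4 j = if j < k then (if j < size s then scaled j else arr N mem 4 j) else arr N mem 4 j].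
Proof.
move=> rdy; elim: k => [|k IH] kN /=.
  have [rdy2 E] := ready_mem2 env rdy; rewrite iter_for0; split=> // j jN.
  have t3 : touches [:: 3] (CSeq (Put 3 (enat 0) (enat 1)) (CFor 0 (denominator_body K))).
    by repeat constructor.
  exact: (touches_arr N env mem j t3).
have [rdy' E' IH'] := IH (ltnW kN).
rewrite iter_forS; set mem' := iter_for _ _ _ _ k _ in rdy' E' IH' *.
have cE : ev N (upd env 0 (Posz k)) mem' (Blt (EVar 0) (In K (enat 1))) = bz (k < size s).
  by apply: ev_blt => //; apply: ev_m.
rewrite (ex_ifb _ _ cE); case: ltnP => ks; last first.
  split=> // j jN; rewrite IH' // [in RHS]ltnS [in RHS]leq_eqVlt; case: (j =P k) => [->|_] //=.
  by rewrite ltnn ltnNge ks.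
split.
- by rewrite (@ex_put _ _ _ _ _ _ k) //; apply: ready_upd.
- by rewrite (@arr_put _ _ _ _ _ _ k).
move=> j jN; rewrite (@arr_put _ _ _ _ _ _ k) // eqxx andTb ltnS leq_eqVlt.
case: eqP => [->|_] /=; last by rewrite IH'.
rewrite -[LHS]/(divz (ev N (upd env 0 (Posz k)) mem' (Get 3 (enat 0)))
    (ev N (upd env 0 (Posz k)) mem' (In K (den_pos K))) *
  ev N (upd env 0 (Posz k)) mem' (In K (num_pos K)))%R.
by rewrite (@ev_get _ _ _ _ _ 0) // E' (@ev_den _ _ k) // (@ev_num _ _ k) // ks /scaled ks.
Qed.

Lemma ex_scale env mem : ready K N s inp mem -> (forall j, arr N mem 4 j = 0%R) ->
  let mem' := ex N env (scale_cmd K) mem in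
  ready K N s inp mem' /\ forall j, j < N -> arr N mem' 4 j = scaled j.
Proof.
move=> rdy zero; rewrite /scale_cmd !ex_seq.
have [rdy' _ E] := numerator_loop env rdy (leqnn N); split=> // j jN.
by rewrite E // jN zero; case: ifP => // js; rewrite /scaled js.
Qed.

(** Here safety depends on the data: the second factors are input entries, which only the loop
    invariants identify. *)
Lemma safe_scale b z0 env mem : small b (Posz z0) -> small b (Posz N) ->
  8 <= z0 -> 2 * K <= z0 -> (forall i, small b (nth 0%R inp i)) ->
  ready K N s inp mem -> safec N b env mem (scale_cmd K).
Proof.
move=> z0b Nb z8 zK inpb rdy.
have pIn e : plain z0 e -> plain z0 (In K e) by move=> pe; rewrite /= pe /=; lia.
have pnum : plain z0 (num_pos K) by rewrite /= ?andbT; lia.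
have pden : plain z0 (den_pos K) by rewrite /= ?andbT; lia.
have ps := fun e env mem => @plain_safe z0 N b env mem e z0b Nb.
have safe_den i : safec N b (upd env 0 (Posz i))
    (iter_for N env 0 (denominator_body K) i (mem1 env mem)) (denominator_body K).
  have [rdy' _] := denominator_loop env i rdy.
  apply: (@safec_if N b _ _ z0 _ _ _ (i < size s)) => //; first by rewrite /= ?andbT; lia.
    by apply: ev_blt; [|apply: ev_m].
  move=> is_; apply: (@safec_put N b _ _ z0) => //; first lia.
  split; [by apply: ps; rewrite /= ?andbT; lia | exact/ps/pIn |].
  by rewrite (@ev_den _ _ i) // -(enc_coef is_).2.
have safe_num i : i < N -> safec N b (upd env 0 (Posz i))
    (iter_for N env 0 (numerator_body K) i (mem2 env mem)) (numerator_body K).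
  move=> iN; have [rdy' _ _] := numerator_loop env rdy (ltnW iN).
  apply: (@safec_if N b _ _ z0 _ _ _ (i < size s)) => //; first by rewrite /= ?andbT; lia.
    by apply: ev_blt; [|apply: ev_m].
  move=> is_; apply: (@safec_put N b _ _ z0) => //; first lia.
  split; [split=> // | exact/ps/pIn |].
  - by apply: ps; rewrite /= ?andbT; lia.
  - exact/ps/pIn.
  by rewrite (@ev_num _ _ i) // -(enc_coef is_).1.
have safe1 : safec N b env mem (Put 3 (enat 0) (enat 1)).
  by apply: (@safec_put N b _ _ z0) => //; [lia | apply: (ps (enat 1)) => /=; lia].
by split; [exact: safe1 | split=> i iN; [exact: safe_den | exact: safe_num]].
Qed.

End ScaleCmd.

(** * Elimination and back substitution *)

Definition Coef et ej := Get 4 (eadd (EBin Bmul et ELim) ej).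

Definition Rank K et ej :=
  eadd (EBin Bmul (ESum 5 (Band (Remaining et (EVar 5)) (Occurs K ej (EVar 5)))) ELim) ej.

Definition Eneg e := EIf e (enat 0) e.

Definition PrefixSum K et ej :=
  ESum 2 (EIf (Band (Occurs K (EVar 2) (Get 2 et)) (Blt (Rank K et (EVar 2)) (eadd (Rank K et ej) (enat 1))))
    (Coef et (EVar 2)) (enat 0)).

(** Each stage gets a row of its own, since back substitution needs the coefficients of all
    stages. *)
Definition coeffs_cmd K : cmd :=
  CFor 0 (CIf (Blt (EVar 0) (In K (enat 0)))
    (CFor 1 (Put 4 (eadd (EBin Bmul (eadd (EVar 0) (enat 1)) ELim) (EVar 1))
      (EIf (Occurs K (EVar 1) (Get 2 (EVar 0)))
        (esub (Eneg (PrefixSum K (EVar 0) (EVar 1)))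
              (Eneg (esub (PrefixSum K (EVar 0) (EVar 1)) (Coef (EVar 0) (EVar 1)))))
        (Coef (EVar 0) (EVar 1))))) CSkip).

Definition Sat K et ej :=
  Bnot (Bex 5 (Band (Band (Remaining et (EVar 5)) (Occurs K ej (EVar 5))) (Bnot (Get 0 (EVar 5))))).

Definition Gain K et :=
  ESum 2 (EIf (Band (Occurs K (EVar 2) (Get 2 et)) (Sat K (eadd et (enat 1)) (EVar 2)))
    (Coef et (EVar 2)) (enat 0)).

Definition back_cmd K : cmd :=
  let et := esub (In K (enat 0)) (eadd (EVar 0) (enat 1)) in
  CFor 0 (CIf (Blt (EVar 0) (In K (enat 0)))
    (Put 0 (Get 2 et) (EIf (esub (enat 0) (Gain K et)) (enat 1) (enat 0))) CSkip).

Section EliminationCmd.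
Variables (K N n : nat) (s : seq {set 'I_n}) (inp : seq int) (vs : seq nat) (c0 : nat -> int).
Hypotheses (K_gt0 : 0 < K) (K_N : 2 * K <= N + 2) (inp_N : size inp <= N) (inp_enc : encodes s inp).
Hypothesis n_N : n <= N.
Hypothesis vs_n : size vs = n.
Hypotheses (vs_uniq : uniq vs) (vs_lt : all (fun v => v < n) vs).

Let occ := occurs s.
Let coef := coeffs N occ vs c0.
Let rdyP := ready K N s inp.

(* Variables 3 and above may be bound inside the expressions that [e] is
   plugged into. *)
Definition stable mem (env : nat -> int) e z :=
  forall env' : nat -> int, (forall k, k < 3 -> env' k = env k) -> ev N env' mem e = z.

Lemma stable_upd mem env e z k i : stable mem env e z -> 3 <= k -> stable mem (upd env k i) e z.
Proof.
move=> st k3 env' eE; apply: st => l l3; rewrite eE // /upd; case: eqP => // lk; lia.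
Qed.

Lemma stable_ev mem env e z : stable mem env e z -> ev N env mem e = z.
Proof. by apply. Qed.

Lemma stable_var mem env k z : k < 3 -> env k = z -> stable mem env (EVar k) z.
Proof. by move=> k3 <- env' eE; apply: eE. Qed.

Lemma ev_coef env mem t et j ej : ev N env mem et = Posz t -> ev N env mem ej = Posz j ->
  ev N env mem (Coef et ej) = arr N mem 4 (t * N + j).
Proof. by move=> etE ejE; apply: ev_get; rewrite /= etE ejE; lia. Qed.

Lemma ev_order env mem t et : holds_order N vs n mem -> ev N env mem et = Posz t -> t < n ->
  ev N env mem (Get 2 et) = Posz (nth 0 vs t).
Proof. by move=> ord etE tn; rewrite (ev_get 2 etE) ord. Qed.

Lemma ev_rem_occ env mem t et j ej b : rdyP mem -> holds_order N vs n mem -> t <= n ->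
  stable mem env et (Posz t) -> stable mem env ej (Posz j) ->
  ev N (upd env 5 (Posz b)) mem (Band (Remaining et (EVar 5)) (Occurs K ej (EVar 5))) =
  bz (remaining vs t b && occ j b).
Proof.
move=> rdy ord tn etS ejS; apply: ev_band => [|_].
  apply: (ev_remaining (vs := vs) (t := t)) => //; rewrite ?vs_n ?(leq_trans tn) //.
    by move=> t' t't; apply: ord; apply: leq_trans tn.
  by move=> i; apply: stable_ev; do 2 apply: stable_upd => //.
apply: (ev_occurs K_gt0 K_N inp_N inp_enc) => // [i|]; apply: stable_ev; do ?apply: stable_upd => //.
Qed.

Lemma ev_rank env mem t et j ej : rdyP mem -> holds_order N vs n mem -> t <= n ->
  stable mem env et (Posz t) -> stable mem env ej (Posz j) ->
  ev N env mem (Rank K et ej) = Posz (rank N occ vs t j).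
Proof.
move=> rdy ord tn etS ejS; apply: ev_add; last exact: stable_ev.
set e := ESum _ _; have eE : ev N env mem e = Posz (rest_size N occ vs t j).
  by apply: ev_count => b bN; apply: ev_rem_occ.
by cbn [ev bfun]; rewrite eE; lia.
Qed.

Definition row t mem := forall j, j < N -> arr N mem 4 (t * N + j) = coef t j.

Lemma ev_prefix_sum env mem t et j ej : rdyP mem -> holds_order N vs n mem -> t < n -> row t mem ->
  (forall k, stable mem (upd env 2 (Posz k)) et (Posz t)) ->
  (forall k, stable mem (upd env 2 (Posz k)) ej (Posz j)) ->
  ev N env mem (PrefixSum K et ej) = prefix_sum N occ vs t (coef t) (nth 0 vs t) j.
Proof.
move=> rdy ord tn rw etS ejS; apply: ev_sum => k kN; have etS' := etS k; have ejS' := ejS k.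
have kS : stable mem (upd env 2 (Posz k)) (EVar 2) (Posz k) by apply: stable_var.
rewrite (ev_if _ _ (p := occ k (nth 0 vs t) && (rank N occ vs t k <= rank N occ vs t j))).
  by case: ifP => // _; rewrite (ev_coef (t := t) (j := k)) ?rw //; apply: stable_ev.
apply: ev_band => [|_].
  apply: (ev_occurs K_gt0 K_N inp_N inp_enc) => // i; apply: ev_order => //; apply: stable_ev.
  by apply: stable_upd.
rewrite -ltnS -[(rank N occ vs t j).+1]addn1; apply: ev_blt.
  by apply: ev_rank => //; apply: ltnW.
by apply: ev_add => //; apply: ev_rank => //; apply: ltnW.
Qed.

Lemma ev_neg env mem e z : ev N env mem e = z -> ev N env mem (Eneg e) = neg_part z.
Proof. by move=> eE; cbn [ev Eneg]; rewrite eE. Qed.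

Definition rows t mem := forall t', t' <= t -> row t' mem.

Lemma row_inj t j t' j' : j < N -> j' < N -> (t * N + j == t' * N + j') = (t == t') && (j == j').
Proof.
move=> jN j'N; apply/eqP/andP => [E|[/eqP-> /eqP->] //].
have N0 : 0 < N by apply: leq_ltn_trans jN.
have jE : j = j' by have := congr1 (modn^~ N) E; rewrite !modnMDl !modn_small.
by move/eqP: E; rewrite jE eqn_add2r eqn_pmul2r // => ->.
Qed.

Lemma ex_coeffs env mem : rdyP mem -> holds_order N vs n mem -> row 0 mem ->
  let mem' := ex N env (coeffs_cmd K) mem in
  [/\ rdyP mem', holds_order N vs n mem' & rows n mem'].
Proof.
move=> rdy ord row0 mem'; rewrite /mem' /coeffs_cmd ex_for; set body := CIf _ _ _.
have tb : touches [:: 4] body by repeat constructor.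
suff H m : m <= N -> let mem1 := iter_for N env 0 body m mem in
    [/\ rdyP mem1, holds_order N vs n mem1 & rows (minn m n) mem1].
  by have := H N (leqnn _); rewrite (minn_idPr n_N).
elim: m => [_|m IH mN] /=.
  by rewrite iter_for0; split=> // t'; rewrite min0n leqn0 => /eqP->.
have [rdy1 ord1 rows1] := IH (ltnW mN); rewrite iter_forS.
set mem1 := iter_for N env 0 body m mem in rdy1 ord1 rows1 *.
rewrite {1 2 3}/body; set env1 := upd env 0 _.
have cE : ev N env1 mem1 (Blt (EVar 0) (In K (enat 0))) = bz (m < n).
  by apply: ev_blt => //; apply: (ev_n K_gt0 K_N inp_enc _ rdy1).
rewrite (ex_ifb _ _ cE); case: ltnP => mn; last first.
  by split=> //; rewrite (minn_idPr (leqW mn)); rewrite (minn_idPr mn) in rows1.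
rewrite (minn_idPl mn); rewrite (minn_idPl (ltnW mn)) in rows1.
rewrite ex_for; set put := Put _ _ _.
have inner p : p <= N -> let mem2 := iter_for N env1 1 put p mem1 in
    [/\ rdyP mem2, holds_order N vs n mem2, rows m mem2 &
        forall j, j < p -> arr N mem2 4 (m.+1 * N + j) = coef m.+1 j].
  elim: p => [|p IHp] pN /=; first by rewrite iter_for0.
  have [rdy2 ord2 rows2 new2] := IHp (ltnW pN); rewrite iter_forS.
  set mem2 := iter_for N env1 1 put p mem1 in rdy2 ord2 rows2 new2 *.
  set env2 := upd env1 1 _.
  have aE : ev N env2 mem2 (eadd (EBin Bmul (eadd (EVar 0) (enat 1)) ELim) (EVar 1)) =
      Posz (m.+1 * N + p).
    by rewrite /= /env2 /env1 /upd /=; lia.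
  have S0 k : stable mem2 (upd env2 2 (Posz k)) (EVar 0) (Posz m) by apply: stable_var.
  have S1 k : stable mem2 (upd env2 2 (Posz k)) (EVar 1) (Posz p) by apply: stable_var.
  have PS : ev N env2 mem2 (PrefixSum K (EVar 0) (EVar 1)) =
      prefix_sum N occ vs m (coef m) (nth 0 vs m) p.
    by apply: ev_prefix_sum => //; apply: rows2.
  have CE : ev N env2 mem2 (Coef (EVar 0) (EVar 1)) = coef m p.
    by rewrite (ev_coef (t := m) (j := p)) // rows2.
  have vE : ev N env2 mem2 (EIf (Occurs K (EVar 1) (Get 2 (EVar 0)))
        (esub (Eneg (PrefixSum K (EVar 0) (EVar 1)))
              (Eneg (esub (PrefixSum K (EVar 0) (EVar 1)) (Coef (EVar 0) (EVar 1)))))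
        (Coef (EVar 0) (EVar 1))) = coef m.+1 p.
    rewrite (ev_if _ _ (p := occ p (nth 0 vs m))); last first.
      by apply: (ev_occurs K_gt0 K_N inp_N inp_enc) => // i; apply: ev_order.
    rewrite CE /coef /= /eliminate -/coef; case: ifP => // _.
    rewrite -[LHS]/(ev N env2 mem2 (Eneg (PrefixSum K (EVar 0) (EVar 1))) -
      ev N env2 mem2 (Eneg (esub (PrefixSum K (EVar 0) (EVar 1)) (Coef (EVar 0) (EVar 1)))))%R.
    rewrite (ev_neg PS); congr (_ - _)%R; apply: ev_neg.
    by rewrite -[LHS]/(ev N env2 mem2 (PrefixSum K (EVar 0) (EVar 1)) -
      ev N env2 mem2 (Coef (EVar 0) (EVar 1)))%R PS CE.
  split.
  - by rewrite (ex_put _ _ aE); apply: ready_upd.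
  - by move=> t' t'n; rewrite (@arr_put _ _ _ _ _ _ (m.+1 * N + p)) //= ord2.
  - move=> t' t'm j jN; rewrite (@arr_put _ _ _ _ _ _ (m.+1 * N + p)) // eqxx andTb row_inj //.
    by rewrite ltn_eqF //= rows2.
  move=> j; rewrite ltnS leq_eqVlt => jp; have jN : j < N by lia.
  rewrite (@arr_put _ _ _ _ _ _ (m.+1 * N + p)) // eqxx andTb row_inj // eqxx andTb.
  by case: eqP jp => [-> //|_] /=; apply: new2.
have [rdy2 ord2 rows2 new2] := inner N (leqnn _); split=> //.
move=> t'; rewrite leq_eqVlt ltnS => /orP[/eqP->|]; last exact: rows2.
by move=> j jN; apply: new2.
Qed.

(** A decision for one variable thus leaves the gains at its own and at all later positions of the
    order unchanged, and decisions made in reverse order stay right. *)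
Lemma gain_ext t x x' : (forall b, remaining vs t.+1 b -> x b = x' b) ->
  gain N occ vs c0 t x = gain N occ vs c0 t x'.
Proof.
move=> xx'; rewrite /gain; apply: eq_bigr => j _; congr (if _ && _ then _ else _).
apply: eq_in_all => b _; case rb: (remaining _ _ _) => //=.
by rewrite xx'.
Qed.

Lemma ev_gain env mem t et (x : pred nat) : rdyP mem -> holds_order N vs n mem -> t < n -> row t mem ->
  (forall b, arr N mem 0 b = bz (x b)) ->
  (forall k, stable mem (upd env 2 (Posz k)) et (Posz t)) ->
  ev N env mem (Gain K et) = gain N occ vs c0 t x.
Proof.
move=> rdy ord tn rw xE etS; apply: ev_sum => k kN; have etS' := etS k.
have kS : stable mem (upd env 2 (Posz k)) (EVar 2) (Posz k) by apply: stable_var.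
rewrite (ev_if _ _ (p := occ k (nth 0 vs t) && sat N occ vs t.+1 x k)).
  by case: ifP => // _; rewrite (ev_coef (t := t) (j := k)) ?rw //; apply: stable_ev.
apply: ev_band => [|_].
  apply: (ev_occurs K_gt0 K_N inp_N inp_enc) => // i; apply: ev_order => //; apply: stable_ev.
  by apply: stable_upd.
have -> : sat N occ vs t.+1 x k =
    ~~ has (fun b => (remaining vs t.+1 b && occ k b) && ~~ x b) (iota 0 N).
  by rewrite -all_predC; apply: eq_all => b /=; rewrite negb_and negbK implybE.
apply: ev_bnot; apply: ev_bex => b bN; apply: ev_band => [|_].
  apply: ev_rem_occ => // env' eE; rewrite -(addn1 t); apply: ev_add => //.
  exact: etS'.
by apply: ev_bnot; rewrite (@ev_get _ _ _ _ _ b) // xE.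
Qed.

Lemma ex_back env mem : rdyP mem -> holds_order N vs n mem -> rows n mem ->
  (forall b, arr N mem 0 b = 0%R) ->
  exists x : pred nat, (forall b, arr N (ex N env (back_cmd K) mem) 0 b = bz (x b)) /\
    forall t, t < n -> x (nth 0 vs t) = (gain N occ vs c0 t x < 0)%R.
Proof.
move=> rdy ord rws zero; rewrite /back_cmd; set et := esub _ _; rewrite ex_for; set body := CIf _ _ _.
have tb : touches [:: 0] body by repeat constructor.
suff H m : let mem1 := iter_for N env 0 body m mem in [/\ rdyP mem1, holds_order N vs n mem1, rows n mem1 &
    exists x : pred nat, (forall b, arr N mem1 0 b = bz (x b)) /\
      forall t, t < n -> n - m <= t -> x (nth 0 vs t) = (gain N occ vs c0 t x < 0)%R].
  have [_ _ _ [x [xE xP]]] := H N; exists x; split=> // t tn; apply: xP => //.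
  by have := n_N; rewrite -subn_eq0 => /eqP->.
elim: m => [|m [rdy1 ord1 rows1 [x [xE xP]]]] /=.
  rewrite iter_for0; split=> //; exists pred0; split=> // t tn.
  by rewrite subn0 leqNgt tn.
rewrite iter_forS; set mem1 := iter_for N env 0 body m mem in rdy1 ord1 rows1 xE *.
set env1 := upd env 0 _.
have cE : ev N env1 mem1 (Blt (EVar 0) (In K (enat 0))) = bz (m < n).
  by apply: ev_blt => //; apply: (ev_n K_gt0 K_N inp_enc _ rdy1).
rewrite {1 2 3 4}/body (ex_ifb _ _ cE); case: ltnP => mn; last first.
  by split=> //; exists x; split=> // t tn nm; apply: xP => //; lia.
set put := Put _ _ _; have tp : touches [:: 0] put by constructor.
pose t0 := n - m.+1; have t0n : t0 < n by rewrite /t0; lia.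
have etE env' : env' 0 = Posz m -> ev N env' mem1 et = Posz t0.
  move=> e0; have nE := ev_n K_gt0 K_N inp_enc env' rdy1.
  rewrite -[LHS]/(ev N env' mem1 (In K (enat 0)) - (env' 0 + 1))%R nE e0 /t0; lia.
have aE : ev N env1 mem1 (Get 2 et) = Posz (nth 0 vs t0) by apply: ev_order => //; apply: etE.
have gE : ev N env1 mem1 (Gain K et) = gain N occ vs c0 t0 x.
  apply: ev_gain => //; first by apply: rows1; apply: ltnW.
  by move=> k env' e'E; apply: etE; rewrite e'E.
have vE : ev N env1 mem1 (EIf (esub (enat 0) (Gain K et)) (enat 1) (enat 0)) =
    bz (gain N occ vs c0 t0 x < 0)%R.
  rewrite -[LHS]/(if (0 < 0 - ev N env1 mem1 (Gain K et))%R then 1%R else 0%R) gE sub0r oppr_gt0.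
  by case: ifP.
split.
- by apply: (ready_frame K_gt0 K_N inp_N inp_enc _ tp).
- by move=> t tn; rewrite (touches_arr _ _ _ _ tp) // ord1.
- by move=> t tn j jN; rewrite (touches_arr _ _ _ _ tp) // rows1.
pose x' b := if b == nth 0 vs t0 then (gain N occ vs c0 t0 x < 0)%R else x b.
have x'E t : t0 <= t -> t < n -> gain N occ vs c0 t x' = gain N occ vs c0 t x.
  move=> t0t tn; apply: gain_ext => b rb; rewrite /x'; case: eqP => // bE.
  move: rb; rewrite bE /remaining => /negP[]; apply/(nthP 0); exists t0.
    by rewrite size_takel ?vs_n.
  by rewrite nth_take.
exists x'; split=> [b|t tn nm].
  by rewrite (@arr_put _ _ _ _ _ _ (nth 0 vs t0)) // eqxx andTb /x' vE xE; case: eqP.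
rewrite x'E //; case: (eqVneq t t0) => [->|tt0]; first by rewrite /x' eqxx.
rewrite /x' nth_uniq ?vs_n // (negPf tt0); apply: xP => //.
by move: tt0 nm; rewrite /t0; lia.
Qed.

End EliminationCmd.

(** * From integral minima to the rational objective *)

Lemma bitlen_small b z : bitlen z <= b -> small b z.
Proof.
move=> zb; apply: (small_leq zb); rewrite /small /bitlen.
exact: trunc_log_ltn.
Qed.

Lemma denominators_gt0 n (s : seq {set 'I_n}) (a : {set 'I_n} -> rat) k : (0 < denominators s a k)%R.
Proof. by apply: prodr_gt0 => j _; apply: denq_gt0. Qed.

Lemma scaledE n (s : seq {set 'I_n}) (a : {set 'I_n} -> rat) j : j < size s ->
  ((scaled s a j)%:~R = (denominators s a (size s))%:~R * a (nth set0 s j))%R.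
Proof.
move=> js; rewrite /scaled js; set D := denominators _ _ _; set q := a _.
have /divzK dD : (denq q %| D)%Z.
  by rewrite /D /denominators big_mkord (bigD1 (Ordinal js)) //=; apply: dvdz_mulr.
rewrite intrM -{2}dD intrM -mulrA; congr (_ * _)%R.
by rewrite numqE mulrC.
Qed.

Lemma sat0E N n (s : seq {set 'I_n}) vs (x : pred nat) j : n <= N ->
  sat N (occurs s) vs 0 x j = [forall i in nth set0 s j, x (val i)].
Proof.
move=> nN; apply/allP/forall_inP => [H i ij|H b _].
  have := H (val i); rewrite mem_iota /= (leq_trans (ltn_ord i)) //.
  by rewrite occursE ij /remaining take0 => /(_ isT).
apply/implyP => /andP[_ ob]; have /andP[_ bn] := occurs_lt ob.
by apply: (H (Ordinal bn)); rewrite -occursE.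
Qed.

Lemma objective_partial_min N n (s : seq {set 'I_n}) (a : {set 'I_n} -> rat) vs (x : pred nat) :
  n <= N -> size s <= N -> uniq s ->
  ((partial_min N (occurs s) vs (scaled s a) 0 x)%:~R =
   (denominators s a (size s))%:~R * objective [set m in s] a (fun i => x (val i)))%R.
Proof.
(* Indices from [size s] on carry the coefficient 0. *)
move=> nN sN us; rewrite /partial_min (big_cat_nat (n := size s)) //=.
rewrite [X in (_ + X)%R]big_nat_cond [X in (_ + X)%R]big1 ?addr0; last first.
  by move=> j /andP[/andP[sj _] _]; rewrite /scaled ltnNge sj /=; case: ifP.
have -> : objective [set m in s] a (fun i => x (val i)) =
    (\sum_(m <- s) a m * \prod_(i in m) (if x (val i) then 1 else 0))%R.
  by rewrite /objective big_uniq //; apply: eq_bigl => m; rewrite inE.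
rewrite (big_nth set0) mulr_sumr rmorph_sum /= !big_nat; apply: eq_bigr => j /andP[_ js].
rewrite sat0E //; case: ifP => [/forall_inP xj|/negbT].
  by rewrite scaledE // big1 ?mulr1 // => i /xj ->.
rewrite negb_forall_in => /existsP[i /andP[ij /negPf xi]].
by rewrite (bigD1 i) //= xi mul0r !mulr0.
Qed.

Definition opt_cmd K : cmd :=
  CSeq (offsets K) (CSeq (order_cmd K) (CSeq (scale_cmd K) (CSeq (coeffs_cmd K) (back_cmd K)))).

Section OptCmd.
Variables (K N n : nat) (s : seq {set 'I_n}) (inp : seq int) (a : {set 'I_n} -> rat).
Hypotheses (K_gt0 : 0 < K) (K_N : 2 * K <= N + 2) (inp_N : size inp <= N) (n_N : n <= N).
Hypothesis inp_a : inp = enc_inst s a.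
Hypotheses (s_uniq : uniq s) (s_ne0 : all (fun m => m != set0) s).
Hypothesis s_mip : monomial_intersection_property [set m in s].

Let inp_enc : encodes s inp.
Proof. by rewrite inp_a; eexists. Qed.

(** The [plainc] premises are settled by computation once [K] is a numeral; [scale_cmd] is handled
    by [safe_scale]. *)
Lemma ex_opt b z0 env mem : small b (Posz z0) -> small b (Posz N) ->
  plainc z0 (offsets K) -> plainc z0 (order_cmd K) -> plainc z0 (coeffs_cmd K) ->
  plainc z0 (back_cmd K) -> 8 <= z0 -> 2 * K <= z0 -> (forall i, small b (nth 0%R inp i)) ->
  holds_input K N mem inp -> (forall A x, A < 8 -> arr N mem A x = 0%R) ->
  safec N b env mem (opt_cmd K) /\
  exists x : pred nat, (forall i, arr N (ex N env (opt_cmd K) mem) 0 i = bz (x i)) /\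
    forall y : 'I_n -> bool,
      (objective [set m in s] a (fun i => x (val i)) <= objective [set m in s] a y)%R.
Proof.
move=> z0b Nb p1 p2 p4 p5 z8 zK inpb hin zero.
have T0 : set0 \notin [set m in s].
  by rewrite inE; apply/negP => /(allP s_ne0); rewrite eqxx.
have acyc := (mip_acyclic T0).1 s_mip.
have sN : size s <= N := leq_trans (size_leq_offset s) (leq_trans (enc_size inp_enc) inp_N).
have pl c env' mem' : plainc z0 c -> safec N b env' mem' c by exact: plainc_safe.
pose m1 := ex N env (offsets K) mem; pose m2 := ex N env (order_cmd K) m1.
pose m3 := ex N env (scale_cmd K) m2; pose m4 := ex N env (coeffs_cmd K) m3.
have t1 : touches [:: 1] (offsets K) by repeat constructor.
have t2 := touches_order K.
have t3 : touches [:: 3; 4] (scale_cmd K) by repeat constructor.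
have t4 : touches [:: 4] (coeffs_cmd K) by repeat constructor.
have rdy1 : ready K N s inp m1 by apply: ex_offsets.
have [vs [vs_n [vs_uniq vs_lt nests] ord2]] := ex_order K_gt0 K_N inp_N inp_enc n_N
  (fun vs' => nest_point_exists N acyc (vs := vs')) env rdy1.
rewrite -/m2 in ord2.
have rdy2 : ready K N s inp m2 by apply: (ready_frame K_gt0 K_N inp_N inp_enc _ t2).
have zero4 j : arr N m2 4 j = 0%R.
  by rewrite /m2 (touches_arr _ _ _ _ t2) // /m1 (touches_arr _ _ _ _ t1) // zero.
have [rdy3 row3] := ex_scale K_gt0 K_N inp_N inp_a env rdy2 zero4.
rewrite -/m3 in rdy3 row3.
have ord3 : holds_order N vs n m3.
  by move=> t tn; rewrite /m3 (touches_arr _ _ _ _ t3) // ord2.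
have [|rdy4 ord4 rows4] := ex_coeffs (c0 := scaled s a) K_gt0 K_N inp_N inp_enc n_N vs_n vs_uniq vs_lt env rdy3 ord3.
  by move=> j jN; rewrite mul0n add0n row3.
rewrite -/m4 in rdy4 ord4 rows4.
have zero0 j : arr N m4 0 j = 0%R.
  rewrite /m4 (touches_arr _ _ _ _ t4) // /m3 (touches_arr _ _ _ _ t3) //.
  by rewrite /m2 (touches_arr _ _ _ _ t2) // /m1 (touches_arr _ _ _ _ t1) // zero.
have [x [xE x_opt]] := ex_back K_gt0 K_N inp_N inp_enc n_N vs_n vs_uniq vs_lt env rdy4 ord4 rows4 zero0.
have safe3 : safec N b env m2 (scale_cmd K).
  by apply: (safe_scale (z0 := z0) K_gt0 K_N inp_N inp_a).
split; first by split; [exact: pl | split; [exact: pl | split; [exact: safe3 | split; exact: pl]]].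
exists x; split=> // y.
(* The elimination works with points on all natural numbers; the value outside the range is
   immaterial. *)
pose y' b := oapp y false (insub b).
have -> : objective [set m in s] a y = objective [set m in s] a (fun i => y' (val i)).
  by apply: eq_bigr => m _; congr (_ * _)%R; apply: eq_bigr => i _; rewrite /y' valK.
have D0 := denominators_gt0 s a (size s).
(* The positive common denominator turns the comparison into one between integers. *)
rewrite -(ler_pM2l (x := (denominators s a (size s))%:~R)) ?ltr0z //.
rewrite -!(objective_partial_min a vs _ n_N sN s_uniq) ler_int.
apply: back_substitution_optimal => //.
- by apply: sub_all vs_lt => v vn; apply: leq_trans n_N.
- move=> j c ojc; have /andP[_ cn] := occurs_lt ojc.
  have [||_ ->] := uniq_min_size (s2 := iota 0 n) vs_uniq; last by rewrite mem_iota.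
    by move=> v /(allP vs_lt); rewrite mem_iota.
  by rewrite size_iota vs_n.
- by move=> t; rewrite vs_n; apply: x_opt.
Qed.

End OptCmd.

Lemma enc_inst_small n (s : seq {set 'I_n}) (a : {set 'I_n} -> rat) i b :
  n + size s + \sum_(m <- s) ratsize (a m) <= b -> small b (nth 0%R (enc_inst s a) i).
Proof.
move=> nb; rewrite /enc_inst nth_cat; case: ifP => _.
  by apply: enc_monos_small; apply: leq_trans nb; apply: leq_addr.
have : \sum_(m <- s) ratsize (a m) <= b by apply: leq_trans nb; apply: leq_addl.
move: (i - _) => k; elim: s k {nb} => [|m s IH] k.
  by rewrite nth_nil /small expn_gt0.
rewrite big_cons /ratsize => le; case: k => [|[|k]] /=.
- by apply: bitlen_small; lia.
- by apply: bitlen_small; lia.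
- by apply: IH; rewrite /ratsize; lia.
Qed.

Lemma mip_optimization_poly : exists (P : seq instr) (c : nat),
  forall (n : nat) (s : seq {set 'I_n}) (a : {set 'I_n} -> rat),
    uniq s -> all (fun m => m != set0) s ->
    monomial_intersection_property [set m in s] ->
    runs_within P (enc_inst s a)
      (c * (size s + n + \sum_(m <- s) ratsize (a m)).+1 ^ c)
      (fun Rf => (forall i : 'I_n, Rf (val i).+1 = 0%R \/ Rf (val i).+1 = 1%R) /\
         forall y : 'I_n -> bool,
           (objective [set m in s] a (fun i => Rf (val i).+1 == 1%R)
            <= objective [set m in s] a y)%R).
Proof.
have [q qP] := cost_poly (opt_cmd ntemps).
exists (compile ntemps (opt_cmd ntemps)), q => n s a s_uniq s_ne0 s_mip.
set inp := enc_inst s a; set w := \sum_(m <- s) _.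
pose M := size inp + n; pose b := M + (size s + n + w) + (ntemps + 4).
have szE : size inp = offset s (size s) + 2 * size s by exact: size_enc_inst.
have inp_gt0 : 1 < size inp by [].
have K_N : 2 * ntemps <= lim ntemps M + 2.
  have -> : M = M.-1.+1 by rewrite prednK // /M; lia.
  exact: lim_geq.
have M_N := leq_lim M.
have inp_N : size inp <= lim ntemps M by apply: leq_trans M_N; rewrite leq_addr.
have n_N : n <= lim ntemps M by apply: leq_trans M_N; rewrite leq_addl.
have b_M : ntemps + 4 + M <= b by rewrite /b; lia.
have inp_small i : small b (nth 0%R inp i) by apply: enc_inst_small; rewrite -/w /b; lia.
have const_b : small b (Posz (ntemps + 8 * (ntemps - 2))) by apply: const_small; rewrite /b; lia.
have [|||||||||fuel [Rf [c [exP [c_le [X [x [XE x_opt]] RX]]]]]] :=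
  @compile_ok ntemps (opt_cmd ntemps) n inp b
  (fun X => exists x : pred nat, (forall i, X i = bz (x i)) /\
    forall y : 'I_n -> bool,
      (objective [set m in s] a (fun i => x (val i)) <= objective [set m in s] a y)%R).
- by [].
- by [].
- exact: ltnW.
- by [].
- by rewrite /b; lia.
- exact: lim_small.
- exact: const_b.
- exact: inp_small.
- move=> env mem hin zero.
  by apply: (@ex_opt ntemps (lim ntemps M) n s inp a _ _ _ _ _ _ _ _ b
    (ntemps + 8 * (ntemps - 2))) => //; apply: lim_small.
have RE (i : 'I_n) : Rf (val i).+1 = bz (x (val i)).
  by rewrite RX ?XE //; apply: leq_trans (ltn_ord i) n_N.
exists fuel, Rf, c; split=> //; split.
  apply: leq_trans c_le _; apply: qP => //.
  by rewrite /M szE; have := offset_size s; nia.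
split=> [i|y]; first by rewrite RE; case: (x _); [right | left].
have -> : objective [set m in s] a (fun i => Rf (val i).+1 == 1%R) =
    objective [set m in s] a (fun i => x (val i)).
  apply: eq_bigr => m _; congr (_ * _)%R; apply: eq_bigr => i _.
  by rewrite RE; case: (x _).
exact: x_opt.
Qed.

Theorem theorem5p4 :
  (* (a) the monomial intersection property is decidable in time
         polynomial in |T| and n *)
  (exists (P : seq instr) (c : nat),
     forall (n : nat) (s : seq {set 'I_n}),
       uniq s -> all (fun m => m != set0) s ->
       runs_within P (enc_monos s) (c * (size s + n).+1 ^ c)
         (fun Rf => (Rf 1%N = 0%R \/ Rf 1%N = 1%R) /\
                    (Rf 1%N = 1%R <-> monomial_intersection_property [set m in s])))
  /\
  (* (b) under the property, min over x in {0,1}^n of the polynomial is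
         solvable in polynomial time (output: an optimal x in R_1..R_n) *)
  (exists (P : seq instr) (c : nat),
     forall (n : nat) (s : seq {set 'I_n}) (a : {set 'I_n} -> rat),
       uniq s -> all (fun m => m != set0) s ->
       monomial_intersection_property [set m in s] ->
       runs_within P (enc_inst s a)
         (c * (size s + n + \sum_(m <- s) ratsize (a m)).+1 ^ c)
         (fun Rf => (forall i : 'I_n, Rf (val i).+1 = 0%R \/ Rf (val i).+1 = 1%R) /\
            forall y : 'I_n -> bool,
              (objective [set m in s] a (fun i => Rf (val i).+1 == 1%R)
               <= objective [set m in s] a y)%R)).
Proof. by split; [exact: mip_decidable_poly | exact: mip_optimization_poly]. Qed.
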